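(* Let $\mathcal{L}:\mathbb{R}^n\times\mathbb{R}^n\to\mathbb{R}$, $(q,v)\mapsto\mathcal{L}(q,v)$, be a smooth (autonomous) Lagrangian such that for some $\ell_0>0$, $D^2_{vv}\mathcal{L}(q,v)\ge\ell_0 I$ as quadratic forms for all $(q,v)\in\mathbb{R}^n\times\mathbb{R}^n$. Let $u^-,u^+\in\mathbb{R}^n$ satisfy $\nabla\mathcal{L}(u^\pm,0)=0$, and let $u^*$ be a nonconstant $C^2$ solution of $$\frac{d}{dt}\partial_v\mathcal{L}(u(t),\dot u(t))=\partial_q\mathcal{L}(u(t),\dot u(t)),\quad t\in\mathbb{R},\qquad \lim_{t\to-\infty}u(t)=u^-,\quad\lim_{t\to+\infty}u(t)=u^+.$$ Put $P(t)=\partial_{vv}\mathcal{L}(u^*(t),\dot u^*(t))$, $Q(t)=\big(\partial_{v_i}\partial_{q_j}\mathcal{L}(u^*(t),\dot u^*(t))\big)_{i,j}$, $R(t)=\partial_{qq}\mathcal{L}(u^*(t),\dot u^*(t))$, and consider the operator $$Aw:=-\frac{d}{dt}\big(P(t)\dot w(t)+Q(t)w(t)\big)+Q^\top(t)\dot w(t)+R(t)w(t),\qquad\operatorname{dom}(A)=W^{2,2}(\mathbb{R},\mathbb{R}^n).$$ Assume that: (L1) $P(t),Q(t),R(t)$ converge to limits $P_\pm,Q_\pm,R_\pm$ as $t\to\pm\infty$, and there are constants $C_1,C_2,C_3>0$ such that for all $t\in\mathbb{R}$: $\langle P(t)v,v\rangle\ge C_1|v|^2$ for all $v\in\mathbb{R}^n$,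 $\|Q(t)\|\le C_2$ and $\|R(t)\|\le C_3$; (L2) the block matrices $\begin{pmatrix}P_-&Q_-\\Q_-^\top&R_-\end{pmatrix}$ and $\begin{pmatrix}P_+&Q_+\\Q_+^\top&R_+\end{pmatrix}$ are both positive definite. Then the number of critical points of $u^*$ is a lower bound for the Morse index of $A$: $$\#\{t\in\mathbb{R}:\dot u^*(t)=0\}\le\mathrm{m}^-(A).$$
   Context: $\mathrm{m}^-(A)$ (Morse index) is the number of negative eigenvalues of the self-adjoint operator $A$ on $L^2(\mathbb{R},\mathbb{R}^n)$, counted with multiplicity. *)

(* Defs.v *)
From HB Require Import structures.
From mathcomp Require Import all_boot all_order all_algebra.
From mathcomp Require Import all_classical all_reals all_analysis.
Set Implicit Arguments.
Unset Strict Implicit.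
Unset Printing Implicit Defensive.
Import Order.TTheory GRing.Theory Num.Theory.
Import numFieldNormedType.Exports.
Local Open Scope ring_scope.
Local Open Scope classical_set_scope.

(* The library norm on matrices is the sup norm; [l2norm] is the Euclidean one. *)
Definition dot (R : realType) (n : nat) (x y : 'cV[R]_n) : R :=
  \sum_i x i 0 * y i 0.

Definition l2norm (R : realType) (n : nat) (x : 'cV[R]_n) : R :=
  Num.sqrt (dot x x).

(* Symmetry is not part of the definition: the matrices it is applied to are
   limits of Hessians of a smooth function. *)
Definition posdef (R : realType) (n : nat) (M : 'M[R]_n) : Prop :=
  forall x : 'cV[R]_n, x != 0 -> 0 < dot (M *m x) x.

(* C^k through iterated directional derivatives; to be used for
   finite-dimensional [V] only, where it agrees with Frechet C^k. *)
Fixpoint Ck (R : realType) (V W : normedModType R) (k : nat) (f : V -> W)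
    {struct k} : Prop :=
  continuous f /\
  (if k is k'.+1 then
     forall v : V, (forall x, derivable f x v) /\ Ck k' (fun x => 'D_v f x)
   else True).

Definition smooth (R : realType) (V W : normedModType R) (f : V -> W) : Prop :=
  forall k, Ck k f.

Section Lagrangian.
Variables (R : realType) (n : nat).
Local Notation vec := 'cV[R]_n.
Variable L : vec * vec -> R.

Definition dirq (i : 'I_n) : vec * vec := (delta_mx i 0, 0).
Definition dirv (i : 'I_n) : vec * vec := (0, delta_mx i 0).

Definition gradq (z : vec * vec) : vec := \col_i 'D_(dirq i) L z.
Definition gradv (z : vec * vec) : vec := \col_i 'D_(dirv i) L z.

Definition hess_vv (z : vec * vec) : 'M[R]_n :=
  \matrix_(i, j) 'D_(dirv i) (fun y => 'D_(dirv j) L y) z.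
Definition hess_vq (z : vec * vec) : 'M[R]_n :=
  \matrix_(i, j) 'D_(dirv i) (fun y => 'D_(dirq j) L y) z.
Definition hess_qq (z : vec * vec) : 'M[R]_n :=
  \matrix_(i, j) 'D_(dirq i) (fun y => 'D_(dirq j) L y) z.

Definition EulerLagrange (u : R -> vec) : Prop :=
  forall t : R,
    is_derive t (1 : R) (fun s => gradv (u s, u^`() s)) (gradq (u t, u^`() t)).

Definition coefP (u : R -> vec) (t : R) := hess_vv (u t, u^`() t).
Definition coefQ (u : R -> vec) (t : R) := hess_vq (u t, u^`() t).
Definition coefR (u : R -> vec) (t : R) := hess_qq (u t, u^`() t).
End Lagrangian.

(* Elements of L^2(R, R^n) are represented by functions; identification up to
   Lebesgue-null sets is made explicit wherever it matters. *)
Section L2operators.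
Variables (R : realType) (n : nat).
Local Notation vec := 'cV[R]_n.
Local Notation mu := (@lebesgue_measure R).

Definition inL2 (w : R -> vec) : Prop :=
  forall i, (fun t => w t i 0) \in Lfun mu 2%:E.

Definition test_function (phi : R -> R) : Prop :=
  smooth phi /\ compact (closure [set t | phi t != 0]).

(* [w] belongs to W^{1,2}(R, R^n) and [g] is its weak derivative. *)
Definition W12 (w g : R -> vec) : Prop :=
  [/\ inL2 w, inL2 g &
      forall phi, test_function phi -> forall i,
        (\int[mu]_t (w t i 0 * phi^`()%classic t) = - \int[mu]_t (g t i 0 * phi t))%R].

Definition W22 (w : R -> vec) : Prop :=
  exists w1 w2, W12 w w1 /\ W12 w1 w2.

(* Operators on L^2 are given by their graphs: [SLop P Q S w f] means that [w]
   is in the domain W^{2,2} and that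
   f = - (P w' + Q w)' + Q^T w' + S w in L^2,
   with [w1] and [g] the weak derivatives of [w] and of P w' + Q w. *)
Definition SLop (P Q S : R -> 'M[R]_n) (w f : R -> vec) : Prop :=
  [/\ W22 w, inL2 f &
      exists w1 g : R -> vec,
      [/\ W12 w w1,
          W12 (fun t => P t *m w1 t + Q t *m w t) g &
          {ae mu, forall t, f t = - g t + (Q t)^T *m w1 t + S t *m w t}]].

Definition lin_indep (k : nat) (w : 'I_k -> R -> vec) : Prop :=
  forall c : 'I_k -> R,
    {ae mu, forall t, \sum_i c i *: w i t = 0} -> forall i, c i = 0.

Variable A : (R -> vec) -> (R -> vec) -> Prop.

Definition eigenfunction (l : R) (w : R -> vec) : Prop :=
  A w (fun t => l *: w t).

Definition is_eigenvalue (l : R) : Prop :=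
  exists w, eigenfunction l w /\ ~ {ae mu, forall t, w t = 0}.

(* dim ker (A - l), possibly +oo *)
Definition multiplicity (l : R) : \bar R :=
  ereal_sup [set k%:R%:E | k in [set k : nat |
    exists w : 'I_k -> R -> vec,
      lin_indep w /\ forall i, eigenfunction l (w i)]].

Definition morse_index : \bar R :=
  \esum_(l in [set l | l < 0 /\ is_eigenvalue l]) multiplicity l.
End L2operators.

(* Main.v *)
Require Import Defs.
From HB Require Import structures.
From mathcomp Require Import all_boot all_order all_algebra.
From mathcomp Require Import all_classical all_reals all_analysis.
From mathcomp Require Import measurable_realfun ring lra.
Import Order.TTheory GRing.Theory Num.Theory.
Import numFieldNormedType.Exports.
Local Open Scope ring_scope.
Local Open Scope classical_set_scope.

(* The velocity v = u' satisfies the linearized equation A v = 0. If v vanishes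
   at t_1, ..., t_k, the functions v_j = v 1_(t <= t_j) belong to W^{1,2}, because
   the coercivity of the form of A at -oo and the boundedness of
   (P v' + Q v) . v force v and v' to be square integrable there.
   Integrating by parts, the index form satisfies
   q(v_j, w) = (P v')(t_j) . w(t_j) for all w in W^{1,2}. Hence the v_j span a
   subspace on which q vanishes identically and which meets the kernel of q only
   in 0: by uniqueness for the linearized equation v'(t_j) <> 0, and w can be
   localized near one t_j. Such a subspace forces k negative eigenvalues. They are
   obtained one at a time by minimizing the Rayleigh quotient, whose minimizers
   exist because q is coercive up to a term concentrated on a compact interval,
   where bounded sequences of W^{1,2} are compact; weak eigenfunctions lie in
   W^{2,2} because P, Q and P^-1 are C^1 with bounded derivatives, which rests on
   conservation of energy. *)

(** Neither a compact embedding theorem nor the spectral theorem enters. On the interval [[- T, T]]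
    where coercivity may fail, a Poincare inequality on a fine grid bounds the L^2 mass by finitely
    many point values plus a small multiple of the derivative, so compactness is needed only for
    bounded vectors of such values. Elements of W^{1,2} are pairs (function, derivative) satisfying
    [ibp], for which point values make sense. A minimizer is only an L^2 limit of such pairs;
    instead of repairing it on a null set, eigenfunctions are sought in the closure [W12limit], to
    which every identity given by an L^2 pairing extends. Once some eigenfunctions are known, the
    form is deflated by their projections: their eigenvalues become 0, so a negative minimum yields
    an eigenfunction orthogonal to them without constrained minimization. Since u is only C^2, v' is
    merely continuous; what can be differentiated is P v' + Q v, which is the derivative of the
    momentum and, by the Euler-Lagrange equation, the q-gradient of L along the curve. Uniqueness
    and integrations by parts are therefore carried out in the variables (v, P v' + Q v). *)

Set Implicit Arguments.
Unset Strict Implicit.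
Unset Printing Implicit Defensive.

(** * Square integrable functions *)

Section SquareIntegrable.
Variable R : realType.
Local Notation mu := (@lebesgue_measure R).
Implicit Types f g h : R -> R.

Definition L2 f : Prop := f \in Lfun mu 2%:E.

Lemma L2P f : L2 f <-> measurable_fun setT f /\
  mu.-integrable setT (EFin \o (fun x => f x ^+ 2)).
Proof.
split=> [lf|[mf /integrableP[_ fi]]].
  split; last exact: Lfun2_integrable_sqr.
  by move: lf; rewrite /L2 inE => /andP[]; rewrite inE.
rewrite /L2 inE; apply/andP; split; rewrite inE//= /finite_norm unlock.
rewrite poweR_lty//; apply: le_lt_trans fi.
rewrite le_eqVlt; apply/orP; left; apply/eqP; apply: eq_integral => x _ /=.
by rewrite powR_mulrn // normrX.
Qed.

Lemma L2_measurable f : L2 f -> measurable_fun setT f.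
Proof. by case/L2P. Qed.

Lemma L2_sqr f : L2 f -> mu.-integrable setT (EFin \o (fun x => f x ^+ 2)).
Proof. by case/L2P. Qed.

Lemma L2_mul f g : L2 f -> L2 g ->
  mu.-integrable setT (EFin \o (fun x => f x * g x)).
Proof.
by move=> lf lg; apply/(@Lfun1_integrable _ _ R mu); apply: Lfun2_mul_Lfun1.
Qed.

Lemma L2_dom f g : measurable_fun setT f -> L2 g ->
  (forall x, `|f x| <= `|g x|) -> L2 f.
Proof.
move=> mf /L2P[mg gi] fg; apply/L2P; split=> //.
apply: (le_integrable _ _ _ gi) => //.
  by apply/measurable_EFinP; exact: measurable_funX.
by move=> x _ /=; rewrite lee_fin !normrX lerXn2r ?nnegrE.
Qed.

Lemma L2D f g : L2 f -> L2 g -> L2 (fun x => f x + g x).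
Proof.
move=> lf lg; apply/L2P; split.
  by apply: measurable_funD; exact: L2_measurable.
have := integrableD measurableT (L2_sqr lf) (L2_sqr lg).
move=> /(integrableZl (@measurableT _ _) 2) ; apply: le_integrable => //.
  apply/measurable_EFinP/measurable_funX.
  by apply: measurable_funD; exact: L2_measurable.
move=> x _; change (`|((f x + g x) ^+ 2)|%:E <= `|2 * (f x ^+ 2 + g x ^+ 2)|%:E)%E; rewrite lee_fin !ger0_norm ?sqr_ge0 ?mulr_ge0 ?addr_ge0 ?sqr_ge0 //.
by have := sqr_ge0 (f x - g x); rewrite !expr2; lra.
Qed.

Lemma L2Mb f g (C : R) : measurable_fun setT f -> (forall x, `|f x| <= C) ->
  L2 g -> L2 (fun x => f x * g x).
Proof.
move=> mf fC lg; have C0 : 0 <= C by apply: le_trans (fC 0).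
have l2 : L2 (fun x => C * g x).
  apply/L2P; split; first exact: measurable_funM (L2_measurable lg).
  have := integrableZl (@measurableT _ _) (C ^+ 2) (L2_sqr lg).
  by apply: eq_integrable => // x _ /=; rewrite exprMn EFinM.
apply: L2_dom l2 _; first exact: measurable_funM (L2_measurable lg).
by move=> x; rewrite !normrM ler_wpM2r // (ger0_norm C0).
Qed.

Lemma L2Z (k : R) f : L2 f -> L2 (fun x => k * f x).
Proof. by move=> lf; apply: (@L2Mb (cst k) f `|k|). Qed.

Lemma L2N f : L2 f -> L2 (fun x => - f x).
Proof.
move=> /(L2Z (-1)); congr L2; apply/funext => x; by rewrite mulN1r.
Qed.

Lemma L2B f g : L2 f -> L2 g -> L2 (fun x => f x - g x).
Proof. by move=> lf lg; apply: L2D lf (L2N lg). Qed.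

Lemma L2_0 : L2 (cst 0).
Proof.
apply/L2P; split; first exact: measurable_cst.
have := @integrable0 _ _ R mu setT; apply: eq_integrable => // x _ /=.
by rewrite expr0n.
Qed.

Lemma L2_sum (I : Type) (r : seq I) (P : pred I) (F : I -> R -> R) :
  (forall i, P i -> L2 (F i)) -> L2 (fun x => \sum_(i <- r | P i) F i x).
Proof.
move=> lF; elim: r => [|i r IH].
  by under eq_fun do rewrite big_nil; exact: L2_0.
under eq_fun do rewrite big_cons.
by have [/lF lFi|//] := boolP (P i); apply: (L2D lFi IH).
Qed.

Lemma Rint_ge0 f : (forall x, 0 <= f x) -> 0 <= \int[mu]_x f x.
Proof. by move=> f0; apply: Rintegral_ge0 => x _. Qed.

Lemma EFin_Rint f : mu.-integrable setT (EFin \o f) ->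
  (\int[mu]_x f x)%:E = (\int[mu]_x (f x)%:E)%E.
Proof. by move=> fi; rewrite /Rintegral fineK//; exact: integrable_fin_num. Qed.

Lemma ae_imp (P Q : R -> Prop) : (forall x, P x -> Q x) ->
  {ae mu, forall x, P x} -> {ae mu, forall x, Q x}.
Proof.
by move=> PQ; apply: negligibleS => x /= nQ Px; apply: nQ; exact: PQ.
Qed.

Lemma ae_Rint f g : measurable_fun setT f -> measurable_fun setT g ->
  {ae mu, forall x, f x = g x} -> \int[mu]_x f x = \int[mu]_x g x.
Proof.
move=> mf mg fg; congr fine; apply: ae_eq_integral => //.
- exact/measurable_EFinP.
- exact/measurable_EFinP.
- by move: fg; apply: ae_imp => x /= fgx _; rewrite fgx.
Qed.

Lemma cvg_sumgeom (f : nat -> R) (M : R) :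
  (forall i, `|f i - f i.+1| <= M * 2^-1 ^+ i) -> cvgn f.
Proof.
move=> fM.
have -> : f = (fun n => f 0%N) \+ series (telescope f).
  by rewrite telescopeK; apply/funext => n /=; rewrite subrKC.
apply: is_cvgD; first exact: is_cvg_cst.
apply: normed_cvg; apply: (@series_le_cvg _ _ (geometric M 2^-1)).
- by move=> n; apply: normr_ge0.
- by move=> n; apply: le_trans (fM n).
- by move=> n; rewrite /= distrC; apply: fM.
- by apply: cvgP; apply: cvg_geometric_series; rewrite gtr0_norm //; lra.
Qed.

(** Fatou's lemma for real-valued integrals. It yields integrability of the limit as well, without
    any dominating function; it serves both for completeness and for exhausting half-lines by
    bounded windows. *)
Lemma fatou_Rint (f : nat -> R -> R) g (c : R) :
  (forall j, measurable_fun setT (f j)) -> (forall j x, 0 <= f j x) ->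
  (forall x, f ^~ x @ \oo --> g x) ->
  (forall j, mu.-integrable setT (EFin \o f j) /\ \int[mu]_x f j x <= c) ->
  mu.-integrable setT (EFin \o g) /\ \int[mu]_x g x <= c.
Proof.
move=> mf f0 fg fc.
have mg : measurable_fun setT g by apply: (measurable_fun_cvg mf) => x _; exact: fg.
have g0 x : 0 <= g x.
  rewrite -(cvg_lim _ (fg x)) //; apply: limr_ge; first exact: cvgP (fg x).
  by apply: nearW => j; exact: f0.
have H : (\int[mu]_x (g x)%:E <= c%:E)%E.
  have := @fatou _ _ R mu setT measurableT (fun j x => (f j x)%:E).
  have mfE j : measurable_fun setT (fun x => (f j x)%:E) by exact/measurable_EFinP.
  move=> /(_ mfE (fun n x _ => f0 n x)) H.
  have E : (\int[mu]_x (g x)%:E = \int[mu]_x limn_einf (fun j => (f j x)%:E))%E.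
    apply: eq_integral => x _; apply/esym.
    have H1 : (f j x)%:E @[j --> \oo] --> (g x)%:E by apply: cvg_EFin (fg x); apply: nearW.
    by have [-> _] := cvg_limn_einf_sup H1.
  rewrite E; apply: le_trans H _.
  rewrite limn_einf_lim; apply: lime_le; first exact: is_cvg_einfs.
  apply: nearW => n; apply: le_trans (_ : _ <= \int[mu]_x (f n x)%:E)%E _.
    by apply: ereal_inf_lbound; exists n => //=.
  by rewrite -EFin_Rint ?lee_fin; case: (fc n).
have gi : mu.-integrable setT (EFin \o g).
  apply/integrableP; split; first exact/measurable_EFinP.
  under eq_integral => x _ do rewrite /= ger0_norm ?g0 //.
  exact: le_lt_trans H (ltry _).
by split=> //; rewrite -lee_fin EFin_Rint.
Qed.

(* The dyadically weighted sum of squares of increments has finite integral,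
   which forces pointwise geometric convergence almost everywhere without
   Minkowski's inequality. *)
Lemma L2_complete (f : nat -> R -> R) : (forall j, L2 (f j)) ->
  (forall i j, (i <= j)%N -> \int[mu]_x (f i x - f j x) ^+ 2 <= (8^-1) ^+ i) ->
  exists2 g, L2 g & forall i, \int[mu]_x (f i x - g x) ^+ 2 <= (8^-1) ^+ i.
Proof.
move=> lf fC.
(* The weight [4 ^+ i] balances two needs: the integrals are at most 4^i 8^-i = 2^-i, hence
   summable, and a finite sum [S x] bounds the i-th increment by 2^-i times the root of [S x]. *)
pose d i x := (4 ^+ i * (f i x - f i.+1 x) ^+ 2)%:E : \bar R.
have di i : mu.-integrable setT (d i).
  have := integrableZl (@measurableT _ _) (4 ^+ i) (L2_sqr (L2B (lf i) (lf i.+1))).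
  by apply: eq_integrable => // x _ /=; rewrite EFinM.
have d0 i x : (0 <= d i x)%E.
  by rewrite /d lee_fin; apply: mulr_ge0; [exact: exprn_ge0|exact: sqr_ge0].
have md i : measurable_fun setT (d i) by case/integrableP: (di i).
have dint i : (\int[mu]_x d i x <= ((2^-1) ^+ i)%:E)%E.
  rewrite /d -EFin_Rint; last exact: di.
  rewrite lee_fin RintegralZl //; last exact: L2_sqr (L2B (lf i) (lf i.+1)).
  have -> : (2^-1) ^+ i = 4 ^+ i * (8^-1) ^+ i :> R by rewrite -exprMn; congr (_ ^+ _); lra.
  by rewrite ler_wpM2l ?exprn_ge0 //; apply: fC.
pose S x := (\sum_(i <oo) d i x)%E.
have mS : measurable_fun setT S by apply: ge0_emeasurable_sum.
have S0 x : (0 <= S x)%E by apply: nneseries_ge0 => *; exact: d0.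
have Sint : (\int[mu]_x S x < +oo)%E.
  rewrite /S integral_nneseries //.
  have := @lee_nneseries R (fun i => (\int[mu]_x d i x)%E) (fun i => ((2^-1) ^+ i)%:E) xpredT 0.
  move=> H; apply: le_lt_trans (H _ _) _ => {H}.
  - by move=> i _ _; apply: integral_ge0 => x _; exact: d0.
  - by move=> i _; exact: dint.
  have cvg2 := @cvg_geometric_series R 1 2^-1.
  rewrite (_ : (\sum_(i <oo) (2^-1 ^+ i)%:E)%E = (1 / (1 - 2^-1))%:E) ?ltry //.
  apply/cvg_lim => //.
  under eq_fun do rewrite sumEFin.
  apply: cvg_EFin; first exact: nearW.
  have := cvg2; rewrite gtr0_norm ?invr_gt0 // invf_lt1 // => /(_ _).
  have h : (1 < 2 :> R) by lra.
  move=> /(_ h); rewrite /series /geometric /=.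
  by under eq_fun do under eq_bigr do rewrite mul1r.
pose G := [set x | (S x < +oo)%E].
have mG : measurable G.
  by have := emeasurable_fun_infty_o measurableT mS +oo%E; rewrite setTI.
have Sfin : {ae mu, forall x, G x}.
  have Si : mu.-integrable setT S.
    apply/integrableP; split => //.
    by under eq_integral => x _ do rewrite gee0_abs ?S0 //.
  have := integrable_ae measurableT Si; apply: ae_imp => x /(_ I).
  by rewrite ge0_fin_numE.
(* Setting the sequence to 0 off the conull set [G] makes it converge everywhere, so that the limit
   is measurable. *)
pose h j x := \1_G x * f j x.
have mh j : measurable_fun setT (h j).
  by apply: measurable_funM; [exact: measurable_indic|exact: L2_measurable].
have hcvg x : cvgn (h ^~ x).
  rewrite /h indicE; have [xG|xG] := boolP (x \in G); last first.
    by under eq_fun do rewrite mul0r; exact: is_cvg_cst.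
  under eq_fun do rewrite mul1r.
  apply: (@cvg_sumgeom _ (Num.sqrt (fine (S x)))) => i.
  rewrite -sqrtr_sqr -[leRHS]ger0_norm ?mulr_ge0 ?sqrtr_ge0 ?exprn_ge0 ?invr_ge0 //.
  rewrite -[leRHS]sqrtr_sqr ler_wsqrtr // exprMn sqr_sqrtr ?fine_ge0 ?S0 //.
  rewrite -exprM mulnC exprM.
  have E4 : 4 ^+ i * (2^-1 ^+ 2) ^+ i = 1 :> R.
    by rewrite -exprMn (_ : 4 * 2^-1 ^+ 2 = 1) ?expr1n // expr2; lra.
  have p4 : 0 < 4 ^+ i :> R by rewrite exprn_gt0.
  rewrite -(ler_pM2l p4) [leRHS]mulrCA E4 mulr1.
  rewrite -lee_fin fineK ?ge0_fin_numE ?S0 //; last by rewrite inE in xG.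
  have := @nneseries_lim_ge R (fun k => d k x) xpredT 0 i.+1 (fun k _ _ => d0 k x).
  apply: le_trans.
  by rewrite big_mkord big_ord_recr /= leeDr // sume_ge0.
pose g x := limn (h ^~ x).
have hg x : h ^~ x @ \oo --> g x by exact: hcvg.
have mg : measurable_fun setT g by apply: (measurable_fun_cvg mh) => x _; exact: hg.
(* Fatou in [j] for the squares of h_i - h_(i+j) turns the Cauchy estimate into a distance to the
   limit. *)
have key i : mu.-integrable setT (EFin \o (fun x => (h i x - g x) ^+ 2)) /\
   \int[mu]_x (h i x - g x) ^+ 2 <= 8^-1 ^+ i.
  apply: (@fatou_Rint (fun j x => (h i x - h (i + j)%N x) ^+ 2)).
  - by move=> j; apply: measurable_funX; apply: measurable_funB.
  - by move=> j x; exact: sqr_ge0.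
  - move=> x; apply: cvgM; apply: cvgB; try exact: cvg_cst;
    by under eq_fun do rewrite addnC; have := hg x; rewrite -(cvg_shiftn i).
  - move=> j.
    have E x : (h i x - h (i + j)%N x) ^+ 2 = \1_G x * (f i x - f (i + j)%N x) ^+ 2.
      by rewrite /h indicE; case: (_ \in _); rewrite ?mul1r ?mul0r ?subrr ?expr0n.
    under [X in EFin \o X]eq_fun do rewrite E.
    under eq_Rintegral do rewrite E.
    have fi := L2_sqr (L2B (lf i) (lf (i + j)%N)).
    have hi : mu.-integrable [set: R] (EFin \o (fun x : R => \1_G x * (f i x - f (i + j)%N x) ^+ 2)).
      apply: le_integrable fi => //.
        apply/measurable_EFinP; apply: measurable_funM; first exact: measurable_indic.
        by apply: measurable_funX; apply: measurable_funB; apply: L2_measurable.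
      move=> x _; rewrite /= lee_fin normrM ler_piMl // indicE.
      by case: (_ \in _); rewrite ?normr1 ?normr0.
    split=> //; apply: le_trans (fC i (i + j)%N (leq_addr _ _)).
    apply: le_Rintegral => // x _; rewrite indicE.
    by case: (_ \in _); rewrite ?mul1r ?mul0r ?sqr_ge0.
have lh i : L2 (h i).
  apply: L2_dom (lf i) _ => // x; rewrite /h normrM ler_piMl // indicE.
  by case: (_ \in _); rewrite ?normr1 ?normr0.
exists g.
  (* [g] is recovered as h_0 - (h_0 - g), a difference of square integrable functions. *)
  have l2 : L2 (fun x => h 0%N x - g x).
    by apply/L2P; split; [exact: measurable_funB|case: (key 0%N)].
  have := L2B (lh 0%N) l2; congr L2; apply/funext => x; lra.
move=> i; rewrite (@ae_Rint _ (fun x => (h i x - g x) ^+ 2)); first by case: (key i).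
- by apply: measurable_funX; apply: measurable_funB => //; apply: L2_measurable.
- by apply: measurable_funX; apply: measurable_funB.
- by move: Sfin; apply: ae_imp => x Gx; rewrite /h indicE mem_set // mul1r.
Qed.
End SquareIntegrable.

(** * Minimizing sequences of quadratic forms *)

Section Forms.
Variables (R : realType) (V : lmodType R) (D : V -> Prop).
Hypothesis D_lin : forall a x y, D x -> D y -> D (a *: x + y).
Implicit Types (b q s h : V -> V -> R).

(** Linearity is asked only on [D] because the forms are integrals, which are additive only on
    integrable arguments; linearity in the second argument follows by symmetry. *)
Definition symbilin b : Prop :=
  (forall x y, D x -> D y -> b x y = b y x) /\
  (forall a x y z, D x -> D y -> D z -> b (a *: x + y) z = a * b x z + b y z).

Definition linform (l : V -> R) : Prop :=
  forall a x y, D x -> D y -> l (a *: x + y) = a * l x + l y.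

Lemma symbilin_expand b a x y : symbilin b -> D x -> D y ->
  b (a *: x + y) (a *: x + y) = a ^+ 2 * b x x + 2 * a * b x y + b y y.
Proof.
move=> [bs bl] Dx Dy; have Dz := D_lin a Dx Dy.
rewrite bl // (bs x) // (bs y (a *: x + y)) // !bl // (bs y x) //.
by rewrite expr2; ring.
Qed.

Lemma parallelogram b x y : symbilin b -> D x -> D y ->
  b ((-1) *: y + x) ((-1) *: y + x) + b (1 *: y + x) (1 *: y + x)
  = 2 * b x x + 2 * b y y.
Proof. by move=> sb Dx Dy; rewrite !symbilin_expand // !expr2; ring. Qed.

Lemma symbilin_comb b q k : symbilin b -> symbilin q ->
  symbilin (fun x y => b x y - k * q x y).
Proof.
move=> [bs bl] [qs ql]; split=> [x y Dx Dy|a x y z Dx Dy Dz]; first by rewrite bs // qs.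
by rewrite bl // ql //; ring.
Qed.

Lemma cauchy_schwarz b x y : symbilin b -> (forall z, D z -> 0 <= b z z) ->
  D x -> D y -> b x y ^+ 2 <= b x x * b y y.
Proof.
move=> sb b0 Dx Dy; have := b0 _ Dx; rewrite le_eqVlt => /predU1P[bx0|bx].
  rewrite -bx0 mul0r; suff -> : b x y = 0 by rewrite expr0n.
  apply/eqP/negPn/negP => bxy.
  (* With [b x x = 0] the form is affine in the coefficient of [x]; this coefficient makes its value
     -1. *)
  have := b0 _ (D_lin (- (b y y + 1) / (2 * b x y)) Dx Dy).
  rewrite symbilin_expand // -bx0 mulr0 add0r.
  have -> : 2 * (- (b y y + 1) / (2 * b x y)) * b x y = - (b y y + 1) by field.
  by move=> ?; lra.
have := b0 _ (D_lin (- b x y / b x x) Dx Dy).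
rewrite symbilin_expand // => H.
rewrite -subr_ge0; have -> : b x x * b y y - b x y ^+ 2 =
  b x x * ((- b x y / b x x) ^+ 2 * b x x + 2 * (- b x y / b x x) * b x y + b y y).
  by field; rewrite gt_eqF.
by rewrite mulr_ge0 // ltW.
Qed.

Lemma null_semidef b x y : symbilin b -> (forall z, D z -> 0 <= b z z) ->
  D x -> D y -> b x x = 0 -> b x y = 0.
Proof.
move=> sb b0 Dx Dy bx; apply/eqP; rewrite -sqrf_eq0 eq_le sqr_ge0 andbT.
by rewrite (le_trans (cauchy_schwarz sb b0 Dx Dy)) // bx mul0r.
Qed.

End Forms.

Section Minimization.
Variable R : realType.

Lemma ler_mx_coord m n (M : 'M[R]_(m, n)) i j : `|M i j| <= `|M|.
Proof.
by rewrite /Num.norm /= mx_normrE; apply: (le_bigmax _ (fun ij => `|M ij.1 ij.2|) (i, j)).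
Qed.

Lemma mx_norm_le m n (M : 'M[R]_(m, n)) (e : R) : 0 <= e ->
  (forall i j, `|M i j| <= e) -> `|M| <= e.
Proof.
move=> e0 Me; rewrite /Num.norm /= mx_normrE; apply: bigmax_le => // -[i j] _.
Qed.

(** Compactness of a cube in finite dimension, stated with a cluster point so that no subsequence
    has to be carried along. *)
Lemma bounded_vec_cluster (I : finType) (K : R) (x : nat -> I -> R) :
  (forall n i, `|x n i| <= K) ->
  exists p : I -> R, forall (e : R) (n : nat), 0 < e ->
    exists2 m, (n <= m)%N & forall i, `|x m i - p i| <= e.
Proof.
move=> xK.
pose A := [set v : 'rV[R]_#|I| | forall i, `[- K, K]%classic (v ord0 i)].
have cA : compact A.
  rewrite /A; apply: (@rV_compact R #|I| (fun=> `[- K, K]%classic)) => _.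
  exact: segment_compact.
pose X n : 'rV[R]_#|I| := \row_i x n (enum_val i).
have XA n : A (X n) by move=> i; rewrite /= mxE in_itv /= -ler_norml.
have XA' : (X @ \oo) A by exists 0%N => // n _; exact: XA.
have [p [_ clp]] := cA (X @ \oo) _ XA'.
exists (fun i => p 0 (enum_rank i)) => e n e0.
have h1 : (X @ \oo) [set v | exists2 m, (n <= m)%N & v = X m].
  by exists n => // m /= nm; exists m.
have h2 : nbhs p (ball p e) by exact: nbhsx_ballx.
have [v [[m nm ->] pm]] := clp _ _ h1 h2.
exists m => // i; move: pm; rewrite -ball_normE /= => pm.
rewrite distrC; apply: le_trans (ltW pm).
by apply: le_trans (ler_mx_coord _ 0 (enum_rank i)); rewrite !mxE enum_rankK.
Qed.

Variables (V : lmodType R) (D : V -> Prop).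
Hypothesis D_lin : forall a x y, D x -> D y -> D (a *: x + y).

(* The difference of two almost minimizers is almost isotropic by the
   parallelogram law, so coercivity up to finitely many functionals makes a
   minimizing sequence Cauchy as soon as those functionals converge along it. *)
Lemma minimizing_cauchy (q s h : V -> V -> R) (I : finType) (l : I -> V -> R)
    (c c1 C K1 K2 : R) (x0 : V) :
  symbilin D q -> symbilin D s -> symbilin D h -> (forall i, linform D (l i)) ->
  0 < c -> 0 < c1 -> 0 <= C -> 0 <= K1 -> 0 <= K2 ->
  (forall x, D x -> 0 <= s x x <= h x x) ->
  (forall x, D x -> c * h x x <= q x x + C * \sum_i l i x ^+ 2) ->
  (forall x, D x -> c1 * h x x - K1 * s x x <= q x x) ->
  (forall i x, D x -> l i x ^+ 2 <= K2 * h x x) ->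
  D x0 -> q x0 x0 < 0 ->
  exists m w, [/\ m < 0, forall x, D x -> m * s x x <= q x x,
    forall j : nat, [/\ D (w j), s (w j) (w j) = 1 &
      q (w j) (w j) - m <= 8^-1 ^+ j] &
    forall i j, (i <= j)%N ->
      h ((-1) *: w j + w i) ((-1) *: w j + w i) <= 8^-1 ^+ i].
Proof.
move=> sq ss sh ll c0 c10 C0 K10 K20 s0h qc qK lK Dx0 qx0.
have s0 x : D x -> 0 <= s x x by move=> /s0h/andP[].
have sx0 : 0 < s x0 x0.
  rewrite lt_neqAle s0 // andbT eq_sym; apply/negP => /eqP s00.
  have := qK _ Dx0; rewrite s00 mulr0 subr0 => hq.
  have /andP[_ h0] := s0h _ Dx0; rewrite s00 in h0.
  by have := mulr_ge0 (ltW c10) h0; lra.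
pose E := [set q x x | x in [set x | D x /\ s x x = 1]].
have scale x : D x -> 0 < s x x -> D ((Num.sqrt (s x x))^-1 *: x) /\
    forall b, symbilin D b ->
    b ((Num.sqrt (s x x))^-1 *: x) ((Num.sqrt (s x x))^-1 *: x) = b x x / s x x.
  move=> Dx sx.
  have D0 : D 0 by rewrite -(subrr x) -scaleN1r addrC; apply: D_lin.
  have Dk k : D (k *: x) by rewrite -[_ *: _]addr0; apply: D_lin.
  split=> // b sb; have [bs bl] := sb.
  have b0 : b 0 0 = 0.
    by have := bl 1 0 0 0 D0 D0 D0; rewrite scaler0 addr0 => ?; lra.
  have bx0 : b x 0 = 0.
    by rewrite bs //; have := bl 1 0 0 x D0 D0 Dx; rewrite scaler0 addr0 => ?; lra.
  rewrite -{1 2}[_ *: x]addr0 (symbilin_expand D_lin) // b0 bx0 mulr0 !addr0.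
  by rewrite exprVn sqr_sqrtr ?(ltW sx) // mulrC.
have Elb : lbound E (- K1).
  move=> _ [x [Dx sx1] <-]; have := qK _ Dx; rewrite sx1 mulr1.
  have /andP[_] := s0h _ Dx; rewrite sx1 => h1.
  have : 0 <= c1 * h x x by rewrite mulr_ge0 ?(ltW c10) //; lra.
  by move=> ? ?; lra.
have E0 : E !=set0.
  have [Dy bE] := scale _ Dx0 sx0.
  exists (q x0 x0 / s x0 x0); exists ((Num.sqrt (s x0 x0))^-1 *: x0); last exact: bE.
  by split=> //=; rewrite (bE _ ss) divff // gt_eqF.
have Einf : has_inf E by split => //; exists (- K1).
set m := inf E.
have mle x : D x -> m * s x x <= q x x.
  move=> Dx; have := s0 _ Dx; rewrite le_eqVlt => /predU1P[s00|sx].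
    have := qK _ Dx; rewrite -s00 !mulr0 subr0.
    have /andP[_] := s0h _ Dx; rewrite -s00 => h0.
    have := mulr_ge0 (ltW c10) h0; lra.
  have [Dy bE] := scale _ Dx sx.
  rewrite -ler_pdivlMr //; apply: (inf_lbound Einf.2).
  exists ((Num.sqrt (s x x))^-1 *: x); last exact: bE.
  by split=> //=; rewrite (bE _ ss) divff // gt_eqF.
have m0 : m < 0.
  have := mle _ Dx0; rewrite -ler_pdivlMr // => mq.
  by apply: le_lt_trans mq _; rewrite pmulr_llt0 ?invr_gt0.
have almost (e : R) : 0 < e -> exists x, [/\ D x, s x x = 1 & q x x - m <= e].
  move=> e0; have [y [x [Dx sx] <-] xe] := inf_adherent e0 Einf.
  by exists x; split=> //; move: xe; rewrite -/m; lra.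
clearbody m.
(* By the choice of [m] as infimum this form is nonnegative, and it is small at almost
   minimizers. *)
pose b x y := q x y - m * s x y.
have sb : symbilin D b by exact: symbilin_comb.
have b0 x : D x -> 0 <= b x x by move=> Dx; rewrite subr_ge0 mle.
pose M := K2 * ((1 + K1) / c1).
have seqx (j : nat) : exists x, [/\ D x, s x x = 1 & q x x - m <= j.+1%:R^-1].
  by apply: almost; rewrite invr_gt0.
have [y yP] := choice seqx.
have hy j : h (y j) (y j) <= (1 + K1) / c1.
  have [Dy sy qy] := yP j; rewrite ler_pdivlMr // mulrC.
  have := qK _ Dy; rewrite sy mulr1.
  have : j.+1%:R^-1 <= 1 :> R by rewrite invf_le1 // ler1n.
  by move: qy; move: (j.+1%:R^-1) => a qy ? ?; have := m0; lra.
have ly j i : `|l i (y j)| <= Num.sqrt M.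
  have [Dy _ _] := yP j; rewrite -sqrtr_sqr ler_wsqrtr //.
  by apply: le_trans (lK _ _ Dy) _; rewrite ler_wpM2l.
have [p pP] := bounded_vec_cluster (fun n i => ly n i).
(* The tolerance [r j] below satisfies [r j <= 8^-1 ^+ j] and [Z * r j <= c * 8^-1 ^+ j]. The second
   bound closes the final estimate, where the form contributes 4 r_i and the functionals 4 C #|I|
   r_i. The rate 8^-j is the one that [L2_complete] expects. *)
pose Z := 4 + 4 * C * #|I|%:R + 4.
have Z0 : 0 < Z by rewrite /Z; have := mulr_ge0 C0 (ler0n R #|I|); lra.
pose r j : R := Num.min 1 (c / Z) * 8^-1 ^+ j.
have e8 j : 0 < 8^-1 ^+ j :> R by rewrite exprn_gt0 // invr_gt0.
have r0 j : 0 < r j.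
  by rewrite mulr_gt0 // lt_min ltr01 divr_gt0.
have r1 j : r j <= 8^-1 ^+ j by rewrite ler_piMl ?(ltW (e8 j)) // ge_min lexx.
have r2 j : Z * r j <= c * 8^-1 ^+ j.
  rewrite mulrA ler_wpM2r ?(ltW (e8 j)) //.
  by rewrite mulrC -ler_pdivlMr // ge_min lexx orbT.
have rdec i j : (i <= j)%N -> r j <= r i.
  move=> ij; rewrite ler_pM2l ?lt_min ?ltr01 ?divr_gt0 //.
  by apply: ler_wiXn2l => //; rewrite ?invr_ge0 // invf_le1 // ler1n.
have seqw j : exists x, [/\ D x, s x x = 1, q x x - m <= r j &
    forall i, (l i x - p i) ^+ 2 <= r j].
  have [n nr] : exists n : nat, n.+1%:R^-1 <= r j.
    by have [n] := ltr_add_invr (r0 j); rewrite add0r => /ltW; exists n.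
  have sr : 0 < Num.sqrt (r j) by rewrite sqrtr_gt0.
  have [k nk kP] := pP _ n sr.
  have [Dy sy qy] := yP k; exists (y k); split=> //.
    apply: le_trans qy (le_trans _ nr).
    by rewrite lef_pV2 ?posrE // ler_nat ltnS.
  move=> i; rewrite -(sqr_sqrtr (ltW (r0 j))) -real_normK ?num_real //.
  by rewrite lerXn2r ?nnegrE ?sqrtr_ge0.
have [w wP] := choice seqw.
exists m, w; split=> //.
  by move=> j; case: (wP j) => ? ? qw _; split=> //; apply: le_trans qw _.
move=> i j ij; have [Di si qi li] := wP i; have [Dj sj qj lj] := wP j.
have Dd := D_lin (-1) Dj Di.
set d := (-1) *: w j + w i in Dd *.
have bd : b d d <= 4 * r i.
  have := parallelogram D_lin sb Di Dj; rewrite -/d.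
  have := b0 _ (D_lin 1 Dj Di); have := rdec _ _ ij.
  have : b (w i) (w i) <= r i by rewrite /b si mulr1.
  have : b (w j) (w j) <= r j by rewrite /b sj mulr1.
  lra.
have ld k : l k d ^+ 2 <= 4 * r i.
  rewrite /d ll //; have := rdec _ _ ij; have := li k; have := lj k.
  have := sqr_ge0 ((l k (w i) - p k) + (l k (w j) - p k)).
  rewrite !expr2; lra.
rewrite -(ler_pM2l c0); apply: le_trans (r2 i).
apply: le_trans (qc _ Dd) _.
(* Here [m < 0] matters: passing from [b] back to [q] adds [m * s d d], which is nonpositive. *)
have qd : q d d <= 4 * r i.
  have : m * s d d <= 0 by rewrite nmulr_rle0 // s0.
  by move: bd; rewrite /b; lra.
have sld : \sum_k l k d ^+ 2 <= 4 * r i * #|I|%:R.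
  apply: le_trans (_ : _ <= \sum_(k : I) (4 * r i)) _.
    by apply: ler_sum => k _; exact: ld.
  by rewrite sumr_const mulr_natr.
have CS := ler_wpM2l C0 sld; apply: le_trans (lerD qd CS) _.
by rewrite /Z; have := r0 i; lra.
Qed.

End Minimization.

(** * Integration by parts and Poincare inequalities *)

Section Intervals.
Variable R : realType.
Local Notation mu := (@lebesgue_measure R).
Implicit Types f g F w phi dphi : R -> R.
Implicit Types a b c x y t : R.

Definition C1 F f : Prop := (forall x, is_derive x 1 F (f x)) /\ continuous f.

Lemma C1_derivable F f x : C1 F f -> derivable F x 1.
Proof. by case=> dF _; apply: ex_derive. Qed.

Lemma C1_continuous F f : C1 F f -> continuous F.
Proof.
move=> CF x; apply: differentiable_continuous.
by apply/derivable1_diffP; exact: C1_derivable CF.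
Qed.

Lemma C1_derive1 F f : C1 F f -> F^`() = f.
Proof. by case=> dF _; apply/funext => x; rewrite derive1E derive_val. Qed.

Lemma C1_derive F : (forall x, derivable F x 1) -> continuous F^`() -> C1 F F^`().
Proof.
move=> dF cF; split=> // x; apply: DeriveDef; first exact: dF.
by rewrite derive1E.
Qed.

Lemma C1_cst k : C1 (cst k) (cst 0).
Proof. by split=> x; [exact: is_derive_cst|exact: cst_continuous]. Qed.

Lemma C1_id : C1 id (cst 1).
Proof. by split=> x; [exact: is_derive_id|exact: cst_continuous]. Qed.

Lemma C1D F f G g : C1 F f -> C1 G g -> C1 (fun x => F x + G x) (fun x => f x + g x).
Proof.
move=> CF CG; split=> x; first by apply: is_deriveD; [case: CF|case: CG].
by apply: cvgD; [case: CF => _|case: CG => _]; apply.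
Qed.

Lemma C1M F f G g : C1 F f -> C1 G g ->
  C1 (fun x => F x * G x) (fun x => f x * G x + F x * g x).
Proof.
move=> CF CG; split=> x.
  have dF : is_derive x 1 F (f x) by case: CF.
  have dG : is_derive x 1 G (g x) by case: CG.
  have := is_deriveM dF dG.
  by rewrite (_ : F x *: g x + G x *: f x = f x * G x + F x * g x) // /GRing.scale /=; ring.
apply: cvgD; apply: cvgM.
- by case: CF => _; apply.
- exact: C1_continuous CG x.
- exact: C1_continuous CF x.
- by case: CG => _; apply.
Qed.

Lemma C1Z k F f : C1 F f -> C1 (fun x => k * F x) (fun x => k * f x).
Proof.
move=> CF; have := C1M (C1_cst k) CF; congr C1; apply/funext => x /=; ring.
Qed.

Lemma C1_sum (I : Type) (r : seq I) (F f : I -> R -> R) :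
  (forall i, C1 (F i) (f i)) ->
  C1 (fun x => \sum_(i <- r) F i x) (fun x => \sum_(i <- r) f i x).
Proof.
move=> CF; elim: r => [|i r IH].
  have := C1_cst 0; congr C1; apply/funext => x; by rewrite big_nil.
by have := C1D (CF i) IH; congr C1; apply/funext => x; rewrite big_cons.
Qed.

Lemma C1_eq F f G g : C1 F f -> F =1 G -> f =1 g -> C1 G g.
Proof. by move=> CF FG fg; rewrite -(funext FG) -(funext fg). Qed.

Implicit Type A : set (measurableTypeR R).

Lemma integrable_D A f g : measurable A -> mu.-integrable A (EFin \o f) ->
  mu.-integrable A (EFin \o g) -> mu.-integrable A (EFin \o (fun x => f x + g x)).
Proof.
by move=> mA fi gi; have := integrableD mA fi gi; apply: eq_integrable.
Qed.

Lemma integrable_Z A k f : measurable A -> mu.-integrable A (EFin \o f) ->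
  mu.-integrable A (EFin \o (fun x => k * f x)).
Proof.
by move=> mA fi; have := integrableZl mA k fi; apply: eq_integrable.
Qed.

Lemma integrable_cst_itv a b k : mu.-integrable `[a, b] (EFin \o cst k).
Proof.
apply: continuous_compact_integrable; first exact: segment_compact.
by apply: continuous_subspaceT => x; exact: cst_continuous.
Qed.

Lemma itv_integrableT f a b : mu.-integrable setT (EFin \o f) ->
  mu.-integrable `[a, b] (EFin \o f).
Proof. by apply: integrableS. Qed.

Lemma continuous_itv_integrable f a b : continuous f ->
  mu.-integrable `[a, b] (EFin \o f).
Proof.
move=> cf; apply: continuous_compact_integrable; first exact: segment_compact.
exact: continuous_subspaceT.
Qed.

Lemma continuous_measurable f : continuous f -> measurable_fun setT f.
Proof. exact: continuous_measurable_fun. Qed.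

Lemma L2_continuous_integrable w f a b : L2 w -> continuous f ->
  mu.-integrable `[a, b] (EFin \o (fun x => w x * f x)).
Proof.
move=> lw cf.
have i2 : mu.-integrable `[a, b] (EFin \o (fun x => f x ^+ 2)).
  apply: continuous_itv_integrable => x; apply: cvgM; exact: cf.
have := integrable_D (measurable_itv `[a, b]%R) (itv_integrableT a b (L2_sqr lw)) i2.
apply: le_integrable => //.
  apply/measurable_EFinP; apply: measurable_funM.
    by apply: measurable_funTS; exact: L2_measurable lw.
  by apply: measurable_funTS; exact: continuous_measurable.
move=> x _; change (`|w x * f x|%:E <= `|w x ^+ 2 + f x ^+ 2|%:E)%E.
rewrite lee_fin [leRHS]ger0_norm ?addr_ge0 ?sqr_ge0 // ler_norml.
have := sqr_ge0 (w x - f x); have := sqr_ge0 (w x + f x).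
have := sqr_ge0 (w x); have := sqr_ge0 (f x).
by rewrite !expr2 => ? ? ? ?; apply/andP; split; lra.
Qed.

Lemma L2_itv_integrable w a b : L2 w -> mu.-integrable `[a, b] (EFin \o w).
Proof.
move=> lw; have c1 : continuous (cst 1 : R -> R) by move=> x; exact: cst_continuous.
have := L2_continuous_integrable a b lw c1.
by apply: eq_integrable => // x _; rewrite /= mulr1.
Qed.

Lemma FTC_C1 F f a b : a <= b -> C1 F f -> \int[mu]_(x in `[a, b]) f x = F b - F a.
Proof.
rewrite le_eqVlt => /predU1P[<- _|ab CF]; first by rewrite set_itv1 Rintegral_set1 subrr.
rewrite /Rintegral (@continuous_FTC2 _ f F) //.
- by apply: continuous_subspaceT; case: CF.
- have cF := C1_continuous CF.
  split; first by move=> x _; exact: C1_derivable CF.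
    by apply: cvg_at_right_filter; exact: cF.
  by apply: cvg_at_left_filter; exact: cF.
- by move=> x _; rewrite (C1_derive1 CF).
Qed.

Lemma Rint_split f a b c : a <= b -> b <= c -> mu.-integrable `[a, c] (EFin \o f) ->
  \int[mu]_(x in `[a, c]) f x =
  \int[mu]_(x in `[a, b]) f x + \int[mu]_(x in `[b, c]) f x.
Proof.
move=> ab bc fi.
have := @Rintegral_itvB _ f (BLeft a) (BRight c) b fi.
rewrite !bnd_simp => /(_ ab bc) /eqP; rewrite subr_eq addrC => /eqP ->.
congr (_ + _); apply: Rintegral_itv_obnd_cbnd.
apply: integrableS fi => //= x /=; rewrite !in_itv /= => /andP[bx ->].
by rewrite andbT (le_trans ab (ltW bx)).
Qed.

Lemma Rint_itv_cst a b (k : R) : a <= b -> \int[mu]_(x in `[a, b]) k = k * (b - a).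
Proof.
move=> ab; rewrite (@FTC_C1 (fun x => k * x) (cst k)) //; first by ring.
apply: C1_eq (C1Z k C1_id) _ _ => // x /=; exact: mulr1.
Qed.

(* Absolute continuity of [w] with density [g], in the form of integration by
   parts against C^1 functions: this is the shape in which it is both easy to
   verify piecewise and easy to use. *)
Definition ibp w g : Prop := forall a b, a <= b -> forall phi dphi, C1 phi dphi ->
  \int[mu]_(t in `[a, b]) (w t * dphi t + g t * phi t) = w b * phi b - w a * phi a.

Lemma C1_ibp F f : C1 F f -> ibp F f.
Proof.
move=> CF a b ab phi dphi Cphi.
rewrite (@FTC_C1 (fun x => F x * phi x)) //.
by apply: C1_eq (C1M CF Cphi) _ _ => // x /=; ring.
Qed.

Lemma ibp_FTC w g a b : ibp w g -> a <= b -> \int[mu]_(t in `[a, b]) g t = w b - w a.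
Proof.
move=> wg ab; have := wg a b ab _ _ (C1_cst 1).
rewrite /= !mulr1 => <-; apply: eq_Rintegral => t _.
by rewrite mulr0 add0r mulr1.
Qed.

Lemma ibp_lin k w g w' g' : L2 w -> L2 g -> L2 w' -> L2 g' -> ibp w g -> ibp w' g' ->
  ibp (fun t => k * w t + w' t) (fun t => k * g t + g' t).
Proof.
move=> lw lg lw' lg' H H' a b ab phi dphi Cphi.
have [_ cd] := Cphi; have cp := C1_continuous Cphi.
have i1 (u v : R -> R) : L2 u -> L2 v -> mu.-integrable `[a, b]
    (EFin \o (fun t => u t * dphi t + v t * phi t)).
  move=> lu lv.
  by apply: integrable_D => //; exact: L2_continuous_integrable.
transitivity (\int[mu]_(t in `[a, b])
   (k * (w t * dphi t + g t * phi t) + (w' t * dphi t + g' t * phi t))).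
  by apply: eq_Rintegral => t _; ring.
rewrite RintegralD //; first last.
- exact: i1.
- by apply: integrable_Z => //; exact: i1.
by rewrite RintegralZl // ?H ?H' //; [ring|exact: i1].
Qed.

Lemma cauchy_schwarz_itv g a b : L2 g -> a <= b ->
  (\int[mu]_(t in `[a, b]) g t) ^+ 2 <= (b - a) * \int[mu]_(t in `[a, b]) (g t ^+ 2).
Proof.
move=> lg; rewrite le_eqVlt => /predU1P[<-|ab].
  by rewrite set_itv1 !Rintegral_set1 expr0n mulr0.
set G := \int[mu]_(t in _) g t; set G2 := \int[mu]_(t in _) (_ ^+ 2).
(* [k] is the mean of [g]; the inequality is the nonnegativity of the variance. *)
pose k := G / (b - a).
have gi := L2_itv_integrable a b lg.
have g2 := itv_integrableT a b (L2_sqr lg).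
have : 0 <= \int[mu]_(t in `[a, b]) (g t - k) ^+ 2.
  by apply: Rintegral_ge0 => t _; exact: sqr_ge0.
have E : \int[mu]_(t in `[a, b]) (g t - k) ^+ 2 = G2 - 2 * k * G + k ^+ 2 * (b - a).
  rewrite -(Rint_itv_cst _ (ltW ab)) -RintegralZl // -RintegralB //; last exact: integrable_Z.
  rewrite -RintegralD //.
  - by apply: eq_Rintegral => t _; rewrite !expr2; ring.
  - have := integrable_D (measurable_itv `[a, b]%R) g2 (integrable_Z (- (2 * k)) (measurable_itv `[a, b]%R) gi).
    by apply: eq_integrable => // t _; rewrite /= mulNr.
  - exact: integrable_cst_itv.
rewrite E -(pmulr_rge0 _ (_ : 0 < b - a)) ?subr_gt0 // => H.
rewrite -subr_ge0; apply: le_trans H _; rewrite le_eqVlt; apply/orP; left.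
by apply/eqP; rewrite /k; field; rewrite subr_eq0 gt_eqF.
Qed.

(** Fundamental theorem of calculus followed by Cauchy-Schwarz, with the integral enlarged from the
    interval between [x] and [y] to all of [[a, b]]. *)
Lemma ibp_holder w g a b x y : L2 g -> ibp w g -> a <= b ->
  a <= x <= b -> a <= y <= b ->
  (w y - w x) ^+ 2 <= (b - a) * \int[mu]_(t in `[a, b]) (g t ^+ 2).
Proof.
move=> lg wg ab.
wlog xy : x y / x <= y.
  move=> H xab yab; have [xy|/ltW yx] := leP x y; first exact: H.
  by rewrite -[w y - _]opprB sqrrN; apply: H.
move=> /andP[ax xb] /andP[ay yb].
rewrite -(ibp_FTC wg xy); apply: le_trans (cauchy_schwarz_itv lg xy) _.
have g2 := itv_integrableT a b (L2_sqr lg).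
apply: ler_pM.
- by rewrite subr_ge0.
- by apply: Rintegral_ge0 => t _; exact: sqr_ge0.
- by rewrite lerB.
rewrite (Rint_split ax xb g2) (@Rint_split _ x y b) //.
  rewrite addrCA lerDl addr_ge0 //; apply: Rintegral_ge0 => t _; exact: sqr_ge0.
exact: itv_integrableT (L2_sqr lg).
Qed.

(** Integrate w(t)^2 <= 2 w(a)^2 + 2 (w(t) - w(a))^2. The square of the length in front of the
    derivative term is what makes fine grids useful. *)
Lemma poincare_itv w g a b : L2 w -> L2 g -> ibp w g -> a <= b ->
  \int[mu]_(t in `[a, b]) (w t ^+ 2) <=
    2 * (b - a) * w a ^+ 2 + 2 * (b - a) ^+ 2 * \int[mu]_(t in `[a, b]) (g t ^+ 2).
Proof.
move=> lw lg wg ab; set G := \int[mu]_(t in _) (g t ^+ 2).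
have -> : 2 * (b - a) * w a ^+ 2 + 2 * (b - a) ^+ 2 * G =
   \int[mu]_(t in `[a, b]) (2 * w a ^+ 2 + 2 * (b - a) * G).
  by rewrite Rint_itv_cst //; ring.
apply: le_Rintegral => //.
- exact: itv_integrableT (L2_sqr lw).
- exact: integrable_cst_itv.
move=> t; rewrite /= in_itv /= => tab; have aab : a <= a <= b by rewrite lexx.
have := ibp_holder lg wg ab aab tab; rewrite -/G => H.
by have := sqr_ge0 (w t - w a - w a); rewrite !expr2 in H *; lra.
Qed.

(** The same argument with the roles of w(a) and w(t) exchanged. It shows that point evaluation is
    bounded in the W^{1,2} norm. *)
Lemma point_bound w g a b : L2 w -> L2 g -> ibp w g -> a < b ->
  (b - a) * w a ^+ 2 <= 2 * \int[mu]_(t in `[a, b]) (w t ^+ 2) +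
     2 * (b - a) ^+ 2 * \int[mu]_(t in `[a, b]) (g t ^+ 2).
Proof.
move=> lw lg wg /ltW ab; set G := \int[mu]_(t in _) (g t ^+ 2).
have w2 := itv_integrableT a b (L2_sqr lw).
have -> : 2 * \int[mu]_(t in `[a, b]) w t ^+ 2 + 2 * (b - a) ^+ 2 * G =
   \int[mu]_(t in `[a, b]) (2 * w t ^+ 2 + 2 * (b - a) * G).
  rewrite RintegralD //.
  - by rewrite RintegralZl // Rint_itv_cst //; ring.
  - exact: integrable_Z.
  - exact: integrable_cst_itv.
rewrite [leLHS]mulrC -(Rint_itv_cst (w a ^+ 2) ab); apply: le_Rintegral => //.
- exact: integrable_cst_itv.
- apply: integrable_D => //; first exact: integrable_Z.
  exact: integrable_cst_itv.
move=> t; rewrite /= in_itv /= => tab; have aab : a <= a <= b by rewrite lexx.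
have := ibp_holder lg wg ab aab tab; rewrite -/G => H.
by have := sqr_ge0 (w t + w t - w a); rewrite !expr2 in H *; lra.
Qed.

(** The quantitative substitute for compact embedding: up to a derivative term that is small for
    small [d], the mass on a bounded interval is controlled by [N] evaluations. *)
Lemma poincare_grid w g a (d : R) (N : nat) : L2 w -> L2 g -> ibp w g -> 0 <= d ->
  \int[mu]_(t in `[a, a + d * N%:R]) (w t ^+ 2) <=
    2 * d * \sum_(k < N) w (a + d * k%:R) ^+ 2 +
    2 * d ^+ 2 * \int[mu]_(t in `[a, a + d * N%:R]) (g t ^+ 2).
Proof.
move=> lw lg wg d0; elim: N => [|N IH].
  by rewrite mulr0 addr0 set_itv1 !Rintegral_set1 big_ord0 !mulr0 addr0.
rewrite big_ord_recr /=.
have h1 : a <= a + d * N%:R by rewrite lerDl mulr_ge0.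
have h2 : a + d * N%:R <= a + d * N.+1%:R by rewrite lerD2l ler_wpM2l // ler_nat.
have := poincare_itv lw lg wg h2.
have -> : a + d * N.+1%:R - (a + d * N%:R) = d by rewrite -natr1; ring.
rewrite (Rint_split h1 h2 (itv_integrableT _ _ (L2_sqr lw))).
rewrite (Rint_split h1 h2 (itv_integrableT _ _ (L2_sqr lg))).
lra.
Qed.

End Intervals.

(** * The Euclidean inner product *)

Section Dot.
Variables (R : realType) (n : nat).
Local Notation vec := 'cV[R]_n.
Implicit Types (x y z : vec) (M : 'M[R]_n).

Lemma dotC x y : dot x y = dot y x.
Proof. by apply: eq_bigr => i _; rewrite mulrC. Qed.

Lemma dot_lin k x y z : dot (k *: x + y) z = k * dot x z + dot y z.
Proof.
rewrite /dot mulr_sumr -big_split /=; apply: eq_bigr => i _.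
by rewrite !mxE; ring.
Qed.

Lemma dotDl x y z : dot (x + y) z = dot x z + dot y z.
Proof. by rewrite -{1}[x]scale1r dot_lin mul1r. Qed.

Lemma dotDr x y z : dot z (x + y) = dot z x + dot z y.
Proof. by rewrite dotC dotDl !(dotC z). Qed.

Lemma dot0l x : dot 0 x = 0.
Proof. by apply: big1 => i _; rewrite mxE mul0r. Qed.

Lemma dot0r x : dot x 0 = 0.
Proof. by rewrite dotC dot0l. Qed.

Lemma dotZl k x y : dot (k *: x) y = k * dot x y.
Proof. by rewrite -[_ *: x]addr0 dot_lin dot0l addr0. Qed.

Lemma dotZr k x y : dot x (k *: y) = k * dot x y.
Proof. by rewrite dotC dotZl dotC. Qed.

Lemma dotNl x y : dot (- x) y = - dot x y.
Proof. by rewrite -scaleN1r dotZl mulN1r. Qed.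

Lemma dotNr x y : dot x (- y) = - dot x y.
Proof. by rewrite dotC dotNl dotC. Qed.

Lemma dotBl x y z : dot (x - y) z = dot x z - dot y z.
Proof. by rewrite dotDl dotNl. Qed.

Lemma dotBr x y z : dot z (x - y) = dot z x - dot z y.
Proof. by rewrite dotDr dotNr. Qed.

Lemma dotxx_ge0 x : 0 <= dot x x.
Proof. by apply: sumr_ge0 => i _; rewrite -expr2 sqr_ge0. Qed.

Lemma dotxx_eq0 x : (dot x x == 0) = (x == 0).
Proof.
apply/eqP/eqP => [/eqP|->]; last exact: dot0l.
rewrite psumr_eq0 => [/allP x0|i _]; last by rewrite -expr2 sqr_ge0.
apply/colP => i; rewrite mxE; have := x0 i (mem_index_enum i).
by rewrite /= -expr2 sqrf_eq0 => /eqP.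
Qed.

Lemma dot_mxl M x y : dot (M *m x) y = dot x (M^T *m y).
Proof.
rewrite /dot; under eq_bigr do rewrite mxE mulr_suml.
rewrite exchange_big /=; apply: eq_bigr => j _.
rewrite mxE mulr_sumr; apply: eq_bigr => i _; rewrite mxE; ring.
Qed.

Lemma dot_amgm x y : 2 * dot x y <= dot x x + dot y y.
Proof. by have := dotxx_ge0 (x - y); rewrite dotBl !dotBr (dotC y x); lra. Qed.

Lemma coord_le_dot x i : x i 0 ^+ 2 <= dot x x.
Proof.
rewrite /dot (bigD1 i) //= -expr2 lerDl sumr_ge0 // => j _.
by rewrite -expr2 sqr_ge0.
Qed.

End Dot.

(** * Square integrable vector functions and their inner product *)

Section VectorL2.
Variables (R : realType) (n : nat).
Local Notation vec := 'cV[R]_n.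
Local Notation mu := (@lebesgue_measure R).
Implicit Types (x y z w g : R -> vec) (M : R -> 'M[R]_n).

Lemma L2_eq (f g : R -> R) : f =1 g -> L2 f -> L2 g.
Proof. by move=> /funext ->. Qed.

Lemma inL2I x : (forall i, L2 (fun t => x t i 0)) -> inL2 x.
Proof. by []. Qed.

Lemma inL2_lin k x y : inL2 x -> inL2 y -> inL2 (k *: x + y).
Proof.
move=> lx ly; apply: inL2I => i; apply: L2_eq (L2D (L2Z k (lx i)) (ly i)) => t.
by rewrite !mxE.
Qed.

Lemma inL2D x y : inL2 x -> inL2 y -> inL2 (x + y).
Proof. by move=> lx ly; rewrite -[x]scale1r; exact: inL2_lin. Qed.

Lemma inL2_0 : inL2 (0 : R -> vec).
Proof.
by apply: inL2I => i; apply: L2_eq (@L2_0 R) => t; rewrite mxE.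
Qed.

Lemma inL2Z k x : inL2 x -> inL2 (k *: x).
Proof. by move=> lx; rewrite -[_ *: x]addr0; apply: inL2_lin => //; exact: inL2_0. Qed.

Definition bmx M : Prop := forall i j, measurable_fun setT (fun t => M t i j) /\
  exists C, forall t, `|M t i j| <= C.

Lemma inL2_mulmx M x : bmx M -> inL2 x -> inL2 (fun t => M t *m x t).
Proof.
move=> bM lx; apply: inL2I => i.
have H j : xpredT j -> L2 (fun t => M t i j * x t j 0).
  by have [mM [C MC]] := bM i j => _; exact: L2Mb MC (lx j).
by apply: L2_eq (@L2_sum R _ (index_enum 'I_n) xpredT _ H) => t; rewrite mxE.
Qed.

Lemma integrable_sum (D : set (measurableTypeR R)) (I : Type) (r : seq I) (F : I -> R -> R) :
  measurable D -> (forall i, mu.-integrable D (EFin \o F i)) ->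
  mu.-integrable D (EFin \o (fun t => \sum_(i <- r) F i t)).
Proof.
move=> mD iF; elim: r => [|i r IH].
  by have := @integrable0 _ _ R mu D; apply: eq_integrable => // t _; rewrite /= big_nil.
have := integrable_D mD (iF i) IH.
by apply: eq_integrable => // t _; rewrite /= big_cons.
Qed.

Lemma Rintegral_sum (D : set (measurableTypeR R)) (I : Type) (r : seq I) (F : I -> R -> R) :
  measurable D -> (forall i, mu.-integrable D (EFin \o F i)) ->
  \int[mu]_(t in D) (\sum_(i <- r) F i t) = \sum_(i <- r) \int[mu]_(t in D) F i t.
Proof.
move=> mD iF; elim: r => [|i r IH].
  rewrite big_nil; under eq_Rintegral do rewrite big_nil.
  by rewrite Rintegral_cst // mul0r.
rewrite big_cons -IH -RintegralD //; last exact: integrable_sum.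
by apply: eq_Rintegral => t _; rewrite big_cons.
Qed.

Lemma dot_integrable x y : inL2 x -> inL2 y ->
  mu.-integrable setT (EFin \o (fun t => dot (x t) (y t))).
Proof. move=> lx ly; apply: integrable_sum => [|i]; first exact: measurableT.
exact: L2_mul (lx i) (ly i). Qed.

Definition ip x y : R := \int[mu]_t dot (x t) (y t).

Lemma ip_coord x y : inL2 x -> inL2 y ->
  ip x y = \sum_i \int[mu]_t (x t i 0 * y t i 0).
Proof. by move=> lx ly; rewrite /ip Rintegral_sum // => i; exact: L2_mul (lx i) (ly i). Qed.

Lemma ipC x y : ip x y = ip y x.
Proof. by apply: eq_Rintegral => t _; exact: dotC. Qed.

Lemma ip_lin k x y z : inL2 x -> inL2 y -> inL2 z ->
  ip (k *: x + y) z = k * ip x z + ip y z.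
Proof.
move=> lx ly lz; rewrite -RintegralZl //; last exact: dot_integrable.
rewrite -RintegralD //; first by apply: eq_Rintegral => t _; exact: dot_lin.
- by apply: integrable_Z => //; exact: dot_integrable.
- exact: dot_integrable.
Qed.

Lemma ip_ge0 x : 0 <= ip x x.
Proof. by apply: Rintegral_ge0 => t _; exact: dotxx_ge0. Qed.

Lemma ip_symbilin : symbilin (@inL2 R n) ip.
Proof. by split=> [x y _ _|k x y z]; [exact: ipC|exact: ip_lin]. Qed.

Lemma ip_CS x y : inL2 x -> inL2 y -> ip x y ^+ 2 <= ip x x * ip y y.
Proof.
move=> lx ly; apply: (cauchy_schwarz inL2_lin ip_symbilin) => // z _.
exact: ip_ge0.
Qed.

Lemma ip_linr k x y z : inL2 x -> inL2 y -> inL2 z ->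
  ip z (k *: x + y) = k * ip z x + ip z y.
Proof. by move=> lx ly lz; rewrite ipC ip_lin // !(ipC z). Qed.

Lemma ipDl x y z : inL2 x -> inL2 y -> inL2 z -> ip (x + y) z = ip x z + ip y z.
Proof. by move=> lx ly lz; rewrite -[x in LHS]scale1r ip_lin // mul1r. Qed.

Lemma ipZl k x z : inL2 x -> inL2 z -> ip (k *: x) z = k * ip x z.
Proof.
move=> lx lz; rewrite -[_ *: x]addr0 ip_lin //; last exact: inL2_0.
rewrite [X in _ + X](_ : _ = 0) ?addr0 //.
rewrite /ip; under eq_Rintegral do rewrite dot0l.
by rewrite Rintegral_cst // mul0r.
Qed.

Lemma ip_sum (I : Type) (r : seq I) (c : I -> R) (w : I -> R -> vec) z :
  (forall i, inL2 (w i)) -> inL2 z ->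
  ip (\sum_(i <- r) c i *: w i) z = \sum_(i <- r) c i * ip (w i) z.
Proof.
move=> lw lz; elim: r => [|i r IH].
  rewrite !big_nil -(scale0r (0 : R -> vec)) ipZl ?mul0r //; exact: inL2_0.
rewrite !big_cons ip_lin ?IH //.
elim: r {IH} => [|j r IH]; first by rewrite big_nil; exact: inL2_0.
by rewrite big_cons; exact: inL2_lin.
Qed.

Lemma inL2_sum (I : Type) (r : seq I) (c : I -> R) (w : I -> R -> vec) :
  (forall i, inL2 (w i)) -> inL2 (\sum_(i <- r) c i *: w i).
Proof.
move=> lw; elim: r => [|j r IH]; first by rewrite big_nil; exact: inL2_0.
by rewrite big_cons; exact: inL2_lin.
Qed.

(** Completeness coordinate by coordinate; each of the [n] coordinates contributes one error term,
    whence the factor [n%:R]. *)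
Lemma vec_complete (f : nat -> R -> vec) : (forall j, inL2 (f j)) ->
  (forall i j, (i <= j)%N ->
     ip ((-1) *: f j + f i) ((-1) *: f j + f i) <= (8^-1) ^+ i) ->
  exists2 g, inL2 g & forall i,
     ip ((-1) *: g + f i) ((-1) *: g + f i) <= n%:R * (8^-1) ^+ i.
Proof.
move=> lf fC.
have comp k : exists g : R -> R, L2 g /\
    forall i, \int[mu]_t (f i t k 0 - g t) ^+ 2 <= (8^-1) ^+ i.
  have [|i j ij|g lg gf] := @L2_complete R (fun j t => f j t k 0); last by exists g.
    by move=> j; exact: lf.
  apply: le_trans (fC i j ij); apply: le_Rintegral => //.
  - exact: L2_sqr (L2B (lf i k) (lf j k)).
  - by apply: dot_integrable; exact: inL2_lin.
  - move=> t _; apply: le_trans (coord_le_dot _ k).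
    by rewrite !mxE mulN1r addrC.
have [g gP] := choice comp.
pose G t : vec := \col_k g k t.
have lG : inL2 G.
  by apply: inL2I => k; have [lg _] := gP k; apply: L2_eq lg => t; rewrite mxE.
exists G => // i; rewrite ip_coord; try exact: inL2_lin.
apply: le_trans (_ : _ <= \sum_(k < n) (8^-1) ^+ i) _.
  apply: ler_sum => k _; have [_ /(_ i)] := gP k; apply: le_trans.
  rewrite le_eqVlt; apply/orP; left; apply/eqP; apply: eq_Rintegral => t _.
  by rewrite !mxE expr2; ring.
by rewrite sumr_const card_ord mulr_natl.
Qed.

End VectorL2.

(** * Negative eigenvalues from isotropic families *)

Section EigenvaluesFromForms.
Variables (R : realType) (n : nat).
Local Notation vec := 'cV[R]_n.
Local Notation mu := (@lebesgue_measure R).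
Local Notation pairL := ((R -> vec) * (R -> vec))%type.
Implicit Types (X Y W Phi : pairL) (x y z : R -> vec).

Definition pairL2 W : Prop := inL2 W.1 /\ inL2 W.2.

(** W^{1,2} through its absolutely continuous representatives: [ibp] holds for the functions
    themselves and not up to null sets, so the point values of the first component are
    meaningful. *)
Definition W12pair W : Prop :=
  pairL2 W /\ forall i, ibp (fun t => W.1 t i 0) (fun t => W.2 t i 0).

Definition W12form W X : R := ip W.1 X.1 + ip W.2 X.2.

Definition pairing x y W : R := ip x W.1 + ip y W.2.

(** Closure of [W12pair] in L^2 x L^2. Minimizers are obtained only as such limits, and staying in
    the closure avoids choosing a representative that satisfies [ibp]. *)
Definition W12limit W : Prop :=
  pairL2 W /\ forall e : R, 0 < e -> exists2 X, W12pair X & W12form ((-1) *: X + W) ((-1) *: X + W) <= e.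

Lemma pairL2_lin k X Y : pairL2 X -> pairL2 Y -> pairL2 (k *: X + Y).
Proof. by case=> ? ? [? ?]; split; apply: inL2_lin. Qed.

Lemma W12pair_pairL2 W : W12pair W -> pairL2 W. Proof. by case. Qed.

Lemma W12pair_lin k X Y : W12pair X -> W12pair Y -> W12pair (k *: X + Y).
Proof.
move=> [[x1 x2] xi] [[y1 y2] yi]; split; first by apply: pairL2_lin; split.
move=> i; have := ibp_lin k (x1 i) (x2 i) (y1 i) (y2 i) (xi i) (yi i).
by congr ibp; apply/funext => t; rewrite !mxE.
Qed.

Lemma W12pair_0 : W12pair 0.
Proof.
split; first by split; exact: inL2_0.
move=> i; have := C1_ibp (@C1_cst R 0).
by congr ibp; apply/funext => t; rewrite !mxE.
Qed.

Lemma W12pair_sum (I : Type) (r : seq I) (c : I -> R) (V : I -> pairL) :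
  (forall i, W12pair (V i)) -> W12pair (\sum_(i <- r) c i *: V i).
Proof.
move=> DV; elim: r => [|j r IH]; first by rewrite big_nil; exact: W12pair_0.
by rewrite big_cons; exact: W12pair_lin.
Qed.

Lemma symbilin_sub (V : lmodType R) (D D' : V -> Prop) (b : V -> V -> R) :
  (forall v, D v -> D' v) -> symbilin D' b -> symbilin D b.
Proof.
move=> DD [bs bl]; split=> [x y /DD Dx /DD Dy|k x y z /DD Dx /DD Dy /DD Dz].
  exact: bs.
exact: bl.
Qed.

Lemma fst_symbilin : symbilin pairL2 (fun X Y => ip X.1 Y.1).
Proof.
split=> [X Y _ _|k X Y Z [x _] [y _] [z _]]; first exact: ipC.
exact: ip_lin.
Qed.

Lemma W12form_symbilin : symbilin pairL2 W12form.
Proof.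
split=> [X Y _ _|k X Y Z [x x'] [y y'] [z z']]; first by rewrite /W12form !(ipC Y.1) (ipC Y.2).
by rewrite /W12form !ip_lin //; ring.
Qed.

Lemma W12form_ge0 X : 0 <= W12form X X.
Proof. by rewrite addr_ge0 ?ip_ge0. Qed.

Lemma pairing_lin k x y X Y : inL2 x -> inL2 y -> pairL2 X -> pairL2 Y ->
  pairing x y (k *: X + Y) = k * pairing x y X + pairing x y Y.
Proof. by move=> lx ly [? ?] [? ?]; rewrite /pairing !ip_linr //; ring. Qed.

Lemma pairing_0 x y : pairing x y 0 = 0.
Proof.
have H z : ip z 0 = 0.
  by rewrite /ip; under eq_Rintegral do rewrite dot0r; rewrite Rintegral_cst // mul0r.
by rewrite /pairing /= !H addr0.
Qed.

Lemma pairing_bound x y W : inL2 x -> inL2 y -> pairL2 W ->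
  pairing x y W ^+ 2 <= 2 * (ip x x + ip y y) * W12form W W.
Proof.
move=> lx ly [l1 l2]; have := ip_CS lx l1; have := ip_CS ly l2.
have := ip_ge0 x; have := ip_ge0 y; have := ip_ge0 W.1; have := ip_ge0 W.2.
rewrite /pairing /W12form; move: (ip x W.1) (ip y W.2) => u v ? ? ? ? ? ?.
have := sqr_ge0 (u - v); rewrite !expr2; nra.
Qed.

Lemma small_sqr_eq0 (u C : R) : (forall e, 0 < e -> u ^+ 2 <= C * e) -> u = 0.
Proof.
move=> uC; apply/eqP; rewrite -sqrf_eq0; apply/eqP/le_anti; rewrite sqr_ge0 andbT.
apply/ler_addgt0Pr => e e0; rewrite add0r.
have C0 : 0 < `|C| + 1 by rewrite ltr_wpDl.
apply: le_trans (uC (e / (`|C| + 1)) _) _; first exact: divr_gt0.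
rewrite mulrCA mulrC ler_piMl ?(ltW e0) // ler_pdivrMr // mul1r.
by have := ler_norm C; lra.
Qed.

(** A pairing with fixed L^2 functions is continuous for [W12form]. All identities proved on
    [W12pair] reach the closure through this lemma. *)
Lemma pairing_W12limit x y W : inL2 x -> inL2 y -> (forall Phi, W12pair Phi -> pairing x y Phi = 0) ->
  W12limit W -> pairing x y W = 0.
Proof.
move=> lx ly f0 [lW WD]; apply: (@small_sqr_eq0 _ (2 * (ip x x + ip y y))) => e e0.
have [X DX hX] := WD e e0.
have -> : pairing x y W = pairing x y ((-1) *: X + W).
  by rewrite (pairing_lin _ lx ly (W12pair_pairL2 DX) lW) (f0 X DX); ring.
apply: le_trans (pairing_bound _ _ _) _ => //; first by apply: pairL2_lin => //; exact: W12pair_pairL2.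
by rewrite ler_wpM2l // mulr_ge0 // addr_ge0 ?ip_ge0.
Qed.

Lemma cut_le_int (f : R -> R) a b : mu.-integrable setT (EFin \o f) ->
  (forall t, 0 <= f t) -> \int[mu]_(t in `[a, b]) f t <= \int[mu]_t f t.
Proof.
move=> fi f0; rewrite -lee_fin (EFin_Rint fi) /Rintegral fineK; last first.
  by apply: integrable_fin_num => //; exact: itv_integrableT.
apply: ge0_subset_integral => //; last by move=> t _; rewrite lee_fin.
by apply/measurable_EFinP; apply/measurable_EFinP; case/integrableP: fi.
Qed.

Variables P Q S : R -> 'M[R]_n.
Hypotheses (bP : bmx P) (bQ : bmx Q) (bS : bmx S).
Hypotheses (symP : forall t, (P t)^T = P t) (symS : forall t, (S t)^T = S t).

Definition momentum_part W : R -> vec := fun t => P t *m W.2 t + Q t *m W.1 t.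
Definition force_part W : R -> vec := fun t => (Q t)^T *m W.2 t + S t *m W.1 t.
(** The form of the operator after one integration by parts. As a pairing with L^2 functions it is
    visibly continuous in the second argument. *)
Definition index_form W X : R := pairing (force_part W) (momentum_part W) X.

Lemma bmx_tr (M : R -> 'M[R]_n) : bmx M -> bmx (fun t => (M t)^T).
Proof.
move=> bM i j; have [mM [C MC]] := bM j i; split.
  by move: mM; congr measurable_fun; apply/funext => t; rewrite mxE.
by exists C => t; rewrite mxE.
Qed.

Lemma momentum_part_L2 W : pairL2 W -> inL2 (momentum_part W).
Proof. by move=> [? ?]; apply: inL2D; apply: inL2_mulmx. Qed.

Lemma force_part_L2 W : pairL2 W -> inL2 (force_part W).
Proof.
by move=> [? ?]; apply: inL2D; apply: inL2_mulmx => //; exact: bmx_tr.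
Qed.

Lemma index_form_int W X : pairL2 W -> pairL2 X -> index_form W X =
  \int[mu]_t (dot (P t *m W.2 t + Q t *m W.1 t) (X.2 t)
    + dot ((Q t)^T *m W.2 t + S t *m W.1 t) (X.1 t)).
Proof.
move=> lW lX; have [x1 x2] := lX; rewrite RintegralD //.
- by rewrite addrC.
- by apply: dot_integrable => //; exact: momentum_part_L2.
- by apply: dot_integrable => //; exact: force_part_L2.
Qed.

Lemma index_form_symbilin : symbilin pairL2 index_form.
Proof.
have sy X Y : pairL2 X -> pairL2 Y -> index_form X Y = index_form Y X.
  move=> lX lY; rewrite !index_form_int //; apply: eq_Rintegral => t _.
  have h1 : dot (P t *m X.2 t) (Y.2 t) = dot (P t *m Y.2 t) (X.2 t).
    by rewrite dot_mxl symP dotC.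
  have h2 : dot (Q t *m X.1 t) (Y.2 t) = dot ((Q t)^T *m Y.2 t) (X.1 t).
    by rewrite dot_mxl dotC.
  have h3 : dot ((Q t)^T *m X.2 t) (Y.1 t) = dot (Q t *m Y.1 t) (X.2 t).
    by rewrite dot_mxl trmxK dotC.
  have h4 : dot (S t *m X.1 t) (Y.1 t) = dot (S t *m Y.1 t) (X.1 t).
    by rewrite dot_mxl symS dotC.
  by rewrite !dotDl h1 h2 h3 h4; ring.
split=> // k X Y Z lX lY lZ; rewrite sy //; last exact: pairL2_lin.
rewrite /index_form pairing_lin //; [|exact: force_part_L2|exact: momentum_part_L2].
by rewrite -!/(index_form _ _) !(sy Z).
Qed.

Definition weak_eigen (l : R) W : Prop :=
  W12limit W /\ forall Phi, W12pair Phi -> index_form W Phi = l * ip W.1 Phi.1.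

(** The difference of both sides is a pairing in [X]. The extension is needed because
    eigenfunctions, known only to lie in the closure, are tested against each other. *)
Lemma weak_eigen_W12limit l W X : weak_eigen l W -> W12limit X -> index_form W X = l * ip W.1 X.1.
Proof.
move=> [[lW _] Wq] cX; have [w1 w2] := lW.
have lz := momentum_part_L2 lW; have ly := force_part_L2 lW.
have := @pairing_W12limit ((- l) *: W.1 + force_part W) (momentum_part W) X (inL2_lin _ w1 ly) lz _ cX.
have E Y : pairL2 Y -> pairing ((- l) *: W.1 + force_part W) (momentum_part W) Y = index_form W Y - l * ip W.1 Y.1.
  by move=> [y1 y2]; rewrite /index_form /pairing ip_lin //; ring.
rewrite E; last by case: cX.
move=> H; apply/eqP; rewrite -subr_eq0; apply/eqP; apply: H => Phi DPhi.
by rewrite E ?Wq ?subrr //; exact: W12pair_pairL2.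
Qed.

Variables (c1 K1 T : R).
Hypotheses (c1_gt0 : 0 < c1) (K1_ge0 : 0 <= K1) (T_gt0 : 0 < T).
Hypothesis coerc : forall t (x y : vec),
  c1 * (dot x x + dot y y) - K1 * \1_`[(- T), T] t * dot x x <=
  dot (P t *m y + Q t *m x) y + dot ((Q t)^T *m y + S t *m x) x.

Lemma pairL2_dot_int W : pairL2 W -> mu.-integrable setT (EFin \o (fun t => dot (W.1 t) (W.1 t))) /\
  mu.-integrable setT (EFin \o (fun t => dot (W.2 t) (W.2 t))).
Proof. by move=> [w1 w2]; split; apply: dot_integrable. Qed.

Lemma index_form_lower W : pairL2 W ->
  c1 * W12form W W - K1 * \int[mu]_(t in `[(- T), T]) dot (W.1 t) (W.1 t) <= index_form W W.
Proof.
move=> lW; have [i1 i2] := pairL2_dot_int lW.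
have i1T : mu.-integrable setT (EFin \o ((fun t => dot (W.1 t) (W.1 t)) \_ `[(- T), T])).
  rewrite -restrict_EFin -integrable_mkcond //.
  exact: itv_integrableT.
have mT := @measurableT _ (measurableTypeR R).
rewrite index_form_int // Rintegral_mkcond /W12form /ip.
rewrite -RintegralD // -RintegralZl //; last exact: integrable_D.
rewrite -mulNr -RintegralZl // -RintegralD //; last 2 first.
- by apply: integrable_Z => //; exact: integrable_D.
- exact: integrable_Z.
apply: le_Rintegral => //.
- by apply: integrable_D => //; apply: integrable_Z => //; exact: integrable_D.
- have [w1 w2] := lW.
  apply: integrable_D => //; apply: dot_integrable => //; [exact: momentum_part_L2|exact: force_part_L2].
move=> t _; apply: le_trans (coerc t (W.1 t) (W.2 t)).
rewrite mulNr lerD2l lerN2 patchE indicE; case: ifP => _.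
  by rewrite mulr1.
by rewrite !(mulr0, mul0r).
Qed.

Lemma index_form_lower_L2 W : pairL2 W -> c1 * W12form W W - K1 * ip W.1 W.1 <= index_form W W.
Proof.
move=> lW; apply: le_trans (index_form_lower lW); rewrite lerD2l lerN2 ler_wpM2l //.
by apply: cut_le_int; [case: (pairL2_dot_int lW)|move=> t; exact: dotxx_ge0].
Qed.

(** The functionals are the coordinates of the values at the points of a grid of [[- T, T]]. The
    grid is so fine that half of the coercivity absorbs the derivative term of the Poincare
    inequality. *)
Lemma index_form_coercive : exists (I : finType) (l : I -> pairL -> R) (C : R), [/\ 0 <= C,
  forall i, linform W12pair (l i),
  forall W, W12pair W -> c1 / 2 * W12form W W <= index_form W W + C * \sum_i l i W ^+ 2 &
  forall i W, W12pair W -> l i W ^+ 2 <= 2 * W12form W W].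
Proof.
(* With step d = 2 T / (N+1) the term to absorb is 2 K1 d^2 = (c1 / 2) B / (N+1)^2, which is at most
   c1 / 2 as soon as B <= N+1. *)
pose B := 16 * K1 * T ^+ 2 / c1.
have B0 : 0 <= B.
  by apply: divr_ge0; [rewrite mulr_ge0 ?sqr_ge0 // mulr_ge0|exact: ltW].
have [N BN] : exists N : nat, B <= N.+1%:R.
  exists (Num.truncn B); exact: ltW (truncnS_gt _).
pose d := 2 * T / N.+1%:R.
have N0 : 0 < N.+1%:R :> R by [].
have d0 : 0 <= d by rewrite /d divr_ge0 ?mulr_ge0 ?ltW.
have dN : - T + d * N.+1%:R = T by rewrite /d divfK ?gt_eqF //; ring.
have Kd : K1 * (2 * d ^+ 2) <= c1 / 2.
  have -> : K1 * (2 * d ^+ 2) = c1 / 2 * (B / N.+1%:R) / N.+1%:R.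
    rewrite /B /d; field; rewrite !gt_eqF //.
  rewrite -mulrA ler_piMr //; first by rewrite divr_ge0 // ltW.
  apply: mulr_ile1; [exact: divr_ge0|by rewrite invr_ge0| |by rewrite invf_le1 // ler1n].
  by rewrite ler_pdivrMr // mul1r.
pose l (ki : 'I_N.+1 * 'I_n) (W : pairL) := W.1 (- T + d * ki.1%:R) ki.2 0.
exists ('I_N.+1 * 'I_n)%type, l, (K1 * (2 * d)); split.
- by rewrite mulr_ge0 // mulr_ge0.
- by move=> [k i] a X Y _ _; rewrite /l !mxE.
- move=> W [lW Wi]; have [w1 w2] := lW.
  have [i1 i2] := pairL2_dot_int lW.
  have key : \int[mu]_(t in `[(- T), T]) dot (W.1 t) (W.1 t) <=
      2 * d * (\sum_ki l ki W ^+ 2) + 2 * d ^+ 2 * W12form W W.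
    have S2 (x : R -> vec) : inL2 x -> \int[mu]_(t in `[(- T), T]) dot (x t) (x t) =
        \sum_i \int[mu]_(t in `[(- T), T]) (x t i 0 ^+ 2).
      move=> lx; rewrite Rintegral_sum // => i.
      exact: itv_integrableT (L2_mul (lx i) (lx i)).
    rewrite S2 //.
    apply: le_trans (_ : _ <= \sum_i (2 * d * (\sum_(k < N.+1) l (k, i) W ^+ 2) +
       2 * d ^+ 2 * \int[mu]_(t in `[(- T), T]) (W.2 t i 0 ^+ 2))) _.
      apply: ler_sum => i _.
      have := @poincare_grid R _ _ (- T) d N.+1 (w1 i) (w2 i) (Wi i) d0.
      by rewrite dN.
    rewrite big_split /= -!mulr_sumr -S2 //.
    rewrite exchange_big pair_big /=.
    apply: lerD.
      by rewrite le_eqVlt; apply/orP; left; apply/eqP; congr (_ * _); apply: eq_bigr => -[].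
    apply: ler_wpM2l; first by rewrite mulr_ge0 ?sqr_ge0.
    apply: le_trans (cut_le_int _ _ i2 _) _; first by move=> t; exact: dotxx_ge0.
    by rewrite /W12form lerDr ip_ge0.
  have h1 := index_form_lower lW; have h2 := ler_wpM2l K1_ge0 key.
  have h3 := ler_wpM2r (W12form_ge0 W) Kd.
  move: h1 h2 h3; move: (W12form W W) (index_form W W) (\sum_ki l ki W ^+ 2) (Rintegral _ _ _).
  by clearbody d => H q0 SS II h1 h2 h3; lra.
move=> [k i] W [lW Wi]; have [w1 w2] := lW; rewrite /l /=.
set a := - T + _.
(* A unit interval to the right of the grid point gives the evaluation bound with constant 2. *)
have aa : a < a + 1 by rewrite ltrDl.
have := @point_bound R _ _ a (a + 1) (w1 i) (w2 i) (Wi i) aa.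
rewrite addrAC subrr add0r expr1n !mul1r mulr1 => H.
apply: le_trans H _; rewrite -mulrDr ler_wpM2l //.
have L (x : R -> vec) : inL2 x -> \int[mu]_(t in `[a, a + 1]) (x t i 0 ^+ 2) <= ip x x.
  move=> lx; apply: le_trans (cut_le_int _ _ (L2_sqr (lx i)) _) _.
    by move=> t; exact: sqr_ge0.
  apply: le_Rintegral => //; [exact: L2_sqr (lx i)|exact: dot_integrable|].
  by move=> t _; exact: coord_le_dot.
by rewrite lerD ?L.
Qed.

Section Deflation.
Variables (m : nat) (e : nat -> pairL) (lam : nat -> R).
Hypothesis lam_lt0 : forall i, (i < m)%N -> lam i < 0.
Hypothesis e_eig : forall i, (i < m)%N -> weak_eigen (lam i) (e i).
Hypothesis e_orth : forall i j, (i < m)%N -> (j < m)%N ->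
  ip (e i).1 (e j).1 = (i == j)%:R.

(** Deflation: subtracting [lam i] times the projections onto the known eigenfunctions moves their
    eigenvalues to 0 and leaves the form unchanged on their orthogonal complement. *)
Definition qE X Y : R :=
  index_form X Y - \sum_(i < m) lam i * ip X.1 (e i).1 * ip Y.1 (e i).1.

Lemma e_L2 (i : 'I_m) : pairL2 (e i).
Proof. by case: (e_eig (ltn_ord i)) => -[]. Qed.

Lemma qE_symbilin : symbilin pairL2 qE.
Proof.
have [qs ql] := index_form_symbilin.
split=> [X Y lX lY|k X Y Z lX lY lZ].
  by rewrite /qE qs //; congr (_ - _); apply: eq_bigr => i _; ring.
rewrite /qE ql // mulrBr mulr_sumr.
have -> : k * index_form X Z - (\sum_(i < m) k * (lam i * ip X.1 (e i).1 * ip Z.1 (e i).1))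
   + (index_form Y Z - \sum_(i < m) lam i * ip Y.1 (e i).1 * ip Z.1 (e i).1) =
   k * index_form X Z + index_form Y Z - ((\sum_(i < m) k * (lam i * ip X.1 (e i).1 * ip Z.1 (e i).1)) +
    \sum_(i < m) lam i * ip Y.1 (e i).1 * ip Z.1 (e i).1) by ring.
rewrite -big_split /=; congr (_ - _); apply: eq_bigr => i _.
by have [ei _] := e_L2 i; case: lX => ? _; case: lY => ? _; rewrite ip_lin //; ring.
Qed.

(** Because [lam i < 0], deflation only raises the form, so the coercivity estimates for
    [index_form] carry over. *)
Lemma qE_ge_index_form X : index_form X X <= qE X X.
Proof.
rewrite lerDl oppr_ge0; apply: sumr_le0 => i _.
by rewrite -mulrA -expr2 nmulr_rle0 ?sqr_ge0 // lam_lt0.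
Qed.

(** The L^2 function which, paired together with [momentum_part W], represents the functional
    [X |-> qE W X - l * ip W.1 X.1], as [qE_pairing] shows. *)
Definition yE W (l : R) : R -> vec :=
  (- l) *: W.1 + (\sum_(i < m) (- (lam i * ip W.1 (e i).1)) *: (e i).1 + force_part W).

Lemma yE_L2 W l : pairL2 W -> inL2 (yE W l).
Proof.
move=> lW; have [w1 _] := lW; apply: inL2_lin => //; apply: inL2D; last exact: force_part_L2.
by apply: inL2_sum => i; case: (e_L2 i).
Qed.

Lemma qE_pairing W l X : pairL2 W -> pairL2 X ->
  qE W X - l * ip W.1 X.1 = pairing (yE W l) (momentum_part W) X.
Proof.
move=> lW lX; have [w1 _] := lW; have [x1 _] := lX.
have le : inL2 (\sum_(i < m) (- (lam i * ip W.1 (e i).1)) *: (e i).1).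
  by apply: inL2_sum => i; case: (e_L2 i).
rewrite /pairing /yE ip_lin //; last by apply: inL2D => //; exact: force_part_L2.
rewrite ipDl //; last exact: force_part_L2.
rewrite ip_sum //; last by move=> i; case: (e_L2 i).
rewrite /qE /index_form /pairing.
have -> : \sum_(i < m) - (lam i * ip W.1 (e i).1) * ip (e i).1 X.1 =
   - \sum_(i < m) lam i * ip W.1 (e i).1 * ip X.1 (e i).1.
  by rewrite -sumrN; apply: eq_bigr => i _; rewrite (ipC X.1) mulNr.
by ring.
Qed.

(** The minimizing sequence of the deflated Rayleigh quotient is Cauchy for [W12form]. Its limit
    satisfies the deflated equation, and testing that equation with the known eigenfunctions shows
    that the deflation terms vanish. *)
Lemma eigen_step X0 : W12pair X0 -> qE X0 X0 < 0 ->
  exists (W : pairL) (l : R), [/\ l < 0, weak_eigen l W, ip W.1 W.1 = 1 &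
    forall i, (i < m)%N -> ip W.1 (e i).1 = 0].
Proof.
move=> DX0 qX0.
have [I [l [C [C0 ll lC lK]]]] := index_form_coercive.
have DL := W12pair_pairL2.
have [l0 [w [l0_lt0 l0_le wP hw]]] :
  exists (l0 : R) (w : nat -> pairL), [/\ l0 < 0,
    forall X, W12pair X -> l0 * ip X.1 X.1 <= qE X X,
    forall j : nat, [/\ W12pair (w j), ip (w j).1 (w j).1 = 1 &
      qE (w j) (w j) - l0 <= 8^-1 ^+ j] &
    forall i j, (i <= j)%N ->
      W12form ((-1) *: w j + w i) ((-1) *: w j + w i) <= 8^-1 ^+ i].
  apply: (@minimizing_cauchy R _ W12pair W12pair_lin qE (fun X Y => ip X.1 Y.1) W12form I l
    (c1 / 2) c1 C K1 2 X0) => //.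
  - exact: symbilin_sub DL qE_symbilin.
  - exact: symbilin_sub DL fst_symbilin.
  - exact: symbilin_sub DL W12form_symbilin.
  - by rewrite divr_gt0.
  - by move=> X _; rewrite ip_ge0 /= /W12form lerDl ip_ge0.
  - by move=> X DX; apply: le_trans (lC X DX) _; rewrite lerD2r qE_ge_index_form.
  - by move=> X DX; apply: le_trans (index_form_lower_L2 (DL _ DX)) (qE_ge_index_form X).
have Dw j : W12pair (w j) by case: (wP j).
have [w1 w2] : (forall j, inL2 (w j).1) /\ (forall j, inL2 (w j).2).
  by split=> j; case: (Dw j) => -[].
have [G1 lG1 wG1] : exists2 g, inL2 g & forall i,
    ip ((-1) *: g + (w i).1) ((-1) *: g + (w i).1) <= n%:R * (8^-1) ^+ i.
  apply: vec_complete => // i j ij; apply: le_trans (hw i j ij).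
  by rewrite /W12form lerDl ip_ge0.
have [G2 lG2 wG2] : exists2 g, inL2 g & forall i,
    ip ((-1) *: g + (w i).2) ((-1) *: g + (w i).2) <= n%:R * (8^-1) ^+ i.
  apply: vec_complete => // i j ij; apply: le_trans (hw i j ij).
  by rewrite /W12form lerDr ip_ge0.
pose G : pairL := (G1, G2).
have lG : pairL2 G by [].
have geom8 (e0 : R) : 0 < e0 -> exists i : nat, 8^-1 ^+ i <= e0.
  move=> e00; have := @cvg_geometric R 1 8^-1.
  rewrite ger0_norm ?invr_ge0 // invf_lt1 // ltr1n => /(_ isT).
  move=> /cvgrPdist_le/(_ e0 e00)[N _ /(_ N (leqnn N))] /=.
  rewrite sub0r normrN mul1r => H; exists N; exact: le_trans (ler_norm _) H.
have hG i : W12form ((-1) *: G + w i) ((-1) *: G + w i) <= 2 * n%:R * 8^-1 ^+ i.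
  by have := wG1 i; have := wG2 i; rewrite /W12form /=; lra.
have hG' i : W12form ((-1) *: w i + G) ((-1) *: w i + G) <= 2 * n%:R * 8^-1 ^+ i.
  apply: le_trans (hG i).
  have lw := DL _ (Dw i).
  rewrite !(symbilin_expand pairL2_lin) //; try exact: W12form_symbilin.
  by rewrite (W12form_symbilin.1 _ _ lw lG); lra.
have cG : W12limit G.
  split=> // e0 e00; have e1 : 0 < e0 / (2 * n%:R + 1).
    by rewrite divr_gt0 // ltr_wpDl // mulr_ge0.
  have [i ie] := geom8 _ e1; exists (w i) => //.
  apply: le_trans (hG' i) _; move: ie; rewrite ler_pdivlMr ?ltr_wpDl ?mulr_ge0 //.
  have : 0 <= 8^-1 ^+ i :> R by rewrite exprn_ge0 // invr_ge0.
  by move=> ? ?; lra.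
(* The constraint passes to the limit because the difference of the squared norms is the inner
   product of the difference and the sum, which tends to 0 by Cauchy-Schwarz. *)
have Gnorm : ip G1 G1 = 1.
  apply/eqP; rewrite -subr_eq0; apply/eqP.
  apply: (@small_sqr_eq0 _ (n%:R * (2 * ip G1 G1 + 2))) => e0 e00.
  have [i ie] := geom8 _ e00; have [_ si _] := wP i.
  have lm : inL2 ((-1) *: G1 + (w i).1) by apply: inL2_lin.
  have lp : inL2 (1 *: G1 + (w i).1) by apply: inL2_lin.
  have E : ip G1 G1 - 1 = - ip ((-1) *: G1 + (w i).1) (1 *: G1 + (w i).1).
    by rewrite ip_linr // !ip_lin // si (ipC (w i).1 G1); ring.
  have E2 : ip (1 *: G1 + (w i).1) (1 *: G1 + (w i).1) <= 2 * ip G1 G1 + 2.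
    have := ip_ge0 ((-1) *: G1 + (w i).1).
    by rewrite !ip_linr // !ip_lin // si (ipC (w i).1 G1); lra.
  rewrite E sqrrN; apply: le_trans (ip_CS lm lp) _.
  rewrite -mulrA [_ * e0]mulrC mulrA; apply: ler_pM => //; try exact: ip_ge0.
  by apply: le_trans (wG1 i) _; rewrite ler_wpM2l.
have bsym : symbilin W12pair (fun X Y => qE X Y - l0 * ip X.1 Y.1).
  apply: symbilin_comb; first exact: symbilin_sub DL qE_symbilin.
  exact: symbilin_sub DL fst_symbilin.
have b0 X : W12pair X -> 0 <= qE X X - l0 * ip X.1 X.1.
  by move=> DX; rewrite subr_ge0 l0_le.
(* The Rayleigh quotient is not differentiated. As a functional of its argument, the value at [G] is
   split into the value at [w i], small by Cauchy-Schwarz for the nonnegative form [qE - l0 * ip],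
   and the value at [G - w i], small by continuity of the pairing. *)
have Gq Phi : W12pair Phi -> qE G Phi - l0 * ip G.1 Phi.1 = 0.
  move=> DPhi; have lPhi := DL _ DPhi; have [p1 _] := lPhi.
  have ly := yE_L2 l0 lPhi; have lz := momentum_part_L2 lPhi.
  have -> : qE G Phi - l0 * ip G.1 Phi.1 = pairing (yE Phi l0) (momentum_part Phi) G.
    by rewrite -qE_pairing // (qE_symbilin.1 _ _ lG lPhi) ipC.
  pose CP := ip (yE Phi l0) (yE Phi l0) + ip (momentum_part Phi) (momentum_part Phi).
  have CP0 : 0 <= CP by rewrite addr_ge0 ?ip_ge0.
  pose BP := qE Phi Phi - l0 * ip Phi.1 Phi.1.
  apply: (@small_sqr_eq0 _ (2 * (2 * CP * (2 * n%:R)) + 2 * BP)) => e0 e00.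
  have [i ie] := geom8 _ e00.
  have h1 := pairing_bound ly lz (pairL2_lin (-1) (DL _ (Dw i)) lG).
  rewrite (pairing_lin _ ly lz (DL _ (Dw i)) lG) in h1.
  have h2 : pairing (yE Phi l0) (momentum_part Phi) (w i) ^+ 2 <= e0 * BP.
    rewrite -(qE_pairing _ lPhi (DL _ (Dw i))).
    have := cauchy_schwarz W12pair_lin bsym b0 DPhi (Dw i) => /le_trans; apply.
    rewrite mulrC ler_wpM2r ?b0 //; have [_ -> qi] := wP i.
    by rewrite mulr1; apply: le_trans ie.
  have h3 : 2 * CP * W12form (-1 *: w i + G) (-1 *: w i + G) <= 2 * CP * (2 * n%:R) * e0.
    rewrite -[leRHS]mulrA; apply: ler_wpM2l; first by rewrite mulr_ge0.
    by apply: le_trans (hG' i) _; rewrite ler_wpM2l // mulr_ge0.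
  have := le_trans h1 h3; move: h2.
  move: (pairing _ _ G) (pairing _ _ (w i)) => u v h2 h4.
  have := sqr_ge0 (u - v - v); rewrite !expr2 in h2 h4 *.
  by rewrite mulrDl; lra.
(* The [e i] used as test functions next are known only to lie in the closure. *)
have Gq' X : W12limit X -> qE G X - l0 * ip G.1 X.1 = 0.
  move=> cX; have [lX _] := cX; rewrite qE_pairing //.
  apply: pairing_W12limit => //; [exact: yE_L2|exact: momentum_part_L2|].
  by move=> Phi DPhi; rewrite -qE_pairing ?Gq //; exact: DL.
(* Tested with [e i], the form gives [lam i] times the inner product and the deflation removes
   exactly that; what remains is [l0] times the inner product, and [l0] is nonzero. *)
have Gorth i : (i < m)%N -> ip G1 (e i).1 = 0.
  move=> im; have [ce _] := e_eig im; have [lei _] := ce.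
  have := Gq' _ ce; rewrite /qE (index_form_symbilin.1 _ _ lG lei).
  rewrite (weak_eigen_W12limit (e_eig im) cG) (bigD1 (Ordinal im)) //= e_orth // eqxx mulr1.
  rewrite big1 ?addr0 => [|j ji]; last first.
    by rewrite e_orth // eq_sym (negbTE (_ : (j : nat) != i)) ?mulr0.
  rewrite [ip (e i).1 _]ipC subrr sub0r => /eqP.
  by rewrite oppr_eq0 mulf_eq0 (lt_eqF l0_lt0) /= => /eqP.
exists G, l0; split=> //; split=> // Phi DPhi.
have := Gq _ DPhi; rewrite /qE big1 ?subr0 => [/eqP|i _].
  by rewrite subr_eq0 => /eqP.
by rewrite Gorth // mulr0 mul0r.
Qed.

End Deflation.

(* An isotropic family on which the form has no kernel beyond zero bounds the
   number of negative directions from below: as long as fewer eigenfunctions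
   have been found, some combination is orthogonal to all of them, and it would
   be a null vector of a semidefinite form if the deflated form were
   nonnegative. *)
Lemma eigen_family (k : nat) (v : 'I_k -> pairL) :
  (forall i, W12pair (v i)) -> (forall i j, index_form (v i) (v j) = 0) ->
  (forall c : 'I_k -> R,
    (forall Phi, W12pair Phi -> \sum_i c i * index_form (v i) Phi = 0) -> forall i, c i = 0) ->
  exists (e : nat -> pairL) (lam : nat -> R), [/\
    forall i, (i < k)%N -> lam i < 0,
    forall i, (i < k)%N -> weak_eigen (lam i) (e i) &
    forall i j, (i < k)%N -> (j < k)%N -> ip (e i).1 (e j).1 = (i == j)%:R].
Proof.
move=> Dv qv0 vker.
suff H m : (m <= k)%N -> exists (e : nat -> pairL) (lam : nat -> R), [/\
    forall i, (i < m)%N -> lam i < 0,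
    forall i, (i < m)%N -> weak_eigen (lam i) (e i) &
    forall i j, (i < m)%N -> (j < m)%N -> ip (e i).1 (e j).1 = (i == j)%:R].
  exact: H.
elim: m => [_|m IH mk]; first by exists (fun=> 0), (fun=> 0).
have [e [lam [lam0 eig orth]]] := IH (ltnW mk).
have [X0 DX0 qX0] : exists2 X0, W12pair X0 & qE m e lam X0 X0 < 0.
  apply: contrapT => nX.
  have qE0 X : W12pair X -> 0 <= qE m e lam X X.
    by move=> DX; rewrite leNgt; apply/negP => qX; apply: nX; exists X.
  (* Since m < k this matrix has more rows than columns, so a nonzero row vector annihilates it; its
     entries are the coefficients of a combination orthogonal to every [e j]. *)
  pose A : 'M[R]_(k, m) := \matrix_(i, j) ip (v i).1 (e j).1.
  have : kermx A != 0.
    rewrite kermx_eq0 /row_free neq_ltn (leq_ltn_trans (rank_leq_col A)) //.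
  move=> /rowV0Pn[c /sub_kermxP cA c0].
  have lv i := W12pair_pairL2 (Dv i).
  have le i : (i < m)%N -> pairL2 (e i) by move=> im; case: (eig i im) => -[].
  pose X := \sum_i c 0 i *: v i.
  have DX : W12pair X by exact: W12pair_sum.
  have XE Phi : W12pair Phi -> index_form X Phi = \sum_i c 0 i * index_form (v i) Phi.
    move=> DPhi; have lPhi := W12pair_pairL2 DPhi.
    have [z1 z2] := (momentum_part_L2 lPhi, force_part_L2 lPhi).
    rewrite (index_form_symbilin.1 _ _ (W12pair_pairL2 DX) lPhi).
    transitivity (\sum_i c 0 i * index_form Phi (v i)); last first.
      by apply: eq_bigr => i _; rewrite (index_form_symbilin.1 _ _ (lv i) lPhi).
    rewrite /X; elim: (index_enum _) => [|i r IHr].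
      by rewrite !big_nil /index_form pairing_0.
    rewrite !big_cons -IHr /index_form pairing_lin //.
    by apply: W12pair_pairL2; exact: W12pair_sum.
  have Xe j : (j < m)%N -> ip X.1 (e j).1 = 0.
    move=> jm; have X1 : X.1 = \sum_i c 0 i *: (v i).1.
      rewrite /X; elim: (index_enum _) => [|i r IHr]; first by rewrite !big_nil.
      by rewrite !big_cons /= IHr.
    rewrite X1 ip_sum; [|by move=> i; case: (lv i)|by case: (le j jm)].
    have cAj := congr1 (fun B : 'rV[R]_m => B 0 (Ordinal jm)) cA; rewrite !mxE in cAj.
    by apply: etrans cAj; apply: eq_bigr => i _; rewrite mxE.
  have EqE Y : qE m e lam X Y = index_form X Y.
    by rewrite /qE big1 ?subr0 // => i _; rewrite Xe // mulr0 mul0r.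
  have qXX : qE m e lam X X = 0.
    rewrite EqE XE //; apply: big1 => i _.
    rewrite (index_form_symbilin.1 _ _ (lv i) (W12pair_pairL2 DX)) XE // big1 ?mulr0 // => j _.
    by rewrite qv0 mulr0.
  have c00 i : c 0 i = 0.
    apply: vker => Phi DPhi; rewrite -XE // -EqE.
    apply: (null_semidef W12pair_lin _ qE0 DX DPhi qXX).
    by apply: symbilin_sub W12pair_pairL2 _; exact: qE_symbilin.
  by case/eqP: c0; apply/rowP => i; rewrite c00 mxE.
have [W [l [l0 Wl W1 Worth]]] := eigen_step lam0 eig orth DX0 qX0.
exists (fun i => if i == m then W else e i), (fun i => if i == m then l else lam i).
split.
- move=> i im1; case: (eqVneq i m) => [//|im]; apply: lam0.
  by rewrite ltn_neqAle im -ltnS.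
- move=> i im1; case: (eqVneq i m) => [//|im]; apply: eig.
  by rewrite ltn_neqAle im -ltnS.
- move=> i j im1 jm1.
  have lt i0 : i0 != m -> (i0 < m.+1)%N -> (i0 < m)%N by rewrite ltnS ltn_neqAle => -> ->.
  have [ei|im] := boolP (i == m); have [ej|jm] := boolP (j == m).
  + by rewrite W1 (eqP ei) (eqP ej) eqxx.
  + by rewrite Worth ?lt // (eqP ei) eq_sym (negbTE jm).
  + by rewrite ipC Worth ?lt // (eqP ej) (negbTE im).
  + by apply: orth; apply: lt.
Qed.

End EigenvaluesFromForms.

(** * Regularity of weak eigenfunctions *)

Section WeakDerivatives.
Variables (R : realType) (n : nat).
Local Notation vec := 'cV[R]_n.
Local Notation mu := (@lebesgue_measure R).
Local Notation pairL := ((R -> vec) * (R -> vec))%type.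
Implicit Types (phi dphi f : R -> R) (x y z w g : R -> vec) (M dM : R -> 'M[R]_n).

(** Test functions are only C^1 so that the class is stable under multiplication by the C^1
    coefficients of the operator. *)
Definition C1c phi dphi : Prop :=
  C1 phi dphi /\ exists A, forall t, A < `|t| -> phi t = 0 /\ dphi t = 0.

Lemma supp_cut f A : (forall t, A < `|t| -> f t = 0) -> f \_ `[(- A), A] = f.
Proof.
move=> fA; apply/funext => t; rewrite patchE; case: ifPn => // /negP tA.
apply/esym/fA; rewrite ltNge; apply/negP => At; apply: tA.
by rewrite inE /= in_itv /= -ler_norml.
Qed.

Lemma supp_int f A : (forall t, A < `|t| -> f t = 0) ->
  \int[mu]_t f t = \int[mu]_(t in `[(- A), A]) f t.
Proof. by move=> fA; rewrite [RHS]Rintegral_mkcond supp_cut. Qed.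

Lemma supp_L2 f A : continuous f -> (forall t, A < `|t| -> f t = 0) -> L2 f.
Proof.
move=> cf fA; apply/L2P; split; first exact: continuous_measurable.
have c2 : continuous (fun t => f t ^+ 2) by move=> t; apply: cvgM; exact: cf.
have fA2 t : A < `|t| -> f t ^+ 2 = 0 by move=> /fA ->; rewrite expr0n.
rewrite -(supp_cut fA2) -restrict_EFin -integrable_mkcond //.
exact: continuous_itv_integrable.
Qed.

Lemma C1c_L2 phi dphi : C1c phi dphi -> L2 phi /\ L2 dphi.
Proof.
move=> [Cp [A pA]]; split.
  by apply: (@supp_L2 _ A); [exact: C1_continuous Cp|move=> t /pA[]].
by apply: (@supp_L2 _ A); [case: Cp|move=> t /pA[]].
Qed.

Definition weak_deriv x y : Prop := forall i phi dphi, C1c phi dphi ->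
  \int[mu]_t (x t i 0 * dphi t) = - \int[mu]_t (y t i 0 * phi t).

Definition coord_fun (i : 'I_n) phi : R -> vec := fun t => phi t *: delta_mx i 0.

Lemma coord_fun_coord i phi t j : coord_fun i phi t j 0 = phi t * (j == i)%:R.
Proof. by rewrite !mxE eqxx andbT. Qed.

Lemma dot_coord_fun i phi t (v : vec) : dot v (coord_fun i phi t) = v i 0 * phi t.
Proof.
rewrite /dot (bigD1 i) //= coord_fun_coord eqxx mulr1 big1 ?addr0 // => j ji.
by rewrite coord_fun_coord (negbTE ji) !mulr0.
Qed.

Lemma ip_coord_fun i phi x : ip x (coord_fun i phi) = \int[mu]_t (x t i 0 * phi t).
Proof. by apply: eq_Rintegral => t _; exact: dot_coord_fun. Qed.

Lemma coord_fun_L2 i phi : L2 phi -> inL2 (coord_fun i phi).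
Proof.
move=> lp; apply: inL2I => j; apply: L2_eq (L2Z (j == i)%:R lp) => t.
by rewrite coord_fun_coord mulrC.
Qed.

Lemma coord_fun_W12pair i phi dphi : C1c phi dphi -> W12pair (coord_fun i phi, coord_fun i dphi).
Proof.
move=> Cp; have [l1 l2] := C1c_L2 Cp; split; first by split; exact: coord_fun_L2.
move=> j; apply: C1_ibp; case: Cp => Cp _.
by apply: C1_eq (C1Z (j == i)%:R Cp) _ _ => t /=; rewrite coord_fun_coord mulrC.
Qed.

Lemma W12pair_weak_deriv W : W12pair W -> weak_deriv W.1 W.2.
Proof.
move=> [[w1 w2] Wi] i phi dphi Cp; have [l1 l2] := C1c_L2 Cp.
apply/eqP; rewrite -subr_eq0 opprK.
have i1 := L2_mul (w1 i) l2; have i2 := L2_mul (w2 i) l1.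
rewrite -RintegralD //; case: (Cp) => Cp1 [A pA].
have pA' t : Num.max A 0 < `|t| -> W.1 t i 0 * dphi t + W.2 t i 0 * phi t = 0.
  rewrite gt_max => /andP[/pA[-> ->] _]; by rewrite !mulr0 addr0.
rewrite (supp_int pA').
have A0 : 0 <= Num.max A 0 by rewrite le_max lexx orbT.
set B := Num.max A 0 in pA' A0 *.
(* [phi] is known to vanish only strictly beyond [A]; the margin 1 makes both boundary terms
   vanish. *)
have BB : - (B + 1) <= B + 1 by lra.
have pB t : B + 1 < `|t| -> W.1 t i 0 * dphi t + W.2 t i 0 * phi t = 0.
  by move=> Bt; apply: pA'; apply: lt_trans Bt; lra.
rewrite -(supp_int pA') (supp_int pB) (Wi i _ _ BB _ _ Cp1).
have pz t : `|t| = B + 1 -> phi t = 0.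
  move=> tB; apply: (pA t _).1; rewrite tB; apply: le_lt_trans (_ : B < _); last lra.
  by rewrite /B le_max lexx.
have p1 : phi (B + 1) = 0 by apply: pz; apply: ger0_norm; lra.
have p2 : phi (- (B + 1)) = 0 by apply: pz; rewrite normrN; apply: ger0_norm; lra.
by rewrite p1 p2 !mulr0 subrr.
Qed.

(** For a fixed test function the defining identity says that a pairing vanishes, so it is inherited
    by the closure. *)
Lemma W12limit_weak_deriv W : W12limit W -> weak_deriv W.1 W.2.
Proof.
move=> cW i phi dphi Cp; have [l1 l2] := C1c_L2 Cp.
have [[w1 w2] _] := cW.
have H : pairing (coord_fun i dphi) (coord_fun i phi) W = 0.
  apply: pairing_W12limit cW; [exact: coord_fun_L2|exact: coord_fun_L2|move=> X DX].
  rewrite /pairing ipC ip_coord_fun [X in _ + X]ipC ip_coord_fun.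
  by rewrite (W12pair_weak_deriv DX i Cp) addNr.
by move: H; rewrite /pairing ipC ip_coord_fun [X in _ + X]ipC ip_coord_fun => /eqP; rewrite addr_eq0 => /eqP.
Qed.

Lemma weak_deriv_lin k x y x' y' : inL2 x -> inL2 y -> inL2 x' -> inL2 y' ->
  weak_deriv x y -> weak_deriv x' y' -> weak_deriv (k *: x + x') (k *: y + y').
Proof.
move=> lx ly lx' ly' H H' i phi dphi Cp; have [l1 l2] := C1c_L2 Cp.
have p1 := coord_fun_L2 i l1; have p2 := coord_fun_L2 i l2.
rewrite -(ip_coord_fun i dphi (k *: x + x')) -(ip_coord_fun i phi (k *: y + y')).
by rewrite (ip_lin _ lx lx' p2) (ip_lin _ ly ly' p1) !ip_coord_fun (H i _ _ Cp) (H' i _ _ Cp); ring.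
Qed.

Definition C1bmx M dM : Prop := forall i j,
  C1 (fun t => M t i j) (fun t => dM t i j) /\
  exists C, forall t, `|M t i j| <= C /\ `|dM t i j| <= C.

Lemma C1bmx_bmx M dM : C1bmx M dM -> bmx M /\ bmx dM.
Proof.
move=> CM; split=> i j; have [CMij [C MC]] := CM i j.
  by split; [exact: continuous_measurable (C1_continuous CMij)|exists C => t; case: (MC t)].
by split; [case: CMij => _; exact: continuous_measurable|exists C => t; case: (MC t)].
Qed.

(** Product rule: the entries of [M] are moved onto the test function, which stays C^1 with compact
    support. *)
Lemma weak_deriv_mx M dM x y : C1bmx M dM -> inL2 x -> inL2 y -> weak_deriv x y ->
  weak_deriv (fun t => M t *m x t) (fun t => dM t *m x t + M t *m y t).
Proof.
move=> CM lx ly H i phi dphi Cp; have [l1 l2] := C1c_L2 Cp.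
have [bM bdM] := C1bmx_bmx CM.
have bL (N : R -> 'M[R]_n) j f : bmx N -> L2 f -> L2 (fun t => N t i j * f t).
  by move=> bN lf; have [mN [C NC]] := bN i j; exact: L2Mb NC lf.
have E (N : R -> 'M[R]_n) z f : bmx N -> inL2 z -> L2 f ->
    \int[mu]_t ((N t *m z t) i 0 * f t) =
    \sum_j \int[mu]_t (z t j 0 * (N t i j * f t)).
  move=> bN lz lf; rewrite -Rintegral_sum //.
    by apply: eq_Rintegral => t _; rewrite mxE mulr_suml; apply: eq_bigr => j _; ring.
  by move=> j; exact: L2_mul (lz j) (bL _ _ _ bN lf).
transitivity (- (\int[mu]_t ((dM t *m x t) i 0 * phi t) +
                 \int[mu]_t ((M t *m y t) i 0 * phi t))); last first.
  rewrite -RintegralD //.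
  - by congr (- _); apply: eq_Rintegral => t _; rewrite [in RHS]mxE; ring.
  - exact: L2_mul (inL2_mulmx bdM lx i) l1.
  - exact: L2_mul (inL2_mulmx bM ly i) l1.
rewrite !E // -big_split /= -sumrN; apply: eq_bigr => j _.
have [CMij [C MC]] := CM i j; case: (Cp) => Cp1 [A pA].
have Cj : C1c (fun t => M t i j * phi t) (fun t => dM t i j * phi t + M t i j * dphi t).
  split; first exact: C1M.
  by exists A => t /pA[-> ->]; rewrite !mulr0 addr0.
have := H j _ _ Cj.
have -> : \int[mu]_t (x t j 0 * (dM t i j * phi t + M t i j * dphi t)) =
  \int[mu]_t (x t j 0 * (dM t i j * phi t)) + \int[mu]_t (x t j 0 * (M t i j * dphi t)).
  rewrite -RintegralD //.
  - by apply: eq_Rintegral => t _; rewrite mulrDr.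
  - exact: L2_mul (lx j) (bL _ _ _ bdM l1).
  - exact: L2_mul (lx j) (bL _ _ _ bM l2).
by move=> H1; lra.
Qed.

Lemma C1bmx_mul M dM N dN : C1bmx M dM -> C1bmx N dN ->
  C1bmx (fun t => M t *m N t) (fun t => dM t *m N t + M t *m dN t).
Proof.
move=> CM CN i j; split.
  apply: C1_eq (@C1_sum R _ (index_enum 'I_n) (fun k t => M t i k * N t k j)
    (fun k t => dM t i k * N t k j + M t i k * dN t k j) _) _ _.
  - by move=> k; apply: C1M; [case: (CM i k)|case: (CN k j)].
  - by move=> t; rewrite mxE.
  - by move=> t; rewrite !mxE -big_split.
have [CA HA] := @choice _ _ (fun k c => forall t, `|M t i k| <= c /\ `|dM t i k| <= c)
  (fun k => (CM i k).2).
have [CB HB] := @choice _ _ (fun k c => forall t, `|N t k j| <= c /\ `|dN t k j| <= c)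
  (fun k => (CN k j).2).
have A0 k : 0 <= CA k by have [h _] := HA k 0; exact: le_trans h.
have B0 k : 0 <= CB k by have [h _] := HB k 0; exact: le_trans h.
exists (\sum_k 2 * (CA k * CB k)) => t; split.
  rewrite mxE; apply: le_trans (ler_norm_sum _ _ _) _; apply: ler_sum => k _.
  have [h1 _] := HA k t; have [h2 _] := HB k t.
  rewrite normrM; apply: le_trans (ler_pM _ _ h1 h2) _ => //.
  by rewrite ler_peMl ?mulr_ge0 // ler1n.
rewrite !mxE -big_split /=; apply: le_trans (ler_norm_sum _ _ _) _; apply: ler_sum => k _.
have [h1 h1'] := HA k t; have [h2 h2'] := HB k t.
apply: le_trans (ler_normD _ _) _; rewrite !normrM mulr2n mulrDl mul1r.
by apply: lerD; apply: ler_pM.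
Qed.

Lemma test_C1c phi : test_function phi -> C1c phi phi^`()%classic.
Proof.
move=> [sphi /compact_bounded[A [Ar HA]]].
have [cphi /(_ 1)[dphi [cD _]]] := sphi 1%N.
have E : phi^`()%classic = (fun x : R => 'D_1 phi x) by apply/funext => t; rewrite derive1E.
split; first by apply: C1_derive; [exact: dphi|rewrite E; exact: cD].
have phi0 t : A + 1 < `|t| -> phi t = 0.
  move=> At; apply: contrapT => /eqP pt.
  have := HA (A + 1); rewrite ltrDl ltr01 => /(_ isT t).
  have cl : closure [set t | phi t != 0] t by apply: subset_closure.
  by move=> /(_ cl) /=; rewrite leNgt At.
exists (A + 1) => t At; split; first exact: phi0.
rewrite derive1E (@near_eq_derive _ _ _ phi (cst 0)) ?derive_cst //.
have : nbhs t [set s | A + 1 < `|s|].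
  apply/nbhs_ballP; exists (`|t| - (A + 1)); first by rewrite /= subr_gt0.
  move=> s0; rewrite -ball_normE /= => ts.
  have : `|t| <= `|t - s0| + `|s0| by rewrite -{1}[t](subrK s0) ler_normD.
  by move: ts; lra.
by apply: filterS => s /phi0 ->.
Qed.

Lemma weak_deriv_W12 x y : inL2 x -> inL2 y -> weak_deriv x y -> W12 x y.
Proof. by move=> lx ly H; split=> // phi /test_C1c Cp i; exact: H. Qed.

End WeakDerivatives.

(** * From weak eigenfunctions to the Morse index *)

Section Eigenfunctions.
Variables (R : realType) (n : nat).
Local Notation vec := 'cV[R]_n.
Local Notation mu := (@lebesgue_measure R).
Local Notation pairL := ((R -> vec) * (R -> vec))%type.

Variables P Q S dP dQ M dM : R -> 'M[R]_n.
Hypotheses (CP : C1bmx P dP) (CQ : C1bmx Q dQ) (CM : C1bmx M dM) (bS : bmx S).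
Hypothesis MP : forall t, M t *m P t = 1%:M.

(** The weak equation states that z = P w' + Q w has an L^2 weak derivative. Since [M] inverts [P],
    w' = M z - (M Q) w is a combination of products of bounded C^1 matrices with functions having
    L^2 weak derivatives, so w' has one too. *)
Lemma weak_eigen_eigenfunction l (W : pairL) : weak_eigen P Q S l W -> eigenfunction (SLop P Q S) l W.1.
Proof.
move=> [cW Wq]; have [lW _] := cW; have [w1 w2] := lW.
have [bP _] := C1bmx_bmx CP; have [bQ _] := C1bmx_bmx CQ.
have [bM bdM] := C1bmx_bmx CM.
have lz := momentum_part_L2 bP bQ lW; have ly := force_part_L2 bQ bS lW.
set z := momentum_part P Q W in lz; set y := force_part Q S W in ly.
have lg : inL2 ((- l) *: W.1 + y) by exact: inL2_lin.
have wdW := W12limit_weak_deriv cW.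
have wdz : weak_deriv z ((- l) *: W.1 + y).
  move=> i phi dphi Cp; have [l1 l2] := C1c_L2 Cp.
  have := Wq _ (coord_fun_W12pair i Cp); rewrite /index_form /pairing /= -/z -/y => H.
  rewrite -!ip_coord_fun ip_lin //; last exact: coord_fun_L2.
  by move: H; lra.
split.
- have CMQ := C1bmx_mul CM CQ; have [bMQ bdMQ] := C1bmx_bmx CMQ.
  pose A1 : R -> vec := fun t => dM t *m z t + M t *m ((- l) *: W.1 + y) t.
  pose A2 : R -> vec := fun t => (dM t *m Q t + M t *m dQ t) *m W.1 t + (M t *m Q t) *m W.2 t.
  exists W.2, (-1 *: A2 + A1).
  split; first exact: weak_deriv_W12.
  have h1 := weak_deriv_mx CM lz lg wdz; have h2 := weak_deriv_mx CMQ w1 w2 wdW.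
  have lx1 := inL2_mulmx bM lz; have lx2 := inL2_mulmx bMQ w1.
  have ly1 : inL2 A1 by apply: inL2D; apply: inL2_mulmx.
  have ly2 : inL2 A2 by apply: inL2D; apply: inL2_mulmx.
  have := weak_deriv_lin (-1) lx2 ly2 lx1 ly1 h2 h1.
  have -> : (-1 *: (fun t => (M t *m Q t) *m W.1 t) + (fun t => M t *m z t)) = W.2.
    apply/funext => t; rewrite !fctE /z /momentum_part mulmxDr mulmxA MP mul1mx -mulmxA.
    by rewrite scaleN1r addrC addrK.
  by apply: weak_deriv_W12 => //; exact: inL2_lin.
- exact: inL2Z.
- exists W.2, ((- l) *: W.1 + y); split.
  + exact: weak_deriv_W12.
  + exact: weak_deriv_W12.
  + apply: aeW => t; rewrite !fctE /y /force_part opprD scaleNr opprK -addrA.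
    by rewrite subrK.
Qed.

Lemma ae_ip0 (x y : R -> vec) : inL2 x -> inL2 y ->
  {ae mu, forall t, x t = 0} -> ip x y = 0.
Proof.
move=> lx ly x0; rewrite /ip (@ae_Rint _ _ (cst 0)).
- by rewrite Rintegral_cst // mul0r.
- by have /integrableP[/measurable_EFinP] := dot_integrable lx ly.
- exact: measurable_cst.
- by move: x0; apply: ae_imp => t ->; rewrite dot0l.
Qed.

(** The Morse index sums multiplicities over distinct eigenvalues, so the eigenfunctions are grouped
    by eigenvalue. Each group is orthonormal, hence independent, and bounded by the multiplicity;
    the group sizes add up to [k]. *)
Lemma morse_index_ge (k : nat) (e : nat -> pairL) (lam : nat -> R) :
  (forall i, (i < k)%N -> lam i < 0) ->
  (forall i, (i < k)%N -> weak_eigen P Q S (lam i) (e i)) ->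
  (forall i j, (i < k)%N -> (j < k)%N -> ip (e i).1 (e j).1 = (i == j)%:R) ->
  (k%:R%:E <= morse_index (SLop P Q S))%E.
Proof.
move=> lam0 eig orth.
have le i : (i < k)%N -> inL2 (e i).1 by move=> ik; case: (eig i ik) => -[[]].
pose s := undup [seq lam (nat_of_ord i) | i <- enum 'I_k].
have sP l : l \in s -> exists2 i : 'I_k, lam i = l & true.
  by rewrite mem_undup => /mapP[i _ ->]; exists i.
have mult l : (#|[pred i : 'I_k | lam i == l]|%:R%:E <= multiplicity (SLop P Q S) l)%E.
  apply: ereal_sup_ubound; exists #|[pred i : 'I_k | lam i == l]| => //.
  pose ev (j : 'I_#|[pred i : 'I_k | lam i == l]|) : 'I_k := enum_val j.
  exists (fun j => (e (ev j)).1); split; last first.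
    move=> j; have := enum_valP j; rewrite inE => /eqP <-.
    by apply: weak_eigen_eigenfunction; apply: eig.
  move=> c c0 j; have x0 := c0.
  pose x : R -> vec := fun t => \sum_i c i *: (e (ev i)).1 t.
  have xE : x = \sum_i c i *: (e (ev i)).1.
    by apply/funext => t; rewrite /x fct_sumE.
  have lx : inL2 x by rewrite xE; apply: inL2_sum => i; exact: le.
  have := ae_ip0 lx (le _ (ltn_ord (ev j))) x0.
  rewrite xE ip_sum; [|by move=> i; exact: le|exact: le].
  rewrite (bigD1 j) //= orth // eqxx mulr1 big1 ?addr0 // => i ij.
  rewrite orth // (_ : (_ == _) = false) ?mulr0 //.
  by apply/negbTE; apply: contra ij => /eqP /ord_inj /enum_val_inj ->.
apply: esum_ge; exists [set` s].
  split; first exact: finite_seq.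
  move=> l /= /sP[i il _]; split; first by rewrite -il lam0.
  exists (e i).1; split; first by rewrite -il; apply: weak_eigen_eigenfunction; exact: eig.
  move=> e0; have := ae_ip0 (le _ (ltn_ord i)) (le _ (ltn_ord i)) e0.
  by rewrite orth // eqxx => /eqP; rewrite oner_eq0.
rewrite -fsbig_seq ?undup_uniq //.
apply: le_trans (_ : _ <= \sum_(l <- s) #|[pred i : 'I_k | lam i == l]|%:R%:E)%E _; last first.
  by apply: lee_sum => l _; exact: mult.
rewrite sumEFin lee_fin -natr_sum ler_nat.
under eq_bigr do rewrite -sum1_card big_mkcond /=.
rewrite exchange_big /= -[X in (X <= _)%N]card_ord -sum1_card.
apply: leq_sum => i _.
have il : lam i \in s by rewrite mem_undup; apply/mapP; exists i; rewrite ?mem_enum.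
by rewrite (big_rem (lam i)) //= inE eqxx.
Qed.

End Eigenfunctions.

(** * Smooth functions on phase space *)

Section Directional.
Variables (R : realType) (V : normedModType R).
Implicit Types (F : V -> R) (x y v w : V).

Lemma is_deriveP (U W : normedModType R) (f : U -> W) (a v : U) (df : W) :
  is_derive a v f df <-> h^-1 *: (f (h *: v + a) - f a) @[h --> 0^'] --> df.
Proof.
split=> [[df1 df2]|H]; first by rewrite -df2; exact: df1.
by split; [exact: cvgP H|exact: cvg_lim H].
Qed.

Lemma cvg_eq_fun (T : Type) (U : nbhsType) (H : set_system T) (f g : T -> U) (l : U) :
  f =1 g -> f @ H --> l -> g @ H --> l.
Proof. by move=> /funext ->. Qed.

Lemma is_derive_line F x v s : derivable F (x + s *: v) v ->
  is_derive s (1 : R) (fun s : R => F (x + s *: v)) ('D_v F (x + s *: v)).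
Proof.
move=> dF; apply/is_deriveP; have /is_deriveP := derivableP dF.
apply: cvg_eq_fun => h.
by rewrite (_ : h *: (1 : R) = h) ?scalerDl 1?addrCA //; exact: mulr1.
Qed.

(** Writing the intermediate point as a fraction [th] of [d] gives one statement for both signs of
    [d] and for [d = 0]. *)
Lemma MVT_line F x v (d : R) : (forall y, derivable F y v) ->
  exists2 th : R, 0 <= th <= 1 &
    F (x + d *: v) - F x = d * 'D_v F (x + (th * d) *: v).
Proof.
move=> dF; have D s := is_derive_line (dF (x + s *: v)).
have C (a b : R) : {within `[a, b], continuous (fun s : R => F (x + s *: v))}.
  apply: continuous_subspaceT => s; apply: differentiable_continuous.
  by apply/derivable1_diffP; apply: ex_derive.
have [d0|d0|->] := ltrgt0P d; last first.
- by exists 0; rewrite ?lexx ?ler01 // scale0r addr0 subrr mul0r.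
- have [c] := MVT_segment (ltW d0) (fun s _ => D s) (C d 0).
  rewrite in_itv /= => /andP[dc c0] E.
  exists (c / d); first by rewrite ler_ndivlMr // mul0r c0 ler_ndivrMr // mul1r dc.
  rewrite divfK ?lt_eqF // -[LHS]opprB; move: E; rewrite scale0r addr0 => ->.
  by rewrite sub0r mulrN opprK mulrC.
- have [c] := MVT_segment (ltW d0) (fun s _ => D s) (C 0 d).
  rewrite in_itv /= => /andP[c0 cd] E.
  exists (c / d); first by rewrite divr_ge0 ?(ltW d0) //= ler_pdivrMr // mul1r.
  rewrite divfK ?gt_eqF //; move: E; rewrite scale0r addr0 => ->.
  by rewrite subr0 mulrC.
Qed.

(** The base point [A h] moves with [h] because the chain rule changes the coordinates one at a
    time, each starting where the previous one stopped. The mean value theorem and continuity of the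
    partial derivative handle this. *)
Lemma quot_step F v x (A : R -> V) (d : R -> R) (c : R) :
  (forall y, derivable F y v) -> continuous ('D_v F) ->
  A h @[h --> 0^'] --> x -> h^-1 * d h @[h --> 0^'] --> c -> d h @[h --> 0^'] --> 0 ->
  h^-1 * (F (A h + d h *: v) - F (A h)) @[h --> 0^'] --> c * 'D_v F x.
Proof.
move=> dF cF Ax dc d0.
have ex h := MVT_line (A h) (d h) dF.
have [th] := @choice _ _ (fun h (t : R) => 0 <= t <= 1 /\
  F (A h + d h *: v) - F (A h) = d h * 'D_v F (A h + (t * d h) *: v))
  (fun h => let: ex_intro2 t t1 t2 := ex h in ex_intro _ t (conj t1 t2)).
move=> thP.
under eq_fun => h do rewrite (thP h).2 mulrA.
have Bx : A h + (th h * d h) *: v @[h --> 0^'] --> x.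
  rewrite -[x in X in _ --> X]addr0; apply: cvgD => //.
  rewrite -[X in _ --> X](scale0r v); apply: cvgZr_tmp.
  apply/cvgrPdist_le => e e0; move/cvgrPdist_le/(_ e e0): d0.
  apply: filterS => h; rewrite !sub0r !normrN normrM => H.
  have /andP[t0 t1] := (thP h).1; rewrite (ger0_norm t0).
  by apply: le_trans H; rewrite ler_piMl.
by apply: cvgM => //; exact: (cvg_comp _ _ Bx (cF x)).
Qed.

Lemma quot_sum F (I : Type) (r : seq I) (v : I -> V) (d : I -> R -> R) (c : I -> R) x :
  (forall i, (forall y, derivable F y (v i)) /\ continuous ('D_(v i) F)) ->
  (forall i, h^-1 * d i h @[h --> 0^'] --> c i /\ d i h @[h --> 0^'] --> 0) ->
  forall A : R -> V, A h @[h --> 0^'] --> x ->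
  h^-1 * (F (A h + \sum_(i <- r) d i h *: v i) - F (A h)) @[h --> 0^'] -->
    \sum_(i <- r) c i * 'D_(v i) F x.
Proof.
move=> FP dP; elim: r => [|i r IH] A Ax.
  under eq_fun do rewrite big_nil addr0 subrr mulr0.
  by rewrite big_nil; exact: cvg_cst.
pose B h := A h + d i h *: v i.
have Bx : B h @[h --> 0^'] --> x.
  rewrite -[x in X in _ --> X]addr0; apply: cvgD => //.
  rewrite -[X in _ --> X](scale0r (v i)); apply: cvgZr_tmp; exact: (dP i).2.
rewrite big_cons.
have -> : (fun h => h^-1 * (F (A h + \sum_(j <- i :: r) d j h *: v j) - F (A h))) =
  (fun h => h^-1 * (F (A h + d i h *: v i) - F (A h)) +
     h^-1 * (F (B h + \sum_(j <- r) d j h *: v j) - F (B h))).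
  apply/funext => h; rewrite big_cons addrA -/(B h); ring.
apply: cvgD; last exact: IH.
by apply: quot_step => //; [case: (FP i)|case: (FP i)|case: (dP i)|case: (dP i)].
Qed.

(** Chain rule from continuous directional derivatives alone, which is the form in which [Ck]
    supplies smoothness. *)
Lemma chain_sum F (I : Type) (r : seq I) (v : I -> V) (C : I -> R -> R) (c : I -> R) (t : R) :
  (forall i, (forall y, derivable F y (v i)) /\ continuous ('D_(v i) F)) ->
  (forall i, is_derive t (1 : R) (C i) (c i)) ->
  is_derive t (1 : R) (fun s : R => F (\sum_(i <- r) C i s *: v i))
    (\sum_(i <- r) c i * 'D_(v i) F (\sum_(i <- r) C i t *: v i)).
Proof.
move=> FP CP; set x := \sum_(i <- r) C i t *: v i.
pose d i h := C i (h + t) - C i t.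
have dc i : h^-1 * d i h @[h --> 0^'] --> c i.
  have /is_deriveP := CP i; apply: cvg_eq_fun => h.
  by rewrite /d /GRing.scale /= mulr1.
have d0 i : d i h @[h --> 0^'] --> 0.
  have idh : (fun h : R => h) h @[h --> 0^'] --> (0 : R).
    exact: cvg_within.
  have H := cvgM idh (dc i); rewrite mul0r in H.
  apply: (cvg_trans _ (H _)); apply: near_eq_cvg.
  near=> h; rewrite /= mulrA divff ?mul1r //.
  by near: h; exact: nbhs_dnbhs_neq.
apply/is_deriveP.
have H := @quot_sum F I r v d c x FP (fun i => conj (dc i) (d0 i)) (cst x) (@cvg_cst _ x _ _ _).
apply: (cvg_eq_fun _ (H _)) => h.
rewrite /GRing.scale /= mulr1; congr (_ * (F _ - _)).
rewrite -big_split /=; apply: eq_bigr => i _; rewrite -scalerDl /d; congr (_ *: _).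
by rewrite addrC subrK.
Unshelve. all: by end_near. Qed.

Lemma smooth_D F v : smooth F -> smooth ('D_v F).
Proof. by move=> sF k; have [_ /(_ v)[_]] := sF k.+1. Qed.

Lemma smooth_continuous F : smooth F -> continuous F.
Proof. by move=> sF; exact: (sF 0%N).1. Qed.

Lemma smooth_derivable F v x : smooth F -> derivable F x v.
Proof. by move=> sF; have [_ /(_ v)[]] := sF 1%N. Qed.

(** The second difference over a parallelogram is symmetric in its two sides. Two mean value
    theorems evaluate it as h^2 times either mixed derivative at a nearby point, and continuity
    concludes. *)
Lemma schwarz F v w x : smooth F -> 'D_w ('D_v F) x = 'D_v ('D_w F) x.
Proof.
move=> sF.
have dF u y : derivable F y u by exact: smooth_derivable.
have ddF u u' y : derivable ('D_u F) y u' by apply: smooth_derivable; exact: smooth_D.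
have cont u u' : continuous ('D_u ('D_u' F)).
  by apply: smooth_continuous; apply: smooth_D; exact: smooth_D.
(* second difference quotient along [a] then [b] *)
have key (a b : V) (h : R) : 0 < h -> exists p : V, `|x - p| <= h * (`|a| + `|b|) /\
    F (x + h *: a + h *: b) - F (x + h *: a) - (F (x + h *: b) - F x) =
    h * (h * 'D_b ('D_a F) p).
  move=> h0; pose G y := F (y + h *: b) - F y.
  have shift y : is_derive y a (fun z => F (z + h *: b)) ('D_a F (y + h *: b)).
    apply/is_deriveP; have /is_deriveP := derivableP (dF a (y + h *: b)).
    by apply: cvg_eq_fun => k; rewrite addrA.
  have dG y : is_derive y a G ('D_a F (y + h *: b) - 'D_a F y).
    by have H1 := shift y; have H2 := derivableP (dF a y); exact: is_deriveB H1 H2.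
  have [th /andP[th0 th1] E] := @MVT_line G x a h (fun y => @ex_derive _ _ _ _ _ _ _ (dG y)).
  have [et /andP[et0 et1] E2] := @MVT_line ('D_a F) (x + (th * h) *: a) b h (fun y => ddF a b y).
  exists (x + (th * h) *: a + (et * h) *: b); split.
    rewrite opprD opprD !addrA subrr sub0r -opprD normrN.
    apply: le_trans (ler_normD _ _) _; rewrite !normrZ mulrDr.
    rewrite (ger0_norm th0) (ger0_norm et0) (ger0_norm (ltW h0)).
    by apply: lerD; apply: ler_wpM2r => //; apply: ler_piMl => //; exact: ltW.
  rewrite -[LHS]/(G (x + h *: a) - G x) E; congr (_ * _).
  have [_ ->] := dG (x + (th * h) *: a).
  by rewrite E2.
apply/eqP; rewrite -subr_eq0 -normr_le0; apply/ler_addgt0Pr => e e0; rewrite add0r.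
have e2 : 0 < e / 2 by rewrite divr_gt0.
have /cvgrPdist_le/(_ _ e2)/nbhs_ballP[r1 /= r10 H1] := cont w v x.
have /cvgrPdist_le/(_ _ e2)/nbhs_ballP[r2 /= r20 H2] := cont v w x.
pose r := Num.min r1 r2; have r0 : 0 < r by rewrite lt_min r10.
(* The summand 1 keeps [N] positive when both directions vanish; [h] is then small enough for the
   two nearby points to lie in both continuity balls. *)
pose N := `|v| + `|w| + 1; have N0 : 0 < N by rewrite /N; have := normr_ge0 v; have := normr_ge0 w; lra.
pose h := r / (2 * N); have h0 : 0 < h by rewrite divr_gt0 // mulr_gt0.
have hN : h * (`|v| + `|w|) < r.
  rewrite /h -mulrA gtr_pMr // mulrC ltr_pdivrMr ?mulr_gt0 // mul1r /N.
  by have := normr_ge0 v; have := normr_ge0 w; lra.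
have [p [p1 p2]] := key v w h h0; have [p' [p1' p2']] := key w v h h0.
have swap (q1 q2 q3 q4 : R) : q1 - q2 - (q3 - q4) = q1 - q3 - (q2 - q4) by ring.
have eqs : x + h *: w + h *: v = x + h *: v + h *: w by rewrite addrAC.
rewrite eqs in p2'.
have E : 'D_w ('D_v F) p = 'D_v ('D_w F) p'.
  apply: (mulfI (lt0r_neq0 h0)); apply: (mulfI (lt0r_neq0 h0)).
  exact: etrans (esym p2) (etrans (swap _ _ _ _) p2').
have b1 : `|'D_w ('D_v F) x - 'D_w ('D_v F) p| <= e / 2.
  apply: H1; rewrite -ball_normE /=; apply: le_lt_trans p1 _.
  by apply: lt_le_trans hN _; rewrite ge_min lexx.
have b2 : `|'D_v ('D_w F) x - 'D_v ('D_w F) p'| <= e / 2.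
  apply: H2; rewrite -ball_normE /=; apply: le_lt_trans p1' _.
  by rewrite [X in h * X]addrC; apply: lt_le_trans hN _; rewrite ge_min lexx orbT.
have tri (q1 q2 q3 q4 : R) : q3 = q4 -> q1 - q2 = (q1 - q3) - (q2 - q4).
  by move=> ->; ring.
rewrite (tri _ _ _ _ E).
by apply: (le_trans (ler_normB _ _)); rewrite [e]splitr; exact: lerD b1 b2.
Qed.

End Directional.

(** * Chain rule and boundedness for functions of position and velocity *)

Section PhaseSpace.
Variables (R : realType) (n : nat).
Local Notation vec := 'cV[R]_n.
Implicit Types (F : vec * vec -> R) (a b : R -> vec).

Lemma vec_continuous a : (forall i, exists da, C1 (fun t => a t i 0) da) -> continuous a.
Proof.
move=> Ca t; apply: differentiable_continuous; apply/derivable1_diffP.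
apply/derivable_mxP => i j; rewrite (ord1 j).
by have [da Cda] := Ca i; exact: C1_derivable Cda.
Qed.

Definition bdir (k : 'I_n + 'I_n) : vec * vec :=
  match k with inl i => dirq R i | inr i => dirv R i end.

Lemma phase_decomp (x y : vec) :
  (x, y) = \sum_k (match k with inl i => x i 0 | inr i => y i 0 end) *: bdir k.
Proof.
rewrite big_sumType /=.
have D (z : vec) : z = \sum_i z i 0 *: delta_mx i 0.
  by rewrite {1}[z]matrix_sum_delta; apply: eq_bigr => i _; rewrite big_ord1.
have S1 (f : 'I_n -> vec * vec) : (\sum_i f i).1 = \sum_i (f i).1.
  exact: (big_morph fst (fun _ _ => erefl) erefl).
have S2 (f : 'I_n -> vec * vec) : (\sum_i f i).2 = \sum_i (f i).2.
  exact: (big_morph snd (fun _ _ => erefl) erefl).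
apply/pair_equal_spec; split; rewrite /= ?S1 ?S2 /=.
- by rewrite {1}[x]D [X in _ + X]big1 ?addr0 // => i _; rewrite scaler0.
- by rewrite {1}[y]D [X in X + _]big1 ?add0r // => i _; rewrite scaler0.
Qed.

Lemma phase_comp_continuous F a b : continuous a -> continuous b -> continuous F ->
  continuous (fun t : R => F (a t, b t)).
Proof.
move=> ca cb cF.
have cab : continuous (fun t : R => (a t, b t)).
  by move=> t; exact: cvg_pair (ca t) (cb t).
by move=> t; exact: (cvg_comp _ _ (cab t) (cF _)).
Qed.

Lemma continuous_bigsum (I : Type) (r : seq I) (f : I -> R -> R) :
  (forall i, continuous (f i)) -> continuous (fun t => \sum_(i <- r) f i t).
Proof.
move=> cf; elim: r => [|i r IH].
  by under eq_fun do rewrite big_nil; move=> t; exact: cst_continuous.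
under eq_fun do rewrite big_cons.
by move=> t; apply: cvgD; [exact: cf|exact: IH].
Qed.

Lemma chain_rule F a b (da db : R -> vec) : smooth F ->
  (forall i, C1 (fun t => a t i 0) (fun t => da t i 0)) ->
  (forall i, C1 (fun t => b t i 0) (fun t => db t i 0)) ->
  (forall i, continuous (fun t => da t i 0)) -> 
  (forall i, continuous (fun t => db t i 0)) -> 
  C1 (fun t => F (a t, b t)) (fun t =>
    \sum_i da t i 0 * 'D_(dirq R i) F (a t, b t) +
    \sum_i db t i 0 * 'D_(dirv R i) F (a t, b t)).
Proof.
move=> sF Ca Cb ca cb.
have cab : continuous (fun t => (a t, b t)).
  have ha : continuous a by apply: vec_continuous => i; exists (fun t => da t i 0).
  have hb : continuous b by apply: vec_continuous => i; exists (fun t => db t i 0).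
  by move=> t; exact: cvg_pair (ha t) (hb t).
have cD v : continuous (fun t => 'D_v F (a t, b t)).
  have cF : continuous ('D_v F) by apply: smooth_continuous; exact: smooth_D.
  by move=> t; exact: (cvg_comp _ _ (cab t) (cF _)).
split=> t.
  pose C (k : 'I_n + 'I_n) s := match k with inl i => a s i 0 | inr i => b s i 0 end.
  pose c (k : 'I_n + 'I_n) := match k with inl i => da t i 0 | inr i => db t i 0 end.
  have := @chain_sum _ _ F _ (index_enum _) bdir C c t.
  rewrite (_ : (fun s => F (\sum_k C k s *: bdir k)) = (fun s => F (a s, b s))); last first.
    by apply/funext => s; rewrite (phase_decomp (a s) (b s)).
  rewrite -(phase_decomp (a t) (b t)) big_sumType /=; apply.
    by move=> k; split; [move=> y; exact: smooth_derivable|apply: smooth_continuous; exact: smooth_D].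
  by case=> i; [case: (Ca i)|case: (Cb i)].
by apply: cvgD; apply: continuous_bigsum => i s; apply: cvgM;
  [exact: ca|exact: cD|exact: cb|exact: cD].
Qed.

Lemma phase_box_bounded F (K : R) : continuous F ->
  exists C, forall x y : vec, (forall i, `|x i 0| <= K) -> (forall i, `|y i 0| <= K) ->
    `|F (x, y)| <= C.
Proof.
move=> cF.
pose A := [set v : 'rV[R]_n | forall i, `[- K, K]%classic (v ord0 i)].
have cA : compact A.
  rewrite /A; apply: (@rV_compact R n (fun=> `[- K, K]%classic)) => _.
  exact: segment_compact.
have ctr : continuous (fun v : 'rV[R]_n => v^T).
  move=> v; apply/(@cvgrPdist_le R _ _ (nbhs v) (nbhs_filter v)) => e e0.
  apply/nbhs_ballP; exists e => //= v'.
  rewrite -ball_normE /= => /ltW; apply: le_trans; apply: mx_norm_le => // i j.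
  rewrite !mxE; apply: le_trans (ler_mx_coord _ j i); by rewrite !mxE.
have cA' := continuous_compact (continuous_subspaceT ctr) cA.
have := continuous_compact (continuous_subspaceT cF) (compact_setX cA' cA').
move=> /compact_bounded[C [_ HC]]; exists (C + 1) => x y xK yK.
apply: (HC (C + 1)); first by rewrite ltrDl.
exists (x, y) => //; split; [exists x^T|exists y^T]; rewrite ?trmxK // => i /=;
by rewrite mxE in_itv /= -ler_norml.
Qed.

End PhaseSpace.

(** * The Hessians along an extremal *)

Section RealFunctions.
Variable R : realType.

Lemma C1_unique (F f g : R -> R) : C1 F f -> C1 F g -> f = g.
Proof. by move=> /C1_derive1 <- /C1_derive1. Qed.

Lemma C1_zero_cst (F f : R -> R) : C1 F f -> (forall t, f t = 0) -> forall s t, F s = F t.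
Proof.
move=> CF f0; suff H s t : s <= t -> F s = F t.
  by move=> s t; have [st|/ltW ts] := leP s t; [exact: H|apply/esym/H].
move=> st; have := FTC_C1 st CF; under eq_Rintegral do rewrite f0.
by rewrite Rint_itv_cst // mul0r => /esym/eqP; rewrite subr_eq0 => /eqP.
Qed.

Lemma C1_le (F f : R -> R) s t : C1 F f -> s <= t -> (forall x, s <= x <= t -> 0 <= f x) ->
  F s <= F t.
Proof.
move=> CF st f0; rewrite -subr_ge0 -(FTC_C1 st CF); apply: Rintegral_ge0 => x /=.
by rewrite in_itv /=; exact: f0.
Qed.

Lemma bounded_of_limits (f : R -> R) (l l' : R) : continuous f ->
  f t @[t --> -oo] --> l -> f t @[t --> +oo] --> l' -> exists K, forall t, `|f t| <= K.
Proof.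
move=> cf /cvgrPdist_le/(_ 1 ltr01)[A [_ HA]] /cvgrPdist_le/(_ 1 ltr01)[B [_ HB]].
(* The maximum keeps the interval nonempty when the two neighbourhoods of infinity overlap. *)
have cn : {within `[A - 1, Num.max (A - 1) (B + 1)], continuous (fun t => `|f t|)}.
  apply: continuous_subspaceT => t; apply: cvg_norm; exact: cf.
have le1 : A - 1 <= Num.max (A - 1) (B + 1) by rewrite le_max lexx.
have [c _ Hc] := EVT_max le1 cn.
exists (`|f c| + (`|l| + 1) + (`|l'| + 1)) => t.
have tri (k : R) : `|k - f t| <= 1 -> `|f t| <= `|k| + 1.
  move=> H; rewrite -[f t](subKr k); apply: le_trans (ler_normB _ _) _; lra.
have [[n1 n2] n3] := (normr_ge0 (f c), normr_ge0 l, normr_ge0 l').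
have [tA|At] := ltP t (A - 1).
  have /tri : `|l - f t| <= 1 by apply: HA; lra.
  by lra.
have [tB|Bt] := leP t (Num.max (A - 1) (B + 1)).
  have /Hc /= : t \in `[A - 1, Num.max (A - 1) (B + 1)]%R by rewrite in_itv /= At tB.
  by lra.
have /tri : `|l' - f t| <= 1 by apply: HB; move: Bt; rewrite gt_max => /andP[_]; lra.
by lra.
Qed.

Lemma cvg_coord n (T : Type) (H : set_system T) (f : T -> 'cV[R]_n) (l : 'cV[R]_n) i :
  Filter H -> f @ H --> l -> (fun t => f t i 0) @ H --> l i 0.
Proof.
move=> FH fl; exact: (@cvg_comp _ _ _ f (fun v : 'cV[R]_n => v i 0) _ _ _ fl
  (@coord_continuous _ _ _ i 0 l)).
Qed.

Lemma vec_C1 n (f : R -> 'cV[R]_n) : (forall x, derivable f x 1) -> continuous ('D_1 f) ->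
  forall i, C1 (fun t => f t i 0) (fun t => ('D_1 f t) i 0).
Proof.
move=> df cf i.
have E t : 'D_1 (fun s => f s i 0) t = ('D_1 f t) i 0.
  by rewrite (derive_mx (df t)) mxE.
split=> t.
  rewrite -E; apply: derivableP.
  by have /derivable_mxP := df t; apply.
by apply: cvg_coord; exact: cf.
Qed.

End RealFunctions.

Section MatrixCoordinates.
Variables (R : realType) (n : nat).

Lemma mulmx_coord (A : 'M[R]_n) (x : 'cV[R]_n) i : (A *m x) i 0 = \sum_j A i j * x j 0.
Proof. exact: mxE. Qed.

Lemma addmx_coord (x y : 'cV[R]_n) i : (x + y) i 0 = x i 0 + y i 0.
Proof. exact: mxE. Qed.

Lemma submx_coord (x y : 'cV[R]_n) i : (x - y) i 0 = x i 0 - y i 0.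
Proof. by rewrite !mxE. Qed.

Lemma trmx_coord (A : 'M[R]_n) i j : A^T i j = A j i.
Proof. exact: mxE. Qed.

Lemma zerovec_coord i : (0 : 'cV[R]_n) i 0 = 0.
Proof. exact: mxE. Qed.

Lemma scalevec_coord k (x : 'cV[R]_n) i : (k *: x) i 0 = k * x i 0.
Proof. exact: mxE. Qed.

Lemma hess_vvE (L : 'cV[R]_n * 'cV[R]_n -> R) z i j :
  hess_vv L z i j = 'D_(dirv R i) ('D_(dirv R j) L) z.
Proof. exact: mxE. Qed.

Lemma gradvE (L : 'cV[R]_n * 'cV[R]_n -> R) z i : gradv L z i 0 = 'D_(dirv R i) L z.
Proof. exact: mxE. Qed.

End MatrixCoordinates.

(* The velocity, the acceleration and the Hessians along the curve are kept
   abstract: unfolding their definitions in unification is very costly. *)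
Section Extremal.
Variables (R : realType) (n : nat).
Local Notation vec := 'cV[R]_n.
Variables (L : vec * vec -> R) (u vel acc force : R -> vec) (P Q S : R -> 'M[R]_n).
Hypothesis L_smooth : smooth L.
Hypothesis C1_pos : forall i, C1 (fun t => u t i 0) (fun t => vel t i 0).
Hypothesis C1_vel : forall i, C1 (fun t => vel t i 0) (fun t => acc t i 0).
Hypothesis acc_continuous : forall i, continuous (fun t => acc t i 0).
Hypothesis forceDE : forall t i, force t i 0 = 'D_(dirq R i) L (u t, vel t).
Hypothesis PDE : forall t i j, P t i j = 'D_(dirv R i) ('D_(dirv R j) L) (u t, vel t).
Hypothesis QDE : forall t i j, Q t i j = 'D_(dirv R i) ('D_(dirq R j) L) (u t, vel t).
Hypothesis SDE : forall t i j, S t i j = 'D_(dirq R i) ('D_(dirq R j) L) (u t, vel t).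
Hypothesis C1_momentum : forall i,
  C1 (fun t => 'D_(dirv R i) L (u t, vel t)) (fun t => force t i 0).

Lemma vel_continuous i : continuous (fun t => vel t i 0).
Proof. exact: C1_continuous (C1_vel i). Qed.

Lemma C1_along F : smooth F -> C1 (fun t => F (u t, vel t)) (fun t =>
    \sum_i vel t i 0 * 'D_(dirq R i) F (u t, vel t) +
    \sum_i acc t i 0 * 'D_(dirv R i) F (u t, vel t)).
Proof.
by move=> sF; exact: (chain_rule sF C1_pos C1_vel vel_continuous acc_continuous).
Qed.

Lemma hessP_sym t : (P t)^T = P t.
Proof. by apply/matrixP => i j; rewrite trmx_coord !PDE; exact: schwarz. Qed.

Lemma hessS_sym t : (S t)^T = S t.
Proof. by apply/matrixP => i j; rewrite trmx_coord !SDE; exact: schwarz. Qed.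

(** Two derivatives of the momentum are compared: the one given by the Euler-Lagrange equation and
    the one given by the chain rule. *)
Lemma forceE t : force t = P t *m acc t + Q t *m vel t.
Proof.
apply/colP => i; rewrite addmx_coord !mulmx_coord.
have sF : smooth ('D_(dirv R i) L) by exact: smooth_D.
have /(congr1 (fun f => f t)) -> := C1_unique (C1_momentum i) (C1_along sF).
rewrite addrC.
congr (_ + _).
  apply: eq_bigr => j _.
  rewrite PDE.
  rewrite (schwarz (dirv R i) (dirv R j) (u t, vel t) L_smooth).
  exact: mulrC.
apply: eq_bigr => j _.
rewrite QDE.
rewrite (schwarz (dirv R i) (dirq R j) (u t, vel t) L_smooth).
exact: mulrC.
Qed.

(** Together with [forceE] this is the linearized equation (P v' + Q v)' = Q^T v' + S v. The left
    side exists although v' is only continuous, because [force] is a first derivative of [L] along a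
    C^2 curve. *)
Lemma C1_force i : C1 (fun t => force t i 0)
  (fun t => ((Q t)^T *m acc t + S t *m vel t) i 0).
Proof.
have sF : smooth ('D_(dirq R i) L) by exact: smooth_D.
apply: C1_eq (C1_along sF) _ _ => t; first by rewrite forceDE.
rewrite addmx_coord !mulmx_coord addrC; congr (_ + _); apply: eq_bigr => j _.
  by rewrite trmx_coord QDE; exact: mulrC.
by rewrite SDE (schwarz (dirq R i) (dirq R j) (u t, vel t) L_smooth); exact: mulrC.
Qed.

Definition momentum : R -> vec := fun t => \col_i 'D_(dirv R i) L (u t, vel t).

(** By the product and chain rules the derivative is force . v + p . v' minus the derivative of L
    along the curve, and these cancel by the Euler-Lagrange equation. *)
Lemma energy_const s t :
  dot (momentum s) (vel s) - L (u s, vel s) =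
  dot (momentum t) (vel t) - L (u t, vel t).
Proof.
have momE t' i : momentum t' i 0 = 'D_(dirv R i) L (u t', vel t') by exact: mxE.
have C1dot : C1 (fun t => dot (momentum t) (vel t))
   (fun t => dot (force t) (vel t) + dot (momentum t) (acc t)).
  have H i : C1 (fun t => momentum t i 0) (fun t => force t i 0).
    by apply: C1_eq (C1_momentum i) _ (fun _ => erefl) => t'; rewrite momE.
  apply: C1_eq (@C1_sum R _ (index_enum 'I_n) _ _ (fun i => C1M (H i) (C1_vel i))) _ _ => // x.
  by rewrite -big_split.
have C1L := C1D C1dot (C1Z (-1) (C1_along L_smooth)).
have := @C1_zero_cst R _ _ C1L _ s t; rewrite !mulN1r; apply=> x.
rewrite mulN1r /dot.
have -> : \sum_i force x i 0 * vel x i 0 =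
   \sum_i vel x i 0 * 'D_(dirq R i) L (u x, vel x).
  by apply: eq_bigr => i _; rewrite forceDE mulrC.
have -> : \sum_i momentum x i 0 * acc x i 0 =
   \sum_i acc x i 0 * 'D_(dirv R i) L (u x, vel x).
  by apply: eq_bigr => i _; rewrite momE mulrC.
by rewrite subrr.
Qed.

Variable l0 : R.
Hypotheses (l0_gt0 : 0 < l0) (L_convex : forall (q v x : vec),
     l0 * dot x x <= dot (hess_vv L (q, v) *m x) x).

(** Along s |-> L(q, s v) the second derivative is at least l0 |v|^2; this is the second order
    expansion from s = 1 evaluated at s = 0. *)
Lemma convex_lower (q v : vec) :
  L (q, v) - dot (gradv L (q, v)) v + l0 / 2 * dot v v <= L (q, 0).
Proof.
pose a (s : R) : vec := q; pose b (s : R) : vec := s *: v.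
have Ca i : C1 (fun t => a t i 0) (fun t => (0 : vec) i 0).
  by apply: C1_eq (@C1_cst R (q i 0)) _ _ => t //; rewrite zerovec_coord.
have Cb i : C1 (fun t => b t i 0) (fun t => v i 0).
  by apply: C1_eq (C1Z (v i 0) (@C1_id R)) _ _ => t; rewrite ?scalevec_coord /= ?mulr1 // mulrC.
have along F : smooth F -> C1 (fun s => F (q, s *: v))
    (fun s => \sum_i v i 0 * 'D_(dirv R i) F (q, s *: v)).
  move=> sF; have := @chain_rule R n F a b (fun=> 0) (fun=> v) sF Ca Cb.
  move=> /(_ _ _)/C1_eq; apply.
  - by move=> i t; exact: cst_continuous.
  - by move=> i t; exact: cst_continuous.
  - by [].
  - move=> t; rewrite [X in X + _]big1 ?add0r // => i _; by rewrite zerovec_coord mul0r.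
pose h s := L (q, s *: v).
pose h' s := \sum_i v i 0 * 'D_(dirv R i) L (q, s *: v).
have Ch : C1 h h' by exact: along.
have Ch' : C1 h' (fun s => dot (hess_vv L (q, s *: v) *m v) v).
  apply: C1_eq (@C1_sum R _ (index_enum 'I_n) _ _ (fun i => C1Z (v i 0) (along _ (smooth_D (dirv R i) L_smooth)))) _ _ => // s.
  apply: eq_bigr => i _; rewrite mulmx_coord [RHS]mulrC; congr (_ * _).
  apply: eq_bigr => j _; rewrite hess_vvE.
  rewrite (schwarz (dirv R i) (dirv R j) (q, s *: v) L_smooth); exact: mulrC.
have mono s : 0 <= s <= 1 -> h' s <= h' 1 - l0 * dot v v * (1 - s).
  move=> /andP[s0 s1].
  have Cm := C1D Ch' (C1Z (- (l0 * dot v v)) (@C1_id R)).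
  have := C1_le Cm s1; rewrite /= => H.
  suff : h' s + - (l0 * dot v v) * s <= h' 1 + - (l0 * dot v v) * 1 by lra.
  by apply: H => x _; rewrite mulr1 subr_ge0; exact: L_convex.
(* A primitive of the gap in [mono]; it is nondecreasing on [0, 1], and comparing its two end values
   gives the claim. *)
have Ck : C1 (fun s => (h' 1 - l0 * dot v v) * s + (l0 * dot v v / 2) * s ^+ 2 + (-1) * h s)
    (fun s => h' 1 - l0 * dot v v * (1 - s) - h' s).
  have C2 : C1 (fun s : R => s ^+ 2) (fun s => 2 * s).
    by apply: C1_eq (C1M (@C1_id R) (@C1_id R)) _ _ => s /=; rewrite ?expr2 //; ring.
  apply: C1_eq (C1D (C1D (C1Z (h' 1 - l0 * dot v v) (@C1_id R)) (C1Z (l0 * dot v v / 2) C2)) (C1Z (-1) Ch)) _ _ => s //=.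
  by field.
have := C1_le Ck ler01; rewrite /= expr0n /= !mulr0 !add0r expr1n !mulr1 => H.
have {H} := H _; rewrite /h scale0r scale1r.
have -> : dot (gradv L (q, v)) v = h' 1.
  by rewrite /h' scale1r; apply: eq_bigr => i _; rewrite gradvE; exact: mulrC.
move: (h' 1) mono => k mono; clear Ck Ch' Ch along Ca Cb.
move: (L _) (L _) (dot v v) mono => L1 L2 d mono H.
have {H} := H _; move=> H.
have {}H : -1 * L2 <= k - l0 * d + l0 * d / 2 + -1 * L1.
  apply: H => x /mono H0; have {H0} : 0 <= k - l0 * d * (1 - x) - h' x by rewrite subr_ge0.
  by [].
by lra.
Qed.

Variables um up : vec.
Hypotheses (u_cvgm : u t @[t --> -oo] --> um) (u_cvgp : u t @[t --> +oo] --> up).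

Lemma pos_bounded : exists K, forall t i, `|u t i 0| <= K.
Proof.
have H i : exists K, forall t, `|u t i 0| <= K.
  apply: (@bounded_of_limits _ _ (um i 0) (up i 0)).
  - exact: C1_continuous (C1_pos i).
  - by apply: cvg_coord; exact: u_cvgm.
  - by apply: cvg_coord; exact: u_cvgp.
have [K KP] := choice H.
have K0 i : 0 <= K i by apply: le_trans (KP i 0).
exists (\sum_i K i) => t i; apply: le_trans (KP i t) _.
by rewrite (bigD1 i) //= lerDl sumr_ge0.
Qed.

Lemma gradv_momentum t : gradv L (u t, vel t) = momentum t.
Proof. by []. Qed.

(** With E the conserved energy, [convex_lower] reads (l0 / 2) |v|^2 <= E + L(u, 0), and L(u, 0) is
    bounded because the curve stays in a compact box. *)
Lemma vel_bounded : exists K, forall t i, `|vel t i 0| <= K.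
Proof.
have [K KP] := pos_bounded.
have [C CP] := @phase_box_bounded R n L (Num.max K 0) (smooth_continuous L_smooth).
set E := dot (momentum 0) (vel 0) - L (u 0, vel 0).
pose B := (C + `|E|) / (l0 / 2).
have K0 : 0 <= Num.max K 0 by rewrite le_max lexx orbT.
have L0 t : L (u t, 0) <= C.
  apply: le_trans (ler_norm _) _; apply: CP => i; last by rewrite mxE normr0.
  by rewrite le_max KP.
exists (Num.sqrt B) => t i.
have vB : dot (vel t) (vel t) <= B.
  rewrite ler_pdivlMr ?divr_gt0 // mulrC.
  have := convex_lower (u t) (vel t); have := energy_const t 0; rewrite -/E.
  rewrite gradv_momentum; have := L0 t; have := ler_norm E.
  move: (dot _ _) (dot _ _) (L _) (L _) => q1 q2 q3 q4.
  by clearbody E => h1 h2 h3 h4; lra.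
by rewrite -sqrtr_sqr ler_wsqrtr //; apply: le_trans (coord_le_dot _ i) vB.
Qed.

Lemma phase_bounded (F : vec * vec -> R) : continuous F -> exists C, forall t : R, `|F (u t, vel t)| <= C.
Proof.
move=> cF; have [K1 H1] := pos_bounded; have [K2 H2] := vel_bounded.
have [C HC] := @phase_box_bounded R n F (Num.max K1 K2) cF.
by exists C => t; apply: HC => i; rewrite le_max ?H1 ?H2 ?orbT.
Qed.

(** The acceleration solves P v' = force - Q v, whose right side is bounded, and [l0] bounds [P]
    from below. *)
Lemma acc_bounded : exists K, forall t i, `|acc t i 0| <= K.
Proof.
have [Kv HKv] := vel_bounded.
have bQ i j : exists C, forall t, `|Q t i j| <= C.
  have [C HC] := @phase_bounded ('D_(dirv R i) ('D_(dirq R j) L))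
     (smooth_continuous (smooth_D _ (smooth_D _ L_smooth))).
  by exists C => t; rewrite QDE; exact: HC.
have bF i : exists C, forall t, `|force t i 0| <= C.
  have [C HC] := @phase_bounded ('D_(dirq R i) L) (smooth_continuous (smooth_D _ L_smooth)).
  by exists C => t; rewrite forceDE; exact: HC.
have by_ i : exists C, forall t, `|(force t - Q t *m vel t) i 0| <= C.
  have [Cf HCf] := bF i; have [CQ HCQ] := choice (bQ i).
  exists (Cf + \sum_j CQ j * Kv) => t; rewrite submx_coord mulmx_coord.
  apply: le_trans (ler_normB _ _) _; apply: lerD => //.
  apply: le_trans (ler_norm_sum _ _ _) _; apply: ler_sum => j _.
  by rewrite normrM; apply: ler_pM.
have [Cy HCy] := choice by_.
pose B := (\sum_i Cy i ^+ 2) / l0 ^+ 2.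
exists (Num.sqrt B) => t i.
rewrite -sqrtr_sqr ler_wsqrtr //; apply: le_trans (coord_le_dot _ i) _.
set y := force t - Q t *m vel t.
have Py : P t *m acc t = y by rewrite /y forceE addrK.
have yB : dot y y <= \sum_i Cy i ^+ 2.
  apply: ler_sum => j _; rewrite -expr2 -real_normK ?num_real //.
  by rewrite lerXn2r ?nnegrE ?(le_trans _ (HCy j t)).
have hP : hess_vv L (u t, vel t) = P t by apply/matrixP => k j; rewrite PDE; exact: mxE.
have := L_convex (u t) (vel t) (acc t); rewrite hP Py => H1; clearbody y.
have := dotxx_ge0 (l0 *: acc t - y).
rewrite dotBl !dotBr !dotZl !dotZr => H2.
rewrite /B ler_pdivlMr ?exprn_gt0 // expr2.
have := ler_wpM2l (ltW l0_gt0) H1; move: H2 yB; rewrite [dot y (acc t)]dotC.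
by move: (dot _ _) (dot _ _) (dot _ _) (\sum_i _) => d1 d2 d3 d4; lra.
Qed.

(** The derivative along the curve is linear in velocity and acceleration with coefficients bounded
    on a compact box, so both previous bounds enter. *)
Lemma C1b_along F : smooth F -> exists2 f, C1 (fun t => F (u t, vel t)) f &
  exists C, forall t, `|F (u t, vel t)| <= C /\ `|f t| <= C.
Proof.
move=> sF; eexists; first exact: C1_along.
have [C HC] := phase_bounded (smooth_continuous sF).
have [Kv HKv] := vel_bounded; have [Ka HKa] := acc_bounded.
have [Cq HCq] := choice (fun i => phase_bounded (smooth_continuous (smooth_D (dirq R i) sF))).
have [Cv HCv] := choice (fun i => phase_bounded (smooth_continuous (smooth_D (dirv R i) sF))).
have sq0 : 0 <= \sum_i Kv * Cq i.
  apply: sumr_ge0 => i _; apply: mulr_ge0; [exact: le_trans (HKv 0 i)|exact: le_trans (HCq i 0)].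
have sv0 : 0 <= \sum_i Ka * Cv i.
  apply: sumr_ge0 => i _; apply: mulr_ge0; [exact: le_trans (HKa 0 i)|exact: le_trans (HCv i 0)].
have C0 : 0 <= C by apply: le_trans (HC 0).
exists (C + (\sum_i Kv * Cq i + \sum_i Ka * Cv i)) => t; split.
  by apply: le_trans (HC t) _; rewrite lerDl addr_ge0.
apply: le_trans (ler_normD _ _) _; apply: ler_wpDl C0 _.
apply: lerD; apply: le_trans (ler_norm_sum _ _ _) _; apply: ler_sum => i _;
by rewrite normrM; apply: ler_pM.
Qed.

Lemma C1bmx_along (F : 'I_n -> 'I_n -> vec * vec -> R) (M : R -> 'M[R]_n) :
  (forall i j, smooth (F i j)) -> (forall t i j, M t i j = F i j (u t, vel t)) ->
  exists dM, C1bmx M dM.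
Proof.
move=> sF ME.
have H (ij : 'I_n * 'I_n) : exists f, C1 (fun t => F ij.1 ij.2 (u t, vel t)) f /\
    exists C, forall t, `|F ij.1 ij.2 (u t, vel t)| <= C /\ `|f t| <= C.
  by have [f] := C1b_along (sF ij.1 ij.2); exists f.
have [f fP] := choice H.
exists (fun t => \matrix_(i, j) f (i, j) t) => i j; have [h1 [C h2]] := fP (i, j).
split; first by apply: C1_eq h1 _ _ => t; [rewrite ME|rewrite mxE].
by exists C => t; rewrite ME; split; [case: (h2 t)|rewrite mxE; case: (h2 t)].
Qed.

Lemma hessP_C1b : exists dP, C1bmx P dP.
Proof.
apply: (@C1bmx_along (fun i j => 'D_(dirv R i) ('D_(dirv R j) L)) P _ PDE) => i j.
exact: (smooth_D _ (smooth_D _ L_smooth)).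
Qed.

Lemma hessQ_C1b : exists dQ, C1bmx Q dQ.
Proof.
apply: (@C1bmx_along (fun i j => 'D_(dirv R i) ('D_(dirq R j) L)) Q _ QDE) => i j.
exact: (smooth_D _ (smooth_D _ L_smooth)).
Qed.

Lemma hessS_C1b : exists dS, C1bmx S dS.
Proof.
apply: (@C1bmx_along (fun i j => 'D_(dirq R i) ('D_(dirq R j) L)) S _ SDE) => i j.
exact: (smooth_D _ (smooth_D _ L_smooth)).
Qed.

End Extremal.

(** * Coercivity *)

Section InverseMatrix.
Variables (R : realType) (n : nat).
Implicit Types (A : 'M[R]_n) (c : R).

Lemma coercive_unitmx A c : 0 < c -> (forall v, c * dot v v <= dot (A *m v) v) -> A \in unitmx.
Proof.
move=> c0 Ac; rewrite -row_free_unit -kermx_eq0; apply/eqP/row_matrixP => i.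
rewrite row0; apply/trmx_inj; rewrite trmx0; apply/eqP; rewrite -dotxx_eq0.
set v := (row i (kermx A))^T.
have vA : A^T *m v = 0 by rewrite /v -trmx_mul -row_mul mulmx_ker row0 trmx0.
have := Ac v; rewrite dot_mxl vA dot0r pmulr_rle0 // => v0.
by rewrite eq_le v0 dotxx_ge0.
Qed.

(** The column x of the inverse solves A x = e_j, so c |x|^2 <= x_j <= |x| and hence |x| <= 1 /
    c. *)
Lemma coercive_invmx_bound A c i j : 0 < c -> (forall v, c * dot v v <= dot (A *m v) v) ->
  `|invmx A i j| <= c^-1.
Proof.
move=> c0 Ac; have uA := coercive_unitmx c0 Ac.
set x := col j (invmx A).
have Ax : A *m x = delta_mx j 0 by rewrite /x colE mulmxA mulmxV // mul1mx.
have := Ac x; rewrite Ax.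
have -> : dot (delta_mx j 0) x = x j 0.
  rewrite /dot (bigD1 j) //= big1 ?addr0 => [|k kj]; rewrite mxE ?eqxx ?mul1r //.
  by rewrite (negPf kj) mul0r.
have xi : x i 0 = invmx A i j by rewrite mxE.
rewrite -xi => H.
have Hj := coord_le_dot x j; have Hi := coord_le_dot x i.
set d := dot x x in H Hj Hi; set a := x j 0 in H Hj; set b := x i 0 in Hi *.
have d0 : 0 <= d := dotxx_ge0 x.
have a0 : 0 <= a by apply: le_trans H; apply: mulr_ge0 => //; exact: ltW.
have dc : d * c ^+ 2 <= 1.
  have [->|dn0] := eqVneq d 0; first by rewrite mul0r.
  have dp : 0 < d by rewrite lt_def dn0.
  rewrite -(ler_pM2l dp) mulr1; apply: le_trans Hj.
  have -> : d * (d * c ^+ 2) = (c * d) ^+ 2 by rewrite exprMn; ring.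
  by rewrite lerXn2r ?nnegrE // mulr_ge0 // ltW.
rewrite -(@ler_pXn2r _ 2) ?nnegrE ?invr_ge0 ?(ltW c0) // real_normK ?num_real //.
apply: le_trans Hi _; rewrite exprVn -[_^-1]mul1r ler_pdivlMr //; exact: exprn_gt0.
Qed.

Lemma cvg_bigsum (T : Type) (F : set_system T) (I : Type) (r : seq I) (f : I -> T -> R) (l : I -> R) :
  Filter F -> (forall i, f i @ F --> l i) ->
  (fun t => \sum_(i <- r) f i t) @ F --> \sum_(i <- r) l i.
Proof.
move=> FF fl; elim: r => [|i r IH].
  by under eq_fun do rewrite big_nil; rewrite big_nil; exact: cvg_cst.
under eq_fun do rewrite big_cons; rewrite big_cons; exact: cvgD.
Qed.

(** Everything follows from M(s) - M(t) = - M(s) (P(s) - P(t)) M(t): the uniform bound on M gives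
    continuity, and dividing by s - t then gives the derivative. *)
Lemma C1bmx_inv (P dP : R -> 'M[R]_n) c : C1bmx P dP -> 0 < c ->
  (forall t v, c * dot v v <= dot (P t *m v) v) ->
  C1bmx (fun t => invmx (P t)) (fun t => - (invmx (P t) *m dP t *m invmx (P t))).
Proof.
move=> CP c0 Pc; pose M t := invmx (P t).
have uP t := coercive_unitmx c0 (Pc t).
have bM t i j : `|M t i j| <= c^-1 := coercive_invmx_bound i j c0 (Pc t).
have diff s t : M s - M t = - (M s *m (P s - P t) *m M t).
  rewrite mulmxBr mulmxBl /M mulVmx // mul1mx -mulmxA mulmxV // mulmx1; by rewrite opprB.
have diffij s t i j : M s i j - M t i j =
    - \sum_l (\sum_k M s i k * (P s k l - P t k l)) * M t l j.
  have := congr1 (fun A => A i j) (diff s t); rewrite /= ![in X in X -> _]mxE => ->.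
  congr (- _); apply: eq_bigr => l _; rewrite mxE; congr (_ * _).
  by apply: eq_bigr => k _; rewrite !mxE.
have cP i j : continuous (fun t => P t i j) by apply: C1_continuous; exact: (CP i j).1.
have cM i j : continuous (fun t => M t i j).
  move=> t; apply: (@cvg_zero _ R^o).
  apply: (cvg_eq_fun (fun s => esym (diffij s t i j))).
  have Z : - \sum_(l : 'I_n) (\sum_(k : 'I_n) (0 : R)) * M t l j = 0.
    by rewrite big1 ?oppr0 // => l _; rewrite big1 ?mul0r.
  rewrite -[X in _ --> X]Z; apply: cvgN; apply: cvg_bigsum => l.
  apply: cvgM; last exact: cvg_cst.
  apply: cvg_bigsum => k.
  apply/cvgr0Pnorm_le => e e0.
  have /cvgrPdist_le/(_ (e * c)) := cP k l t; have ec : 0 < e * c by exact: mulr_gt0.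
  move=> /(_ ec); apply: filterS => s Hs.
  rewrite normrM distrC mulrC -[e](mulfK (lt0r_neq0 c0)); apply: ler_pM => //; exact: bM.
have DM t i j : (- (M t *m dP t *m M t)) i j = - \sum_l (\sum_k M t i k * dP t k l) * M t l j.
  rewrite !mxE; congr (- _); apply: eq_bigr => l _; by rewrite mxE.
have bound t i j C : (forall k l, `|dP t k l| <= C) -> `|(- (M t *m dP t *m M t)) i j| <=
   \sum_(l : 'I_n) (\sum_(k : 'I_n) c^-1 * C) * c^-1.
  move=> HC; rewrite DM normrN; apply: le_trans (ler_norm_sum _ _ _) _.
  apply: ler_sum => l _; rewrite normrM; apply: ler_pM => //.
  apply: le_trans (ler_norm_sum _ _ _) _; apply: ler_sum => k _.
  by rewrite normrM; apply: ler_pM.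
have [C HC] : exists C, forall t k l, `|dP t k l| <= C.
  have H (ij : 'I_n * 'I_n) : exists C, forall t, `|dP t ij.1 ij.2| <= C.
    by have [_ [C HC]] := CP ij.1 ij.2; exists C => t; case: (HC t).
  have [C HC] := choice H; exists (\sum_ij `|C ij|) => t k l.
  apply: le_trans (HC (k, l) t) _; apply: le_trans (ler_norm _) _.
  by rewrite (bigD1 (k, l)) //= lerDl sumr_ge0.
move=> i j; split; last first.
  exists (Num.max c^-1 (\sum_(l : 'I_n) (\sum_(k : 'I_n) c^-1 * C) * c^-1)) => t.
  by rewrite !le_max bM /= bound ?orbT.
split=> t; last first.
  apply: (@cvg_eq_fun _ _ (nbhs t) _ _ _ (fun s => esym (DM s i j))).
  rewrite DM; apply: cvgN; apply: cvg_bigsum => l; apply: cvgM; last exact: cM.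
  apply: cvg_bigsum => k; apply: cvgM; first exact: cM.
  by have [[_ cd] _] := CP k l; exact: cd.
apply/is_deriveP; rewrite DM.
have E h : - \sum_l (\sum_k M (h + t) i k * (h^-1 * (P (h + t) k l - P t k l))) * M t l j =
   h^-1 *: (M (h *: 1 + t) i j - M t i j).
  rewrite /GRing.scale /= mulr1 diffij mulrN mulr_sumr; congr (- _).
  apply: eq_bigr => l _; rewrite mulrA; congr (_ * _); rewrite mulr_sumr.
  by apply: eq_bigr => k _; ring.
apply: (cvg_eq_fun E); apply: cvgN; apply: cvg_bigsum => l; apply: cvgM; last exact: cvg_cst.
apply: cvg_bigsum => k; apply: cvgM.
  have ht : (h + t) @[h --> (0:R)^'] --> t.
    rewrite -[X in _ --> X]add0r; apply: cvgD; last exact: cvg_cst.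
    exact: cvg_within.
  exact: (cvg_comp _ _ ht (cM i k t)).
have [[/(_ t) /is_deriveP H _] _] := CP k l.
by apply: cvg_eq_fun H => h; rewrite /GRing.scale /= mulr1.
Qed.

End InverseMatrix.

Section Coercivity.
Variables (R : realType).

(** Compactness of the unit sphere instead of a least eigenvalue, since [posdef] does not include
    symmetry. Unit vectors violating the constants 1/(k+1) would cluster at a unit vector where the
    form is nonpositive. *)
Lemma posdef_lower n (M : 'M[R]_n) : posdef M ->
  exists2 c, 0 < c & forall x, c * dot x x <= dot (M *m x) x.
Proof.
move=> pM; apply: contrapT => nc.
have H (k : nat) : exists x : 'cV[R]_n, dot x x = 1 /\ dot (M *m x) x <= k.+1%:R^-1.
  have : ~ forall x, k.+1%:R^-1 * dot x x <= dot (M *m x) x.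
    by move=> h; apply: nc; exists k.+1%:R^-1; rewrite ?invr_gt0.
  move=> /existsNP[x /negP]; rewrite -ltNge => hx.
  have x0 : 0 < dot x x.
    rewrite lt_def dotxx_ge0 andbT dotxx_eq0; apply: contraPneq hx => ->.
    by rewrite mulmx0 dot0l mulr0 ltxx.
  exists ((Num.sqrt (dot x x))^-1 *: x); rewrite -scalemxAr !dotZl !dotZr.
  have s0 : Num.sqrt (dot x x) != 0 by rewrite gt_eqF // sqrtr_gt0.
  have E a : (Num.sqrt (dot x x))^-1 * ((Num.sqrt (dot x x))^-1 * a) = a / dot x x.
    by rewrite mulrA -invfM -expr2 sqr_sqrtr ?(ltW x0) // mulrC.
  rewrite !E divff ?gt_eqF //; split=> //.
  by rewrite ler_pdivrMr //; exact: ltW.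
have [x xP] := choice H.
have xb k i : `|x k i 0| <= 1.
  have := coord_le_dot (x k) i; rewrite (xP k).1 => h; rewrite -(@ler_pXn2r _ 2) ?nnegrE //.
  by rewrite expr1n real_normK ?num_real.
have [p Hp] := bounded_vec_cluster xb.
have Hp' k : exists m, (k <= m)%N /\ forall i, `|x m i 0 - p i| <= k.+1%:R^-1.
  by have [m km Hm] := Hp k.+1%:R^-1 k ltac:(by rewrite invr_gt0); exists m.
have [f fP] := choice Hp'.
have inv0 : (fun k : nat => k.+1%:R^-1 : R) @ \oo --> 0 by exact: cvg_harmonic.
have cx i : (fun k => x (f k) i 0) @ \oo --> p i.
  apply/cvgrPdist_le => e e0.
  have /cvgr0Pnorm_le/(_ e e0) := inv0.
  apply: filterS => k Hk; rewrite distrC; apply: le_trans ((fP k).2 i) _.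
  by apply: le_trans Hk; exact: ler_norm.
pose y : 'cV[R]_n := \col_i p i.
have yp i : y i 0 = p i by rewrite mxE.
have c1 : (fun k => dot (x (f k)) (x (f k))) @ \oo --> dot y y.
  by apply: cvg_bigsum => i; rewrite yp; apply: cvgM.
have c2 : (fun k => dot (M *m x (f k)) (x (f k))) @ \oo --> dot (M *m y) y.
  apply: cvg_bigsum => i; rewrite yp mulmx_coord; apply: cvgM => //.
  apply: (cvg_eq_fun (fun k => esym (mulmx_coord M (x (f k)) i))).
  by apply: cvg_bigsum => j; rewrite yp; apply: cvgM => //; exact: cvg_cst.
have y1 : dot y y = 1.
  apply: (cvg_unique (@norm_hausdorff _ _) c1).
  by apply: (cvg_eq_fun (fun k => esym (xP (f k)).1)); exact: cvg_cst.
have y0 : dot (M *m y) y <= 0.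
  apply: (ler_cvg_to c2 inv0); near=> k.
  apply: le_trans (xP (f k)).2 _; rewrite lef_pV2 ?posrE // ler_nat ltnS.
  exact: (fP k).1.
have /pM : y != 0 by rewrite -dotxx_eq0 y1 oner_eq0.
by rewrite ltNge y0.
Unshelve. all: by end_near. Qed.

(** Each of the n^2 error terms is at most d (x_i^2 + x_j^2) / 2, and these sum to d n |x|^2. *)
Lemma dot_perturb n (A M : 'M[R]_n) (d : R) x : (forall i j, `|A i j - M i j| <= d) ->
  dot (M *m x) x - d * n%:R * dot x x <= dot (A *m x) x.
Proof.
move=> H; rewrite -subr_ge0; have -> : dot (A *m x) x - (dot (M *m x) x - d * n%:R * dot x x) =
   d * n%:R * dot x x + dot ((A - M) *m x) x by rewrite mulmxBl dotBl; ring.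
have E : dot ((A - M) *m x) x = \sum_i \sum_j (A i j - M i j) * x j 0 * x i 0.
  apply: eq_bigr => i _; rewrite mulmx_coord mulr_suml; apply: eq_bigr => j _; by rewrite !mxE.
have E2 : d * n%:R * dot x x = \sum_(i < n) \sum_(j < n) d * ((x i 0 ^+ 2 + x j 0 ^+ 2) / 2).
  transitivity (\sum_(i < n) (d * n%:R / 2 * x i 0 ^+ 2 + d / 2 * dot x x)).
    rewrite big_split /= -mulr_sumr sumr_const card_ord.
    have -> : \sum_(i < n) x i 0 ^+ 2 = dot x x by apply: eq_bigr => i _; exact: expr2.
    by rewrite -[_ *+ n]mulr_natr; field.
  apply: eq_bigr => i _; rewrite -mulr_sumr -mulr_suml big_split /= sumr_const card_ord.
  have -> : \sum_(j < n) x j 0 ^+ 2 = dot x x by apply: eq_bigr => j _; exact: expr2.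
  by rewrite -[_ *+ n]mulr_natr; field.
rewrite E E2 -big_split /=; apply: sumr_ge0 => i _; rewrite -big_split /=; apply: sumr_ge0 => j _.
have d0 := le_trans (normr_ge0 _) (H i j).
have h1 : `|(A i j - M i j) * x j 0 * x i 0| <= d * (`|x j 0| * `|x i 0|).
  by rewrite !normrM -mulrA; apply: ler_wpM2r => //; rewrite mulr_ge0.
have h2 : d * (`|x j 0| * `|x i 0|) <= d * ((x i 0 ^+ 2 + x j 0 ^+ 2) / 2).
  apply: ler_wpM2l => //; rewrite -(real_normK (num_real (x i 0))) -(real_normK (num_real (x j 0))).
  have := sqr_ge0 (`|x i 0| - `|x j 0|); rewrite sqrrB mulr2n; lra.
have := lerNnormlW (le_trans h1 h2); lra.
Qed.

(** The density of the index form at a function with value [x] and derivative [y]. *)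
Definition blockf n (P Q S : 'M[R]_n) (x y : 'cV[R]_n) : R :=
  dot (P *m y + Q *m x) y + dot (Q^T *m y + S *m x) x.

Lemma blockfE n (P Q S : 'M[R]_n) x y : blockf P Q S x y =
  dot (block_mx P Q Q^T S *m col_mx y x) (col_mx y x).
Proof.
rewrite mul_block_col /dot big_split_ord /=; congr (_ + _); apply: eq_bigr => i _;
by rewrite ?col_mxEu ?col_mxEd.
Qed.

Lemma dot_col_mx n (x y : 'cV[R]_n) : dot (col_mx y x) (col_mx y x) = dot y y + dot x x.
Proof.
by rewrite /dot big_split_ord /=; congr (_ + _); apply: eq_bigr => i _;
   rewrite ?col_mxEu ?col_mxEd.
Qed.

Lemma near_mx_coord (F : set_system R) m n (A : R -> 'M[R]_(m, n)) (A0 : 'M[R]_(m, n)) (d : R) :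
  Filter F -> A @ F --> A0 -> 0 < d -> \forall t \near F, forall i j, `|A t i j - A0 i j| <= d.
Proof.
move=> FF /cvgrPdist_le H d0; have := H d d0; apply: filterS => t Ht i j.
by rewrite distrC; apply: le_trans Ht; have := ler_mx_coord (A0 - A t) i j; rewrite !mxE.
Qed.

Lemma blockf_near_lower (F : set_system R) n (P Q S : R -> 'M[R]_n) (P0 Q0 S0 : 'M[R]_n) :
  Filter F -> P @ F --> P0 -> Q @ F --> Q0 -> S @ F --> S0 ->
  posdef (block_mx P0 Q0 Q0^T S0) ->
  exists2 c, 0 < c & \forall t \near F, forall x y,
    c * (dot x x + dot y y) <= blockf (P t) (Q t) (S t) x y.
Proof.
move=> FF PP QQ SS /posdef_lower[c c0 Hc].
(* The perturbation costs d N <= c / 2, so half of the constant of the limit matrix survives; the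
   summand 1 covers n = 0. *)
set N : R := (n + n)%:R; pose d := c / (2 * (N + 1)).
have N0 : 0 <= N by exact: ler0n.
have d0 : 0 < d by rewrite divr_gt0 // mulr_gt0 //; lra.
have dN : d * N <= c / 2.
  rewrite /d invfM mulrA -mulrA; apply: ler_piMr; first by rewrite divr_ge0 // ltW.
  by rewrite mulrC ler_pdivrMr; lra.
have hP := near_mx_coord FF PP d0; have hQ := near_mx_coord FF QQ d0.
have hS := near_mx_coord FF SS d0.
exists (c / 2); first by rewrite divr_gt0.
near=> t.
have nP : forall i j, `|P t i j - P0 i j| <= d by near: t.
have nQ : forall i j, `|Q t i j - Q0 i j| <= d by near: t.
have nS : forall i j, `|S t i j - S0 i j| <= d by near: t.
move=> x y; rewrite blockfE.
have := Hc (col_mx y x); rewrite dot_col_mx.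
have := @dot_perturb _ (block_mx (P t) (Q t) (Q t)^T (S t)) (block_mx P0 Q0 Q0^T S0) d (col_mx y x).
rewrite dot_col_mx => H1 H2.
have {}H1 := H1 _.
have H3 : (d * N) * (dot y y + dot x x) <= c / 2 * (dot y y + dot x x).
  by apply: ler_wpM2r => //; apply: addr_ge0; exact: dotxx_ge0.
have {}H1 : dot (block_mx P0 Q0 Q0^T S0 *m col_mx y x) (col_mx y x) -
     d * N * (dot y y + dot x x) <= dot (block_mx (P t) (Q t) (Q t)^T (S t) *m col_mx y x) (col_mx y x).
  apply: H1 => i j; rewrite !mxE; case: (fintype.split i) => i'; rewrite !mxE; case: (fintype.split j) => j';
  by rewrite ?mxE.
move: (dot _ _) (dot _ _) (dot x x) (dot y y) H1 H2 H3 => a b e f; lra.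
Unshelve. all: by end_near. Qed.

(** A Garding inequality, available at every time: half of the P term absorbs the cross term, at the
    price of a multiple of |x|^2. *)
Lemma blockf_lower n (P Q S : 'M[R]_n) (a b d : R) x y : 0 < a ->
  a * dot y y <= dot (P *m y) y -> dot (Q *m x) (Q *m x) <= b * dot x x ->
  dot (S *m x) (S *m x) <= d * dot x x ->
  a / 2 * dot y y - (2 / a * b + (d + 1) / 2) * dot x x <= blockf P Q S x y.
Proof.
move=> a0 HP HQ HS; rewrite /blockf !dotDl (dot_mxl Q^T) trmxK (dotC y (Q *m x)).
(* This is a / 2 times the square of (2 / a) Q x + y. *)
have q1 : 0 <= 2 / a * dot (Q *m x) (Q *m x) + 2 * dot (Q *m x) y + a / 2 * dot y y.
  have := dotxx_ge0 ((2 / a) *: (Q *m x) + y).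
  rewrite dotDl !dotDr !dotZl !dotZr (dotC y (Q *m x)) => h.
  have a2 : 0 <= a / 2 by rewrite divr_ge0 // ltW.
  have := mulr_ge0 a2 h; move: (dot _ _) (dot _ _) (dot _ _) => d1 d2 d3.
  by rewrite [X in 0 <= X -> _](_ : _ = 2 / a * d3 + 2 * d2 + a / 2 * d1) //; field; exact: lt0r_neq0.
have q2 := dot_amgm (- (S *m x)) x; rewrite !dotNl dotNr opprK in q2.
have q3 : 2 / a * dot (Q *m x) (Q *m x) <= 2 / a * (b * dot x x).
  by apply: ler_wpM2l => //; rewrite divr_ge0 // ltW.
have E : (2 / a * b + (d + 1) / 2) * dot x x = 2 / a * (b * dot x x) + (d * dot x x + dot x x) / 2.
  by field; exact: lt0r_neq0.
rewrite E; move: q1 q2 q3 HP HQ HS.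
move: (dot (Q *m x) (Q *m x)) (dot (Q *m x) y) (dot y y) (dot (S *m x) (S *m x)) (dot (S *m x) x)
  (dot (P *m y) y) => e1 e2 e3 e4 e5 e6.
move: (2 / a * e1) (2 / a * (b * dot x x)) (b * dot x x) (d * dot x x) (dot x x) => f1 f2 f3 f4 f5.
have -> : a / 2 * e3 = a * e3 / 2 by ring.
move: (a * e3) => f6; lra.
Qed.

Lemma blockf_coercive n (P Q S : R -> 'M[R]_n) (Pm Qm Sm Pp Qp Sp : 'M[R]_n) (a b d : R) :
  P t @[t --> -oo] --> Pm -> P t @[t --> +oo] --> Pp ->
  Q t @[t --> -oo] --> Qm -> Q t @[t --> +oo] --> Qp ->
  S t @[t --> -oo] --> Sm -> S t @[t --> +oo] --> Sp ->
  posdef (block_mx Pm Qm Qm^T Sm) -> posdef (block_mx Pp Qp Qp^T Sp) ->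
  0 < a -> 0 <= b -> 0 <= d ->
  (forall t y, a * dot y y <= dot (P t *m y) y) ->
  (forall t x, dot (Q t *m x) (Q t *m x) <= b * dot x x) ->
  (forall t x, dot (S t *m x) (S t *m x) <= d * dot x x) ->
  exists c K T, [/\ 0 < c, 0 <= K, 0 < T & forall t x y,
    c * (dot x x + dot y y) - K * \1_`[(- T), T] t * dot x x <= blockf (P t) (Q t) (S t) x y].
Proof.
move=> cPm cPp cQm cQp cSm cSp pm pp a0 b0 d0 HP HQ HS.
have [cm cm0 [Am [_ HAm]]] := blockf_near_lower _ cPm cQm cSm pm.
have [cp cp0 [Ap [_ HAp]]] := blockf_near_lower _ cPp cQp cSp pp.
pose c := Num.min (a / 2) (Num.min cm cp).
have c0 : 0 < c by rewrite /c !lt_min divr_gt0 //= cm0.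
have ca : c <= a / 2 by rewrite /c ge_min lexx.
have ccm : c <= cm by rewrite /c !ge_min lexx orbT.
have ccp : c <= cp by rewrite /c !ge_min lexx !orbT.
pose K0 := 2 / a * b + (d + 1) / 2.
have K00 : 0 <= K0.
  rewrite /K0; apply: addr_ge0; last lra.
  by apply: mulr_ge0 => //; rewrite divr_ge0 // ltW.
(* Inside the interval the Garding constant [K0] has to be compensated, and also the term
   [c * dot x x] demanded on the left; outside, the limit matrices decide. *)
exists c, (K0 + c), (`|Am| + `|Ap| + 1).
have nAm := normr_ge0 Am; have nAp := normr_ge0 Ap.
split; [exact: c0|by apply: addr_ge0 => //; exact: ltW|by rewrite ltr_wpDl // addr_ge0|move=> t x y].
have x0 := dotxx_ge0 x; have y0 := dotxx_ge0 y.
have xy0 := addr_ge0 x0 y0.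
rewrite indicE; have [|/negP] := boolP (t \in _).
  move=> _; rewrite mulr1; apply: le_trans (blockf_lower a0 (HP t y) (HQ t x) (HS t x)).
  rewrite -/K0; have := ler_wpM2r y0 ca; move: (dot x x) (dot y y) => q1 q2.
  by lra.
rewrite inE /= in_itv /= => tT; rewrite mulr0 mul0r subr0.
have [tm|tm] := ltP t (- (`|Am| + `|Ap| + 1)).
  apply: le_trans (ler_wpM2r xy0 ccm) _; apply: HAm.
  have := lerNnormlW (lexx `|Am|); lra.
have [coord_fun|coord_fun] := ltP (`|Am| + `|Ap| + 1) t.
  apply: le_trans (ler_wpM2r xy0 ccp) _; apply: HAp.
  have := ler_norm Ap; lra.
by exfalso; apply: tT; rewrite tm coord_fun.
Qed.

End Coercivity.

(** * Truncated velocities *)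

Section HalfLine.
Variable R : realType.
Local Notation mu := (@lebesgue_measure R).
Implicit Types (F f g G H p : R -> R) (c : R).

Definition cut c F : R -> R := fun t => if t <= c then F t else 0.

Lemma patch_itvE F a b t : (F \_ `[a, b]) t = if a <= t <= b then F t else 0.
Proof.
rewrite patchE; have -> // : (t \in `[a, b]%classic) = (a <= t <= b).
by apply/idP/idP; rewrite inE /= in_itv.
Qed.

Lemma cut_measurable c F : measurable_fun setT F -> measurable_fun setT (cut c F).
Proof.
move=> mF; have -> : cut c F = (fun t => F t * \1_`]-oo, c] t).
  apply/funext => t; rewrite /cut indicE.
  have -> : (t \in `]-oo, c]%classic) = (t <= c) by apply/idP/idP; rewrite inE /= in_itv.
  by case: (t <= c); rewrite ?mulr1 ?mulr0.
apply: measurable_funM => //; exact: measurable_indic.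
Qed.

Lemma cut_int c F a b : \int[mu]_(t in `[a, b]) cut c F t = \int[mu]_(t in `[a, Num.min b c]) F t.
Proof.
rewrite Rintegral_mkcond [RHS]Rintegral_mkcond; apply: eq_Rintegral => t _.
rewrite !patch_itvE le_min /cut.
by case: (a <= t) => //=; case: (t <= b) => //=; case: (t <= c).
Qed.

(** Since [F c = 0] the truncation has no jump, so no boundary term arises at [c]. *)
Lemma cut_ibp c F f : C1 F f -> F c = 0 -> ibp (cut c F) (cut c f).
Proof.
move=> CF F0 a b ab phi dphi Cphi.
have -> : \int[mu]_(t in `[a, b]) (cut c F t * dphi t + cut c f t * phi t) =
   \int[mu]_(t in `[a, b]) cut c (fun t => F t * dphi t + f t * phi t) t.
  by apply: eq_Rintegral => t _; rewrite /cut; case: ifP => // _; rewrite !mul0r addr0.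
rewrite cut_int /cut; have [bc|cb] := leP b c.
  by rewrite (C1_ibp CF ab Cphi) (le_trans ab bc).
rewrite mul0r sub0r; have [ac|ca] := leP a c.
  by rewrite (C1_ibp CF ac Cphi) F0 mul0r sub0r.
rewrite mul0r oppr0 (_ : [set` _] = set0) ?Rintegral_set0 //.
by apply/seteqP; split => t //=; rewrite in_itv /= => /andP[at_ tc]; lra.
Qed.

Lemma cut_itv_integrable c F a : continuous F ->
  mu.-integrable setT (EFin \o (F \_ `[a, c])).
Proof.
move=> cF; rewrite -restrict_EFin -integrable_mkcond //; exact: continuous_itv_integrable.
Qed.

(** Fatou on the growing windows from c - j to c. *)
Lemma tail_integrable c C G : continuous G -> (forall t, 0 <= G t) ->
  (forall a, a <= c -> \int[mu]_(t in `[a, c]) G t <= C) ->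
  mu.-integrable setT (EFin \o cut c G).
Proof.
move=> cG G0 HC.
have := @fatou_Rint R (fun j => G \_ `[c - j%:R, c]) (cut c G) C.
case=> //.
- by move=> j; apply/measurable_EFinP; case/integrableP: (@cut_itv_integrable c G (c - j%:R) cG).
- by move=> j x; rewrite patchE; case: ifP.
- move=> x; apply: cvg_near_cst; near=> j.
  rewrite patch_itvE /cut.
  suff -> : c - j%:R <= x by [].
  have : c - x <= j%:R by near: j; exact: nbhs_infty_ger.
  lra.
- move=> j; split; first exact: cut_itv_integrable.
  by rewrite -Rintegral_mkcond; apply: HC; rewrite lerBlDr lerDl.
Unshelve. all: by end_near. Qed.

(** If every window missed at least [e] of the integral of the absolute value, Fatou would bound
    that integral by itself minus [e]. *)
Lemma tail_small c h : mu.-integrable setT (EFin \o cut c h) -> forall e, 0 < e ->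
  exists2 A, A <= c & forall a, a <= A ->
    `|\int[mu]_t cut c h t - \int[mu]_(t in `[a, c]) h t| <= e.
Proof.
move=> ih e e0.
have iN : mu.-integrable setT (EFin \o (fun t => `|cut c h t|)).
  by have /integrable_abse := ih.
have ij a : mu.-integrable setT (EFin \o ((fun t => `|cut c h t|) \_ `[a, c])).
  rewrite -restrict_EFin -integrable_mkcond //; exact: itv_integrableT.
have [j Hj] : exists j : nat, \int[mu]_t `|cut c h t| - e <=
    \int[mu]_t ((fun t => `|cut c h t|) \_ `[c - j%:R, c]) t.
  apply: contrapT => nj.
  have := @fatou_Rint R (fun j => (fun t => `|cut c h t|) \_ `[c - j%:R, c])
     (fun t => `|cut c h t|) (\int[mu]_t `|cut c h t| - e).
  case=> //.
  - by move=> j; apply/measurable_EFinP; case/integrableP: (ij (c - j%:R)).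
  - by move=> j x; rewrite patchE; case: ifP.
  - move=> x; apply: cvg_near_cst; near=> j.
    rewrite patch_itvE.
    suff jx : c - j%:R <= x by rewrite jx /= /cut; case: (x <= c); rewrite ?normr0.
    have : c - x <= j%:R by near: j; exact: nbhs_infty_ger.
    lra.
  - move=> j; split; first exact: ij.
    apply/ltW; rewrite ltNge; apply/negP => Hj; apply: nj; by exists j.
  - by move=> _; rewrite lerDl oppr_ge0 leNgt e0.
exists (c - j%:R) => [|a aj]; first by rewrite lerBlDr lerDl.
have ia : mu.-integrable setT (EFin \o (cut c h \_ `[a, c])).
  rewrite -restrict_EFin -integrable_mkcond //; exact: itv_integrableT.
have -> : \int[mu]_(t in `[a, c]) h t = \int[mu]_t (cut c h \_ `[a, c]) t.
  by rewrite -Rintegral_mkcond cut_int minxx.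
rewrite -RintegralB //; apply: le_trans (le_normr_Rintegral _ _) _ => //.
  have := integrable_D measurableT ih (integrable_Z (-1) measurableT ia).
  by apply: eq_integrable => // t _ /=; rewrite mulN1r.
have : \int[mu]_t `|cut c h t| - \int[mu]_t ((fun t => `|cut c h t|) \_ `[c - j%:R, c]) t <= e by lra.
apply: le_trans; rewrite -RintegralB //; apply: le_Rintegral => //.
- have := integrable_D measurableT ih (integrable_Z (-1) measurableT ia).
  move=> /integrable_abse; apply: eq_integrable => // t _ /=; by rewrite mulN1r.
- have := integrable_D measurableT iN (integrable_Z (-1) measurableT (ij (c - j%:R))).
  by apply: eq_integrable => // t _ /=; rewrite mulN1r.
move=> t _; rewrite !patch_itvE.
case: (leP (c - j%:R) t) => /= [jt|_].
  rewrite (le_trans aj jt) /=; case: ifP; rewrite ?subrr ?normr0 //.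
  by rewrite /cut => ->; rewrite subrr normr0.
by rewrite subr0; case: ifP; rewrite ?subr0 // subrr normr0.
Unshelve. all: by end_near. Qed.

(* [p] is integrable and has a limit at -oo, which must then be 0. *)
Lemma tail_FTC c p H : mu.-integrable setT (EFin \o cut c H) ->
  mu.-integrable setT (EFin \o cut c p) ->
  (forall a, a <= c -> \int[mu]_(t in `[a, c]) H t = p c - p a) ->
  \int[mu]_t cut c H t = p c.
Proof.
move=> iH ip HE; apply/eqP; rewrite -subr_eq0; apply: contrapT => /negP l0.
set l := _ - _ in l0; have e0 : 0 < `|l| / 2 by rewrite divr_gt0 // normr_gt0.
have [A Ac HA] := tail_small iH e0.
have pl a : a <= A -> `|l| / 2 <= `|cut c p a|.
  move=> aA; have ac := le_trans aA Ac.
  have := HA a aA; rewrite HE // /cut ac => h.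
  have -> : p a = - (l - (\int[mu]_t cut c H t - (p c - p a))) by rewrite /l; ring.
  rewrite normrN; apply: le_trans (lerB_dist _ _); move: h; rewrite /cut; lra.
have iN : mu.-integrable setT (EFin \o (fun t => `|cut c p t|)).
  by have /integrable_abse := ip.
have bnd (N : R) : 0 <= N -> `|l| / 2 * N <= \int[mu]_t `|cut c p t|.
  move=> N0; have NA : A - N <= A by lra.
  apply: le_trans (cut_le_int (A - N) A iN (fun t => normr_ge0 _)).
  have -> : `|l| / 2 * N = \int[mu]_(t in `[A - N, A]) (`|l| / 2).
    by rewrite Rint_itv_cst //; congr (_ * _); ring.
  apply: le_Rintegral => //.
  - exact: integrable_cst_itv.
  - exact: itv_integrableT.
  by move=> t /=; rewrite in_itv /= => /andP[_]; exact: pl.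
have I0 : 0 <= \int[mu]_t `|cut c p t| by apply: Rint_ge0.
have := bnd ((\int[mu]_t `|cut c p t| + 1) / (`|l| / 2)).
rewrite [_ * (_ / _)]mulrC divfK ?gt_eqF // => h.
have : \int[mu]_t `|cut c p t| + 1 <= \int[mu]_t `|cut c p t|.
  by apply: h; apply: divr_ge0; [lra|exact: ltW].
by lra.
Qed.

Lemma C1_expR k : C1 (fun t : R => expR (k * t)) (fun t => k * expR (k * t)).
Proof.
have D (t : R) : is_derive t (1 : R) (fun t : R => expR (k * t)) (k * expR (k * t)).
  have h : is_derive t (1 : R) (fun t : R => k * t) k.
    by have [/(_ t) + _] := C1Z k (@C1_id R); rewrite /= mulr1.
  have := @is_derive1_comp R expR (fun t : R => k * t) t (expR (k * t)) k (is_derive_expR _) h.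
  by rewrite mulrC.
split=> // t; apply: cvgM; first exact: cvg_cst.
have kt : k * x @[x --> t] --> k * t by apply: cvgM; [exact: cvg_cst|exact: cvg_id].
exact: (cvg_comp _ _ kt (@continuous_expR R (k * t))).
Qed.

(** To the right of [t0] the product of psi with exp(-K t) is nonincreasing, to the left the product
    with exp(K t) is nondecreasing; both vanish at [t0]. *)
Lemma gronwall_zero (psi dpsi : R -> R) (K t0 : R) : C1 psi dpsi ->
  (forall t, 0 <= psi t) -> (forall t, `|dpsi t| <= K * psi t) -> psi t0 = 0 ->
  forall t, psi t = 0.
Proof.
move=> Cp p0 Kp pt0 t; apply: le_anti; rewrite p0 andbT.
have [tt|/ltW tt] := leP t0 t.
  have := C1_le (C1Z (-1) (C1M (C1_expR (- K)) Cp)) tt.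
  rewrite pt0 mulr0 mulr0 mulN1r oppr_ge0 pmulr_rle0 ?expR_gt0 //; apply => x _.
  have := ler_norm (dpsi x); have := Kp x => h1 h2.
  rewrite mulN1r oppr_ge0.
  have -> : - K * expR (- K * x) * psi x + expR (- K * x) * dpsi x =
    expR (- K * x) * (dpsi x - K * psi x) by ring.
  by rewrite pmulr_rle0 ?expR_gt0 //; lra.
have := C1_le (C1M (C1_expR K) Cp) tt.
rewrite pt0 mulr0 pmulr_rle0 ?expR_gt0 //; apply => x _.
have -> : K * expR (K * x) * psi x + expR (K * x) * dpsi x =
    expR (K * x) * (dpsi x + K * psi x) by ring.
apply: mulr_ge0; first exact: expR_ge0.
by have := lerNnormlW (Kp x); lra.
Qed.

Lemma is_derive_quadratic F (x d C : R) :
  (forall h, `|F (x + h) - F x - d * h| <= C * h ^+ 2) -> is_derive x (1 : R) F d.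
Proof.
move=> HF; apply/is_deriveP; apply/cvgrPdist_le => e e0.
have C0 : 0 <= C.
  by have := le_trans (normr_ge0 _) (HF 1); rewrite expr1n mulr1.
have idh : (fun h : R => h) h @[h --> 0^'] --> (0 : R) by exact: cvg_within.
near=> h.
have h0 : h != 0 by near: h; exact: nbhs_dnbhs_neq.
have hs : `|h| <= e / (C + 1).
  near: h; have /cvgr0Pnorm_le := idh; apply.
  by rewrite divr_gt0 //; lra.
rewrite /GRing.scale /= mulr1.
have -> : d - h^-1 * (F (h + x) - F x) = - (h^-1 * (F (x + h) - F x - d * h)).
  by rewrite [h + x]addrC; field.
rewrite normrN normrM normfV -ler_pdivlMl ?invr_gt0 ?normr_gt0 // invrK.
apply: le_trans (HF h) _; rewrite -(real_normK (num_real h)) expr2 mulrCA.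
apply: ler_wpM2l => //; apply: le_trans (ler_wpM2l C0 hs) _.
by rewrite mulrCA ler_piMr ?(ltW e0) // ler_pdivrMr; lra.
Unshelve. all: by end_near. Qed.

(** The squared positive part of an affine function has a second order remainder at most k^2 h^2. It
    is the building block of an explicit C^1 bump. *)
Lemma C1_pos_sqr (k a : R) : C1 (fun t => Num.max 0 (k * (t - a)) ^+ 2)
   (fun t => 2 * k * Num.max 0 (k * (t - a))).
Proof.
split=> t.
  apply: (@is_derive_quadratic _ _ _ (k ^+ 2)) => h.
  have -> : k * (t + h - a) = k * (t - a) + k * h by ring.
  move: (k * (t - a)) => s.
  have -> : 2 * k * Num.max 0 s * h = 2 * Num.max 0 s * (k * h) by ring.
  rewrite -exprMn; move: (k * h) => y.
  rewrite ler_norml; have [s0|s0] := leP 0 s; have [y0|y0] := leP 0 (s + y); apply/andP; split; nra.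
apply: cvgM; first exact: cvg_cst.
have -> : (fun t => Num.max 0 (k * (t - a))) = (fun t : R => (k * (t - a) + `|k * (t - a)|) / 2).
  by apply/funext => x; have [h|h] := leP 0 (k * (x - a)); [rewrite ger0_norm //|rewrite ltr0_norm //]; lra.
have cx : k * (x - a) @[x --> t] --> k * (t - a).
  by apply: cvgM; [exact: cvg_cst|apply: cvgB; [exact: cvg_id|exact: cvg_cst]].
rewrite (_ : Num.max 0 (k * (t - a)) = (k * (t - a) + `|k * (t - a)|) / 2); last first.
  by have [h|h] := leP 0 (k * (t - a)); [rewrite ger0_norm //|rewrite ltr0_norm //]; lra.
apply: cvgM; last exact: cvg_cst.
by apply: cvgD => //; exact: cvg_norm.
Qed.

(** The product of two squared positive parts, one vanishing left of t0 - r and the other right of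
    t0 + r. *)
Lemma bump (t0 r : R) : 0 < r -> exists beta dbeta, [/\ C1c beta dbeta, beta t0 != 0 &
  forall t, r <= `|t - t0| -> beta t = 0].
Proof.
move=> r0.
exists (fun t => Num.max 0 (1 * (t - (t0 - r))) ^+ 2 * Num.max 0 ((- 1) * (t - (t0 + r))) ^+ 2).
eexists; split.
- split; first exact: C1M (C1_pos_sqr _ _) (C1_pos_sqr _ _).
  exists (`|t0| + r) => t Ht.
  have : t <= t0 - r \/ t0 + r <= t.
    have [tn|tn] := leP 0 t.
      by right; move: Ht; rewrite (ger0_norm tn); have := ler_norm t0; lra.
    by left; move: Ht; rewrite (ltr0_norm tn); have := lerNnormlW (lexx `|t0|); lra.
  case=> ht.
    have -> : Num.max 0 (1 * (t - (t0 - r))) = 0 by apply/max_idPl; lra.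
    by rewrite expr0n /= !(mul0r, mulr0, addr0).
  have -> : Num.max 0 ((- 1) * (t - (t0 + r))) = 0 by apply/max_idPl; lra.
  by rewrite expr0n /= !(mul0r, mulr0, addr0).
- have -> : Num.max 0 (1 * (t0 - (t0 - r))) = r by rewrite max_r; lra.
  have -> : Num.max 0 ((- 1) * (t0 - (t0 + r))) = r by rewrite max_r; lra.
  by rewrite mulf_neq0 // expf_neq0 // gt_eqF.
move=> t Ht; have : t <= t0 - r \/ t0 + r <= t.
  have [tn|tn] := leP 0 (t - t0).
    by right; move: Ht; rewrite (ger0_norm tn); lra.
  by left; move: Ht; rewrite (ltr0_norm tn); lra.
case=> ht.
  have -> : Num.max 0 (1 * (t - (t0 - r))) = 0 by apply/max_idPl; lra.
  by rewrite expr0n /= mul0r.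
have -> : Num.max 0 ((- 1) * (t - (t0 + r))) = 0 by apply/max_idPl; lra.
by rewrite expr0n /= mulr0.
Qed.

End HalfLine.

(** * Uniqueness for the linearized equation *)

Section TrialFunctions.
Variables (R : realType) (n : nat).
Local Notation vec := 'cV[R]_n.
Local Notation mu := (@lebesgue_measure R).
Variables (vel acc force : R -> vec) (P Q S : R -> 'M[R]_n) (a b d c K T : R).
Hypothesis C1_vel : forall i, C1 (fun t => vel t i 0) (fun t => acc t i 0).
Hypothesis acc_continuous : forall i, continuous (fun t => acc t i 0).
Hypothesis forceE : forall t, force t = P t *m acc t + Q t *m vel t.
Hypothesis C1_force : forall i, C1 (fun t => force t i 0)
  (fun t => ((Q t)^T *m acc t + S t *m vel t) i 0).
Hypotheses (bP : bmx P) (bQ : bmx Q) (bS : bmx S).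
Hypotheses (a_gt0 : 0 < a) (b_ge0 : 0 <= b) (d_ge0 : 0 <= d).
Hypothesis P_lower : forall t y, a * dot y y <= dot (P t *m y) y.
Hypothesis Q_upper : forall t x, dot (Q t *m x) (Q t *m x) <= b * dot x x.
Hypothesis S_upper : forall t x, dot (S t *m x) (S t *m x) <= d * dot x x.

Definition force' t : vec := (Q t)^T *m acc t + S t *m vel t.

Lemma dot_le_sqr k (x y : vec) : 0 < k -> k * dot x x <= dot y x ->
  k ^+ 2 * dot x x <= dot y y.
Proof.
move=> k0 /(ler_wpM2l (ltW k0)) H; have := dotxx_ge0 (y - k *: x).
rewrite dotBl !dotBr !dotZl !dotZr (dotC x y) expr2 -mulrA; move: H.
by move: (dot y x) (k * (k * dot x x)) (dot y y) => q1 q2 q3; lra.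
Qed.

Lemma dot_sub_sqr (x y : vec) : dot (x - y) (x - y) <= 2 * dot x x + 2 * dot y y.
Proof. by have := dotxx_ge0 (x + y); rewrite !(dotDl, dotDr, dotNl, dotNr) (dotC y x); lra. Qed.

Lemma C1_dot (x x' y y' : R -> vec) :
  (forall i, C1 (fun t => x t i 0) (fun t => x' t i 0)) ->
  (forall i, C1 (fun t => y t i 0) (fun t => y' t i 0)) ->
  C1 (fun t => dot (x t) (y t)) (fun t => dot (x' t) (y t) + dot (x t) (y' t)).
Proof.
move=> Cx Cy.
apply: C1_eq (@C1_sum R _ (index_enum 'I_n) _ _ (fun i => C1M (Cx i) (Cy i))) _ _ => // t.
by rewrite -big_split.
Qed.

(** Gronwall for |v|^2 + |force|^2. With [force] as second variable the acceleration need not be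
    differentiated; it is recovered from P v' = force - Q v by coercivity of [P]. *)
Lemma stationary_zero t0 : vel t0 = 0 -> acc t0 = 0 -> forall t, vel t = 0.
Proof.
move=> v0 a0.
have Cpsi : C1 (fun t => dot (vel t) (vel t) + dot (force t) (force t))
   (fun t => (dot (acc t) (vel t) + dot (vel t) (acc t)) +
             (dot (force' t) (force t) + dot (force t) (force' t))).
  by apply: C1D; apply: C1_dot.
(* [A] bounds |v'|^2, because a^2 |v'|^2 <= |force - Q v|^2 <= 2 |force|^2 + 2 b |v|^2; [k] adds the
   costs of splitting the products in the derivative. *)
pose A := 2 / a ^+ 2 * (1 + b).
pose k := (1 + d) + (1 + b) + 2 * A.
have bound t : `|(dot (acc t) (vel t) + dot (vel t) (acc t)) +
             (dot (force' t) (force t) + dot (force t) (force' t))| <=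
     k * (dot (vel t) (vel t) + dot (force t) (force t)).
  have HPa := P_lower t (acc t); have HQv := Q_upper t (vel t).
  have HQf := Q_upper t (force t); have HSv := S_upper t (vel t).
  have Pa : P t *m acc t = force t - Q t *m vel t by rewrite forceE addrK.
  rewrite Pa in HPa.
  have E1 : dot (force' t) (force t) = dot (acc t) (Q t *m force t) + dot (S t *m vel t) (force t).
    by rewrite /force' dotDl (dot_mxl (Q t)^T) trmxK.
  rewrite (dotC (force t)) E1 (dotC (vel t) (acc t)).
  have g1 := dot_amgm (acc t) (vel t); have g2 := dot_amgm (- acc t) (vel t).
  have g3 := dot_amgm (acc t) (Q t *m force t); have g4 := dot_amgm (- acc t) (Q t *m force t).
  have g5 := dot_amgm (S t *m vel t) (force t); have g6 := dot_amgm (- (S t *m vel t)) (force t).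
  rewrite !(dotNl, dotNr) !opprK in g2 g4 g6.
  have f0 := dotxx_ge0 (force t); have v0' := dotxx_ge0 (vel t).
  have accb : dot (acc t) (acc t) <= A * (dot (vel t) (vel t) + dot (force t) (force t)).
    have -> : A * (dot (vel t) (vel t) + dot (force t) (force t)) =
      (2 * (1 + b) * (dot (vel t) (vel t) + dot (force t) (force t))) / a ^+ 2.
      by rewrite /A; ring.
    rewrite ler_pdivlMr ?exprn_gt0 // mulrC; apply: le_trans (dot_le_sqr a_gt0 HPa) _.
    apply: le_trans (dot_sub_sqr _ _) _.
    have bf := mulr_ge0 b_ge0 f0; move: HQv bf f0 v0'.
    have -> : 2 * (1 + b) * (dot (vel t) (vel t) + dot (force t) (force t)) =
      2 * dot (vel t) (vel t) + 2 * dot (force t) (force t) +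
      2 * (b * dot (vel t) (vel t)) + 2 * (b * dot (force t) (force t)) by ring.
    by lra.
  rewrite /k; move: g1 g2 g3 g4 g5 g6 accb HQf HSv f0 v0'.
  have -> : (1 + d + (1 + b) + 2 * A) * (dot (vel t) (vel t) + dot (force t) (force t)) =
    dot (vel t) (vel t) + dot (force t) (force t) + d * dot (vel t) (vel t) + d * dot (force t) (force t)
    + dot (vel t) (vel t) + dot (force t) (force t) + b * dot (vel t) (vel t) + b * dot (force t) (force t)
    + 2 * (A * (dot (vel t) (vel t) + dot (force t) (force t))) by ring.
  move=> g1 g2 g3 g4 g5 g6 accb HQf HSv f0 v0'.
  have bv := mulr_ge0 b_ge0 v0'; have df := mulr_ge0 d_ge0 f0.
  rewrite ler_norml; apply/andP; split; lra.
have psi0 t : 0 <= dot (vel t) (vel t) + dot (force t) (force t).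
  by apply: addr_ge0; exact: dotxx_ge0.
have f0 : force t0 = 0 by rewrite forceE v0 a0 !mulmx0 addr0.
have := gronwall_zero Cpsi psi0 bound (t0 := t0); rewrite v0 f0 !dot0l addr0 => H t.
have := H erefl t; move=> /eqP; rewrite paddr_eq0 ?dotxx_ge0 // => /andP[+ _].
by rewrite dotxx_eq0 => /eqP.
Qed.

End TrialFunctions.

(** * The truncated velocities as trial functions *)

Section TrialFamily.
Variables (R : realType) (n : nat).
Local Notation vec := 'cV[R]_n.
Local Notation mu := (@lebesgue_measure R).
Local Notation pairL := ((R -> vec) * (R -> vec))%type.
Variables (vel acc force : R -> vec) (P Q S : R -> 'M[R]_n) (c K T B : R).
Hypothesis C1_vel : forall i, C1 (fun t => vel t i 0) (fun t => acc t i 0).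
Hypothesis acc_continuous : forall i, continuous (fun t => acc t i 0).
Hypothesis forceE : forall t, force t = P t *m acc t + Q t *m vel t.
Hypothesis C1_force : forall i, C1 (fun t => force t i 0)
  (fun t => ((Q t)^T *m acc t + S t *m vel t) i 0).
Hypotheses (vel_le : forall t i, `|vel t i 0| <= B) (force_le : forall t i, `|force t i 0| <= B).
Hypotheses (bP : bmx P) (bQ : bmx Q) (bS : bmx S).
Hypotheses (c_gt0 : 0 < c) (T_gt0 : 0 < T).
Hypothesis coercive : forall t x y,
  c * (dot x x + dot y y) - K * \1_`[(- T), T] t * dot x x <= blockf (P t) (Q t) (S t) x y.

Local Notation force' := (force' vel acc Q S).
(** The W^{1,2} density of the velocity, not the conserved quantity of [energy_const]. *)
Local Notation energy := (fun t => dot (vel t) (vel t) + dot (acc t) (acc t)).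

Lemma energy_continuous : continuous energy.
Proof.
have cv i : continuous (fun t => vel t i 0) by exact: C1_continuous (C1_vel i).
by move=> t; apply: cvgD; apply: cvg_bigsum => i; apply: cvgM; first
  [exact: cv|exact: acc_continuous].
Qed.

Lemma energy_ge0 t : 0 <= energy t.
Proof. by apply: addr_ge0; exact: dotxx_ge0. Qed.

(** By the linearized equation the density of the index form at the velocity is an exact derivative,
    so its integrals over intervals are bounded boundary terms. *)
Lemma C1_force_vel : C1 (fun t => dot (force t) (vel t))
  (fun t => blockf (P t) (Q t) (S t) (vel t) (acc t)).
Proof.
apply: C1_eq (C1_dot C1_force C1_vel) _ _ => // t.
by rewrite /blockf -forceE addrC.
Qed.

Lemma force_vel_le t : `|dot (force t) (vel t)| <= \sum_(i < n) B * B.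
Proof.
apply: le_trans (ler_norm_sum _ _ _) _; apply: ler_sum => i _.
by rewrite normrM; apply: ler_pM.
Qed.

(** Left of [- T] coercivity bounds c times the integral of [energy] by that of [blockf], which is a
    difference of two boundary terms of size at most [M]. The remaining stretch is compact. *)
Lemma energy_tail e : mu.-integrable setT (EFin \o cut e energy).
Proof.
(* The margin 1 puts [e'] strictly left of [[- T, T]], where the indicator in the coercivity
   estimate vanishes. *)
pose M := \sum_(i < n) B * B; pose e' := Num.min e (- T - 1).
have ee : e' <= e by rewrite /e' ge_min lexx.
have eT : e' <= - T - 1 by rewrite /e' ge_min lexx orbT.
have iG a b : mu.-integrable `[a, b] (EFin \o energy).
  apply: continuous_itv_integrable; exact: energy_continuous.
have far a : a <= e' -> \int[mu]_(t in `[a, e']) energy t <= 2 * M / c.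
  move=> ae; rewrite ler_pdivlMr // mulrC -RintegralZl //.
  apply: le_trans (_ : \int[mu]_(t in `[a, e']) blockf (P t) (Q t) (S t) (vel t) (acc t) <= _).
    apply: le_Rintegral => //.
    - by apply: integrable_Z => //; exact: iG.
    - by apply: continuous_itv_integrable; case: C1_force_vel.
    move=> t /=; rewrite in_itv /= => /andP[_ te]; apply: le_trans (coercive t _ _).
    rewrite indicE (_ : (t \in _) = false) ?mulr0 ?mul0r ?subr0 //.
    by apply/negP; rewrite inE /= in_itv /= => /andP[]; lra.
  rewrite (FTC_C1 ae C1_force_vel).
  have := ler_norm (dot (force e') (vel e')); have := lerNnormlW (force_vel_le a).
  have := force_vel_le e'; rewrite -/M; lra.
apply: (@tail_integrable _ _ (2 * M / c + \int[mu]_(t in `[e', e]) energy t)).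
- exact: energy_continuous.
- exact: energy_ge0.
move=> a ae; have I0 x y : 0 <= \int[mu]_(t in `[x, y]) energy t.
  by apply: Rintegral_ge0 => t _; exact: energy_ge0.
have [ae'|/ltW ae'] := leP a e'.
  by rewrite (Rint_split ae' ee (iG _ _)) lerD2r; exact: far.
rewrite (Rint_split ae' ae (iG _ _)) addrA lerDr addr_ge0 //.
exact: le_trans (I0 e' e') (far _ (lexx e')).
Qed.

Definition vcut e (x : R -> vec) : R -> vec := fun t => if t <= e then x t else 0.

Definition trial e : pairL := (vcut e vel, vcut e acc).

Lemma vcut_coord e x t i : vcut e x t i 0 = cut e (fun t => x t i 0) t.
Proof. by rewrite /vcut /cut; case: ifP => // _; exact: zerovec_coord. Qed.

Lemma cut_L2 e (f : R -> R) : continuous f -> (forall t : R, f t ^+ 2 <= energy t) -> L2 (cut e f).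
Proof.
move=> cf fle; apply/L2P; have mf := continuous_measurable cf.
split; first exact: cut_measurable.
apply: le_integrable (energy_tail e) => //.
  apply/measurable_EFinP; apply: measurable_funX; exact: cut_measurable.
move=> t _ /=; rewrite lee_fin /cut; case: ifP => _; last by rewrite expr0n normr0.
by rewrite !ger0_norm ?sqr_ge0 // energy_ge0.
Qed.

Lemma trial_pairL2 e : pairL2 (trial e).
Proof.
have cv i : continuous (fun t => vel t i 0) by exact: C1_continuous (C1_vel i).
split=> i /=.
- apply: L2_eq (fun t => esym (vcut_coord e vel t i)) _; apply: cut_L2 => // t.
  by apply: le_trans (coord_le_dot _ i) _; rewrite lerDl dotxx_ge0.
- apply: L2_eq (fun t => esym (vcut_coord e acc t i)) _; apply: cut_L2 => // t.
  by apply: le_trans (coord_le_dot _ i) _; rewrite lerDr dotxx_ge0.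
Qed.

Lemma trial_W12pair e : vel e = 0 -> W12pair (trial e).
Proof.
move=> ve; split=> [|i]; first exact: trial_pairL2.
have := cut_ibp (C1_vel i) (c := e); rewrite ve zerovec_coord => /(_ erefl).
by congr ibp; apply/funext => t; rewrite /= vcut_coord.
Qed.

Lemma momentum_part_trial e t : momentum_part P Q (trial e) t = vcut e force t.
Proof. by rewrite /momentum_part /= /vcut forceE; case: ifP => // _; rewrite !mulmx0 addr0. Qed.

Lemma force_part_trial e t : force_part Q S (trial e) t = vcut e force' t.
Proof. by rewrite /force_part /= /vcut; case: ifP => // _; rewrite !mulmx0 addr0. Qed.

Lemma dot_vcut e x y t : dot (vcut e x t) (y t) = cut e (fun t => dot (x t) (y t)) t.
Proof. by rewrite /vcut /cut; case: ifP => // _; rewrite dot0l. Qed.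

(** On the half-line the integrand is the derivative of force . Phi. This product is integrable
    there, so [tail_FTC] leaves only the boundary term at [e]. *)
Lemma index_form_trial e Phi : W12pair Phi -> index_form P Q S (trial e) Phi = dot (force e) (Phi.1 e).
Proof.
move=> [lPhi iPhi]; have [p1 p2] := lPhi; have lt := trial_pairL2 e.
have lz : inL2 (momentum_part P Q (trial e)) by exact: momentum_part_L2.
have ly : inL2 (force_part Q S (trial e)) by exact: force_part_L2.
pose H t := dot (force t) (Phi.2 t) + dot (force' t) (Phi.1 t).
have HE t : dot (P t *m (trial e).2 t + Q t *m (trial e).1 t) (Phi.2 t) +
    dot ((Q t)^T *m (trial e).2 t + S t *m (trial e).1 t) (Phi.1 t) = cut e H t.
  rewrite -/(momentum_part P Q (trial e) t) -/(force_part Q S (trial e) t) momentum_part_trial force_part_trial !dot_vcut.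
  by rewrite /cut; case: ifP => // _; rewrite addr0.
rewrite index_form_int //; under eq_Rintegral do rewrite HE.
apply: (@tail_FTC R e (fun t => dot (force t) (Phi.1 t)) H).
- have := integrable_D measurableT (dot_integrable lz p2) (dot_integrable ly p1).
  by apply: eq_integrable => // t _ /=; rewrite -HE.
- have := dot_integrable lz p1.
  by apply: eq_integrable => // t _ /=; rewrite momentum_part_trial dot_vcut.
move=> s se; rewrite -sumrB.
transitivity (\sum_i \int[mu]_(t in `[s, e])
    (Phi.1 t i 0 * force' t i 0 + Phi.2 t i 0 * force t i 0)).
  rewrite -Rintegral_sum //.
    apply: eq_Rintegral => t _; rewrite /H addrC -big_split /=; apply: eq_bigr => i _.
    by rewrite [X in X + _]mulrC [X in _ + X]mulrC.
  move=> i; have Cf := C1_force i.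
  apply: integrable_D => //; apply: L2_continuous_integrable; first
    [exact: p1|exact: p2|exact: C1_continuous Cf|by case: Cf].
apply: eq_bigr => i _; rewrite (iPhi i _ _ se _ _ (C1_force i)).
by rewrite [force e i 0 * _]mulrC [force s i 0 * _]mulrC.
Qed.

(** The value at [e] of the second trial function is 0 either because it has been cut off or because
    the velocity vanishes there. *)
Lemma index_form_trial_trial e e' : vel e = 0 -> vel e' = 0 -> index_form P Q S (trial e) (trial e') = 0.
Proof.
move=> v0 v0'; rewrite index_form_trial; last exact: trial_W12pair.
by rewrite /= /vcut v0; case: ifP => _; rewrite dot0r.
Qed.

Lemma separated (k : nat) (tau : 'I_k -> R) (j : 'I_k) : injective tau ->
  exists2 r, 0 < r & forall i, i != j -> r <= `|tau i - tau j|.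
Proof.
move=> inj; exists (\big[Num.min/1]_(i | i != j) `|tau i - tau j|).
  apply: (@big_ind R (fun x => 0 < x)) => // [x y x0 y0|i ij]; first by rewrite lt_min x0.
  by rewrite normr_gt0 subr_eq0 (inj_eq inj).
by move=> i ij; exact: bigmin_le_cond.
Qed.

(** Tested with a bump around [tau j] in the direction of the acceleration there, only the j-th
    boundary term survives, and it is nonzero. *)
Lemma trial_independent (k : nat) (tau : 'I_k -> R) (cc : 'I_k -> R) : injective tau ->
  (forall i, dot (force (tau i)) (acc (tau i)) != 0) ->
  (forall Phi, W12pair Phi -> \sum_i cc i * index_form P Q S (trial (tau i)) Phi = 0) ->
  forall j, cc j = 0.
Proof.
move=> inj acc0 Hc j; have [r r0 Hr] := separated j inj.
have [beta [dbeta [Cb bj b0]]] := bump (tau j) r0.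
pose Phi : pairL := \sum_i acc (tau j) i 0 *: (coord_fun i beta, coord_fun i dbeta).
have DPhi : W12pair Phi by apply: W12pair_sum => i; exact: coord_fun_W12pair.
have Phi1 t : Phi.1 t = beta t *: acc (tau j).
  apply/colP => l; rewrite scalevec_coord /Phi.
  have -> : (\sum_i acc (tau j) i 0 *: (coord_fun i beta, coord_fun i dbeta)).1 t l 0 =
     \sum_i acc (tau j) i 0 * coord_fun i beta t l 0.
    elim/big_ind2: _ => [|u1 u2 x1 x2 <- <-|i _]; [exact: zerovec_coord|exact: addmx_coord|].
    exact: scalevec_coord.
  rewrite (bigD1 l) //= big1 ?addr0 => [|i il]; rewrite coord_fun_coord ?eqxx ?mulr1 1?mulrC //.
  by rewrite eq_sym (negPf il) mulr0 mul0r.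
have := Hc _ DPhi; rewrite (bigD1 j) //= big1 ?addr0 => [|i ij].
  rewrite index_form_trial // Phi1 dotZr => /eqP; rewrite !mulf_eq0 (negPf bj) (negPf (acc0 j)) !orbF.
  by move/eqP.
by rewrite index_form_trial // Phi1 b0 ?scale0r ?dot0r ?mulr0 //; exact: Hr.
Qed.

End TrialFamily.

(** * The index of an extremal *)

Section Counting.
Import finmap.finmap.
Variable R : realType.

(** An infinite set contains finite subsets of every size, which forces [m] to be +oo; so it is
    enough to bound the size of finite families. *)
Lemma counting_le (A : set R) (m : \bar R) :
  (forall (k : nat) (tau : 'I_k -> R), injective tau -> (forall i, A (tau i)) -> (k%:R%:E <= m)%E) ->
  (counting A <= m)%E.
Proof.
move=> H.
have sub (B : {fset R}) : (forall x, x \in B -> A x) -> ((#|` B|%fset)%:R%:E <= m)%E.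
  move=> BA; apply: (H _ (fun i => nth 0 (enum_fset B) i)).
    by move=> i j /eqP; rewrite (nth_uniq 0 (ltn_ord i) (ltn_ord j) (fset_uniq B)) => /eqP/ord_inj.
  by move=> i; apply: BA; apply: mem_nth; exact: ltn_ord.
rewrite /counting; case: asboolP => [fA|nA].
  by apply: sub => x; rewrite in_fset_set // in_setE.
rewrite leye_eq; apply/eqP/eqyP => r r0.
have [B BA Br] := infinite_set_fset (Num.truncn r).+1 nA.
apply: le_trans (sub B _); last by move=> x xB; apply: BA.
rewrite lee_fin; apply: le_trans (ltW (truncnS_gt r)) _; by rewrite ler_nat.
Qed.

End Counting.

Section ExtremalIndex.
Variables (R : realType) (n : nat).
Local Notation vec := 'cV[R]_n.
Variables (L : vec * vec -> R) (u vel acc force : R -> vec) (P Q S : R -> 'M[R]_n).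
Variables (l0 a b d : R) (um up : vec) (Pm Qm Sm Pp Qp Sp : 'M[R]_n).
Hypothesis L_smooth : smooth L.
Hypothesis C1_pos : forall i, C1 (fun t => u t i 0) (fun t => vel t i 0).
Hypothesis C1_vel : forall i, C1 (fun t => vel t i 0) (fun t => acc t i 0).
Hypothesis acc_continuous : forall i, continuous (fun t => acc t i 0).
Hypothesis forceDE : forall t i, force t i 0 = 'D_(dirq R i) L (u t, vel t).
Hypothesis PDE : forall t i j, P t i j = 'D_(dirv R i) ('D_(dirv R j) L) (u t, vel t).
Hypothesis QDE : forall t i j, Q t i j = 'D_(dirv R i) ('D_(dirq R j) L) (u t, vel t).
Hypothesis SDE : forall t i j, S t i j = 'D_(dirq R i) ('D_(dirq R j) L) (u t, vel t).
Hypothesis C1_momentum : forall i,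
  C1 (fun t => 'D_(dirv R i) L (u t, vel t)) (fun t => force t i 0).
Hypotheses (l0_gt0 : 0 < l0) (L_convex : forall (q v x : vec),
     l0 * dot x x <= dot (hess_vv L (q, v) *m x) x).
Hypotheses (u_cvgm : u t @[t --> -oo] --> um) (u_cvgp : u t @[t --> +oo] --> up).
Hypothesis u_nonconst : exists s t, u s <> u t.
Hypotheses (P_cvgm : P t @[t --> -oo] --> Pm) (P_cvgp : P t @[t --> +oo] --> Pp).
Hypotheses (Q_cvgm : Q t @[t --> -oo] --> Qm) (Q_cvgp : Q t @[t --> +oo] --> Qp).
Hypotheses (S_cvgm : S t @[t --> -oo] --> Sm) (S_cvgp : S t @[t --> +oo] --> Sp).
Hypotheses (posm : posdef (block_mx Pm Qm Qm^T Sm)) (posp : posdef (block_mx Pp Qp Qp^T Sp)).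
Hypotheses (a_gt0 : 0 < a) (b_ge0 : 0 <= b) (d_ge0 : 0 <= d).
Hypothesis P_lower : forall t y, a * dot y y <= dot (P t *m y) y.
Hypothesis Q_upper : forall t x, dot (Q t *m x) (Q t *m x) <= b * dot x x.
Hypothesis S_upper : forall t x, dot (S t *m x) (S t *m x) <= d * dot x x.

(** Otherwise uniqueness for the linearized equation makes the velocity vanish identically, against
    nonconstancy. *)
Lemma critical_acc t : vel t = 0 -> acc t <> 0.
Proof.
move=> vt at0; have [s [s' us]] := u_nonconst; apply: us.
have fE := forceE L_smooth C1_pos C1_vel acc_continuous PDE QDE C1_momentum.
have Cf := C1_force L_smooth C1_pos C1_vel acc_continuous forceDE QDE SDE.
have v0 := stationary_zero C1_vel fE Cf a_gt0 b_ge0 d_ge0 P_lower Q_upper S_upper vt at0.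
apply/colP => i; apply: (C1_zero_cst (C1_pos i)) => x; rewrite v0; exact: zerovec_coord.
Qed.

Lemma morse_index_critical (k : nat) (tau : 'I_k -> R) : injective tau ->
  (forall i, vel (tau i) = 0) -> (k%:R%:E <= morse_index (SLop P Q S))%E.
Proof.
move=> inj vtau.
have fE := forceE L_smooth C1_pos C1_vel acc_continuous PDE QDE C1_momentum.
have Cf := C1_force L_smooth C1_pos C1_vel acc_continuous forceDE QDE SDE.
have bounded := phase_bounded L_smooth C1_pos C1_vel acc_continuous forceDE C1_momentum
  l0_gt0 L_convex u_cvgm u_cvgp.
have [Bv HBv] := vel_bounded L_smooth C1_pos C1_vel acc_continuous forceDE C1_momentum
  l0_gt0 L_convex u_cvgm u_cvgp.
have Hf i : exists C, forall t, `|force t i 0| <= C.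
  have [C HC] := bounded _ (smooth_continuous (smooth_D (dirq R i) L_smooth)).
  by exists C => t; rewrite forceDE; exact: HC.
have [Bf HBf] := choice Hf.
pose B := \sum_i `|Bf i| + `|Bv|.
have vel_le t i : `|vel t i 0| <= B.
  apply: le_trans (HBv t i) _; apply: le_trans (ler_norm _) _.
  by rewrite /B lerDr sumr_ge0.
have force_le t i : `|force t i 0| <= B.
  apply: le_trans (HBf i t) _; apply: le_trans (ler_norm _) _.
  by rewrite /B (bigD1 i) //= -addrA lerDl addr_ge0 ?sumr_ge0.
have [dP CP] := hessP_C1b L_smooth C1_pos C1_vel acc_continuous forceDE PDE QDE C1_momentum
  l0_gt0 L_convex u_cvgm u_cvgp.
have [dQ CQ] := hessQ_C1b L_smooth C1_pos C1_vel acc_continuous forceDE PDE QDE C1_momentum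
  l0_gt0 L_convex u_cvgm u_cvgp.
have [dS CS] := hessS_C1b L_smooth C1_pos C1_vel acc_continuous forceDE PDE QDE SDE C1_momentum
  l0_gt0 L_convex u_cvgm u_cvgp.
have [bP _] := C1bmx_bmx CP; have [bQ _] := C1bmx_bmx CQ; have [bS _] := C1bmx_bmx CS.
have symP := hessP_sym L_smooth PDE; have symS := hessS_sym L_smooth SDE.
have CM := C1bmx_inv CP a_gt0 P_lower.
have [c [K [T [c0 K0 T0 coer]]]] := blockf_coercive P_cvgm P_cvgp Q_cvgm Q_cvgp S_cvgm S_cvgp
  posm posp a_gt0 b_ge0 d_ge0 P_lower Q_upper S_upper.
have D i : W12pair (trial vel acc (tau i)).
  exact: (trial_W12pair C1_vel acc_continuous fE Cf vel_le force_le c0 coer).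
have q0 i j : index_form P Q S (trial vel acc (tau i)) (trial vel acc (tau j)) = 0.
  exact: (index_form_trial_trial C1_vel acc_continuous fE Cf vel_le force_le bP bQ bS c0 coer).
(* At a zero of the velocity [force] reduces to P v', and [P] is positive definite. *)
have acc0 i : dot (force (tau i)) (acc (tau i)) != 0.
  rewrite fE vtau mulmx0 addr0 gt_eqF //; apply: lt_le_trans (P_lower _ _).
  apply: mulr_gt0 => //; rewrite lt_def dotxx_ge0 andbT dotxx_eq0.
  by apply/eqP; exact: critical_acc.
have ker cc := @trial_independent _ _ vel acc force P Q S c K T B C1_vel acc_continuous fE Cf
   vel_le force_le bP bQ bS c0 coer k tau cc inj acc0.
have [e [lam [lam0 eig orth]]] := eigen_family bP bQ bS symP symS c0 K0 T0 coer D q0 ker.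
apply: (morse_index_ge CP CQ CM bS _ lam0 eig orth) => t.
exact: mulVmx (coercive_unitmx a_gt0 (P_lower t)).
Qed.

End ExtremalIndex.

(** * Regularity of the curve and of its momentum *)

Section Curve.
Variables (R : realType) (n : nat).
Local Notation vec := 'cV[R]_n.

Lemma is_derive_coord (f : R -> vec) t df i : is_derive t (1 : R) f df ->
  is_derive t (1 : R) (fun s => f s i 0) (df i 0).
Proof.
move=> /is_deriveP H; apply/is_deriveP; have Hi := @cvg_coord _ _ _ _ _ _ i (dnbhs_filter _) H.
by apply: cvg_eq_fun Hi => h; rewrite scalevec_coord submx_coord.
Qed.

Lemma l2norm_dot (x : vec) : l2norm x ^+ 2 = dot x x.
Proof. exact: sqr_sqrtr (dotxx_ge0 x). Qed.

Lemma l2norm_le_dot (x y : vec) k : 0 <= k -> l2norm x <= k * l2norm y ->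
  dot x x <= k ^+ 2 * dot y y.
Proof.
move=> k0 H; rewrite -!l2norm_dot -exprMn ler_pXn2r // nnegrE ?sqrtr_ge0 //.
by rewrite mulr_ge0 ?sqrtr_ge0.
Qed.

Lemma Ck2_curve (u : R -> vec) : Ck 2 u -> exists acc : R -> vec, [/\
  forall i, C1 (fun t => u t i 0) (fun t => u^`() t i 0),
  forall i, C1 (fun t => u^`() t i 0) (fun t => acc t i 0) &
  forall i, continuous (fun t => acc t i 0)].
Proof.
move=> [_ /(_ 1)[du [cu /(_ 1)[dv [ca _]]]]].
have -> : u^`() = 'D_1 u by apply/funext => t; exact: derive1E.
exists ('D_1 ('D_1 u)); split=> i.
- exact: (vec_C1 du cu i).
- exact: (vec_C1 dv ca i).
- by move=> t; apply: cvg_coord; exact: ca.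
Qed.

(** Differentiability is the Euler-Lagrange equation read coordinatewise; the derivative is
    continuous because it is a partial derivative of [L] along a continuous phase curve. *)
Lemma momentum_C1 (L : vec * vec -> R) (u vel : R -> vec) : smooth L ->
  continuous u -> continuous vel ->
  (forall t, is_derive t (1 : R) (fun s => gradv L (u s, vel s)) (gradq L (u t, vel t))) ->
  forall i, C1 (fun t => 'D_(dirv R i) L (u t, vel t)) (fun t => gradq L (u t, vel t) i 0).
Proof.
move=> sL cu cv EL i.
have gq t : gradq L (u t, vel t) i 0 = 'D_(dirq R i) L (u t, vel t) by exact: mxE.
split=> t.
  have := is_derive_coord i (EL t).
  by congr (is_derive _ _ _ _); apply/funext => s; exact: gradvE.
apply: (cvg_eq_fun (fun t => esym (gq t))); rewrite gq.
have cD : continuous ('D_(dirq R i) L) by exact: smooth_continuous (smooth_D _ sL).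
exact: (phase_comp_continuous cu cv cD).
Qed.

End Curve.

Unset Implicit Arguments.
Theorem mainTheorem2 (R : realType) (n : nat)
  (L : 'cV[R]_n * 'cV[R]_n -> R) (l0 : R) (um up : 'cV[R]_n)
  (u : R -> 'cV[R]_n) (Pm Qm Rm Pp Qp Rp : 'M[R]_n) (C1 C2 C3 : R)
  (L_smooth : smooth L)
  (l0_gt0 : 0 < l0)
  (L_convex : forall (q v x : 'cV[R]_n),
     l0 * dot x x <= dot (hess_vv L (q, v) *m x) x)
  (um_crit : gradq L (um, 0) = 0 /\ gradv L (um, 0) = 0)
  (up_crit : gradq L (up, 0) = 0 /\ gradv L (up, 0) = 0)
  (u_C2 : Ck 2 u)
  (u_nonconst : exists s t, u s <> u t)
  (u_EL : EulerLagrange L u)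
  (u_cvgm : u t @[t --> -oo] --> um)
  (u_cvgp : u t @[t --> +oo] --> up)
  (P_cvgm : coefP L u t @[t --> -oo] --> Pm)
  (P_cvgp : coefP L u t @[t --> +oo] --> Pp)
  (Q_cvgm : coefQ L u t @[t --> -oo] --> Qm)
  (Q_cvgp : coefQ L u t @[t --> +oo] --> Qp)
  (R_cvgm : coefR L u t @[t --> -oo] --> Rm)
  (R_cvgp : coefR L u t @[t --> +oo] --> Rp)
  (C1_gt0 : 0 < C1) (C2_gt0 : 0 < C2) (C3_gt0 : 0 < C3)
  (P_ge : forall (t : R) (v : 'cV[R]_n),
     C1 * l2norm v ^+ 2 <= dot (coefP L u t *m v) v)
  (Q_le : forall (t : R) (v : 'cV[R]_n),
     l2norm (coefQ L u t *m v) <= C2 * l2norm v)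
  (R_le : forall (t : R) (v : 'cV[R]_n),
     l2norm (coefR L u t *m v) <= C3 * l2norm v)
  (posm : posdef (block_mx Pm Qm Qm^T Rm))
  (posp : posdef (block_mx Pp Qp Qp^T Rp)) :
  (counting [set t : R | u^`() t = 0%R]
     <= morse_index (SLop (coefP L u) (coefQ L u) (coefR L u)))%E.
Proof.
have [acc [Cu Cv ca]] := Ck2_curve u_C2.
apply: counting_le => k tau inj tau0.
have cu : continuous u by apply: vec_continuous => i; eexists; exact: Cu.
have cv : continuous (u^`()) by apply: vec_continuous => i; eexists; exact: Cv.
have momC := momentum_C1 L_smooth cu cv u_EL.
have fD t i : gradq L (u t, u^`() t) i 0 = 'D_(dirq R i) L (u t, u^`() t) by exact: mxE.
have PD t i j : coefP L u t i j = 'D_(dirv R i) ('D_(dirv R j) L) (u t, u^`() t) by exact: mxE.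
have QD t i j : coefQ L u t i j = 'D_(dirv R i) ('D_(dirq R j) L) (u t, u^`() t) by exact: mxE.
have SD t i j : coefR L u t i j = 'D_(dirq R i) ('D_(dirq R j) L) (u t, u^`() t) by exact: mxE.
have PL t y : C1 * dot y y <= dot (coefP L u t *m y) y by rewrite -l2norm_dot.
(* The estimates are formulated with squared Euclidean norms, hence the squares of the constants in
   (L1). *)
have QU t x : dot (coefQ L u t *m x) (coefQ L u t *m x) <= C2 ^+ 2 * dot x x.
  exact: l2norm_le_dot (ltW C2_gt0) (Q_le t x).
have SU t x : dot (coefR L u t *m x) (coefR L u t *m x) <= C3 ^+ 2 * dot x x.
  exact: l2norm_le_dot (ltW C3_gt0) (R_le t x).
exact: (morse_index_critical L_smooth Cu Cv ca fD PD QD SD momC l0_gt0 L_convex u_cvgm u_cvgp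
  u_nonconst P_cvgm P_cvgp Q_cvgm Q_cvgp R_cvgm R_cvgp posm posp C1_gt0
  (sqr_ge0 C2) (sqr_ge0 C3) PL QU SU inj tau0).
Qed.
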